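(* In the setting of the context, fix $\alpha>0$, let $\hat{\bm\eta}_{\mathrm{EB},\alpha}$ be the scaled EB hyper-parameter estimator, and assume conditions (i)–(iii) of the context hold for the cost function $\mathscr F_N=\mathscr F_{\mathrm{EB},\alpha}$. Define $$\bm\eta_{\mathrm b\star,\alpha}=\arg\min_{\bm\eta\in\mathcal D_{\bm\eta}}W_{\mathrm b,\alpha}(\bm\eta),\qquad W_{\mathrm b,\alpha}(\bm\eta)=\bm\theta_0^\top\mathbf P(\bm\eta)^{-1}\bm\theta_0+\alpha\log\det(\mathbf P(\bm\eta)),$$ $$[\mathbf A_{\mathrm b,\alpha}]_{k,l}=\bm\theta_0^\top\frac{\partial^2\mathbf P(\bm\eta)^{-1}}{\partial\eta_k\partial\eta_l}\bm\theta_0+\alpha\,\mathrm{Tr}\Big[\mathbf P(\bm\eta)^{-1}\frac{\partial^2\mathbf P(\bm\eta)}{\partial\eta_k\partial\eta_l}\Big]+\alpha\,\mathrm{Tr}\Big[\frac{\partial\mathbf P(\bm\eta)^{-1}}{\partial\eta_l}\frac{\partial\mathbf P(\bm\eta)}{\partial\eta_k}\Big],\qquad [\mathbf B_{\mathrm b}]_{k,:}=2\bm\theta_0^\top\frac{\partial\mathbf P(\bm\eta)^{-1}}{\partial\eta_k}.$$ Then $$\mathrm{XMSE}(\hat{\bm\theta}^{\mathrm R}(\hat{\bm\eta}_{\mathrm{EB},\alpha}))=\|\mathrm{XBias}\|_2^2+\mathrm{Tr}[\mathrm{XVar}]+\mathrm{Tr}[\mathrm{XVarHPE}],$$ where, with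 all functions of $\bm\eta$ evaluated at $\bm\eta=\bm\eta_{\mathrm b\star,\alpha}$, $$\mathrm{XBias}=-\sigma^2\mathbf\Sigma^{-1}\mathbf P(\bm\eta)^{-1}\bm\theta_0,\qquad \mathrm{XVar}=\mathrm{XVar}_\#+\mathrm{XVar}_\#^\top,\quad \mathrm{XVar}_\#=-(\sigma^2)^2\mathbf\Sigma^{-1}\mathbf P(\bm\eta)^{-1}\mathbf\Sigma^{-1},$$ $$\mathrm{XVarHPE}=\mathrm{XVarHPE}_\#+\mathrm{XVarHPE}_\#^\top,\qquad \mathrm{XVarHPE}_\#=-\sigma^2\,\mathbf b'_{\bm\eta,\star}(\bm\eta)\,\mathbf A_{\mathrm b,\alpha}^{-1}\,\mathbf B_{\mathrm b}\,\mathbf\Sigma^{-1},$$ and $\mathbf b'_{\bm\eta,\star}(\bm\eta)\in\mathbb R^{n\times p}$ has columns $[\mathbf b'_{\bm\eta,\star}(\bm\eta)]_{:,k}=-\sigma^2\mathbf\Sigma^{-1}\frac{\partial\mathbf P(\bm\eta)^{-1}}{\partial\eta_k}\bm\theta_0$.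
   Context: Model. Fix $n\ge1$, $\sigma^2>0$ (known) and the true parameter $\bm\theta_0\in\mathbb R^n$. For every sample size $N\ge n$ the data are $\bm Y=\mathbf\Phi\bm\theta_0+\bm E\in\mathbb R^N$ with $\bm E\sim\mathcal N(\bm 0,\sigma^2\mathbf I_N)$. Here $\mathbf\Phi=\mathbf\Phi_N\in\mathbb R^{N\times n}$ is the lower triangular Toeplitz matrix with first column $[u(0),\dots,u(N-1)]^\top$, i.e. $[\mathbf\Phi]_{t,k}=u(t-k)$, where the inputs $u(t)$ are deterministic and known with $u(t)=0$ for $t<0$; $\mathrm{rank}(\mathbf\Phi)=n$ for all $N\ge n$. Moreover $\lim_{N\to\infty}\mathbf\Phi^\top\mathbf\Phi/N=\mathbf\Sigma\succ0$. Estimators. $\mathrm{MSE}(\hat{\bm\theta})=\mathbb E[\|\hat{\bm\theta}-\bm\theta_0\|_2^2]$; $\hat{\bm\theta}^{\mathrm{ML}}=(\mathbf\Phi^\top\mathbf\Phi)^{-1}\mathbf\Phi^\top\bm Y$; $\mathrm{XMSE}(\hat{\bm\theta})=\lim_{N\to\infty}N^2[\mathrm{MSE}(\hat{\bm\theta})-\mathrm{MSE}(\hat{\bm\theta}^{\mathrm{ML}})]$. Let $\mathcal D_{\bm\eta}\subset\mathbb R^p$ be the hyper-parameter set. The kernel matrix $\mathbf P(\bm\eta)\in\mathbb R^{n\times n}$ is positive definite and twice continuously differentiable with respect to $\bm\eta$ in the interior of $\mathcal D_{\bm\eta}$. The kernel-based regularized estimator is $\hat{\bm\theta}^{\mathrm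 R}(\bm\eta)=[\mathbf\Phi^\top\mathbf\Phi+\sigma^2\mathbf P(\bm\eta)^{-1}]^{-1}\mathbf\Phi^\top\bm Y$. Scaled EB hyper-parameter estimator: $\hat{\bm\eta}_{\mathrm{EB},\alpha}=\arg\min_{\bm\eta\in\mathcal D_{\bm\eta}}\mathscr F_{\mathrm{EB},\alpha}(\bm\eta)$, $\mathscr F_{\mathrm{EB},\alpha}(\bm\eta)=\bm Y^\top\mathbf Q(\bm\eta)^{-1}\bm Y+\alpha\log\det\mathbf Q(\bm\eta)$, $\mathbf Q(\bm\eta)=\mathbf\Phi\mathbf P(\bm\eta)\mathbf\Phi^\top+\sigma^2\mathbf I_N$. Up to terms independent of $\bm\eta$, $\mathscr F_{\mathrm{EB},\alpha}(\bm\eta)$ equals $(\hat{\bm\theta}^{\mathrm{ML}})^\top\mathbf S(\bm\eta)^{-1}\hat{\bm\theta}^{\mathrm{ML}}+\alpha\log\det\mathbf S(\bm\eta)$ with $\mathbf S(\bm\eta)=\mathbf P(\bm\eta)+\sigma^2(\mathbf\Phi^\top\mathbf\Phi)^{-1}$, so $\hat{\bm\eta}_{\mathrm{EB},\alpha}$ is a function of $\hat{\bm\theta}^{\mathrm{ML}}$. Conditions on a cost function $\mathscr F_N(\hat{\bm\theta}^{\mathrm{ML}},\bm\eta)$ with minimizer $\hat{\bm\eta}(\hat{\bm\theta}^{\mathrm{ML}})=\arg\min_{\bm\eta\in\mathcal D_{\bm\eta}}\mathscr F_N(\hat{\bm\theta}^{\mathrm{ML}},\bm\eta)$: (i) $\mathcal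 D_{\bm\eta}$ is compact; (ii) $\partial\mathscr F_N(\hat{\bm\theta}^{\mathrm{ML}},\bm\eta)/\partial\bm\eta=\bm 0$ at $\bm\eta=\hat{\bm\eta}(\hat{\bm\theta}^{\mathrm{ML}})$; (iii) there exists $\widetilde{\mathscr F}_N(\hat{\bm\theta}^{\mathrm{ML}},\bm\eta)=a^{\mathscr F}(\hat{\bm\theta}^{\mathrm{ML}})\mathscr F_N(\hat{\bm\theta}^{\mathrm{ML}},\bm\eta)+b^{\mathscr F}(\hat{\bm\theta}^{\mathrm{ML}})$ with $a^{\mathscr F}>0$ and $b^{\mathscr F}$ independent of $\bm\eta$, such that $\sup_{\bm\eta\in\mathcal D_{\bm\eta}}|\widetilde{\mathscr F}_N(\bm\theta_0,\bm\eta)-W(\bm\theta_0,\bm\eta)|\to0$ as $N\to\infty$ for a nonzero deterministic function $W$; moreover, at $\bm\eta=\arg\min_{\bm\eta\in\mathcal D_{\bm\eta}}W(\bm\theta_0,\bm\eta)$, $\partial W(\bm\theta_0,\bm\eta)/\partial\bm\eta=\bm 0$ and $\partial^2W(\bm\theta_0,\bm\eta)/\partial\bm\eta\,\partial\bm\eta^\top\succ0$. (For $\mathscr F_{\mathrm{EB},\alpha}$ the limit is $W=W_{\mathrm b,\alpha}$.) $[\mathbf M]_{k,:}$ and $[\mathbf M]_{:,k}$ denote the $k$th row and column of $\mathbf M$; $\arg\min$ denotes the minimizer.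
   Formalization: The kernel matrix P(η) is additionally assumed continuous on all of the compact set D_η, including its boundary; with smoothness only in the interior the minimizers may approach a boundary discontinuity and the formula can fail. *)

(* Defs.v *)
From HB Require Import structures.
From mathcomp Require Import all_boot all_order all_algebra.
From mathcomp Require Import all_classical all_reals all_analysis.
Set Implicit Arguments.
Unset Strict Implicit.
Unset Printing Implicit Defensive.
Import Order.TTheory GRing.Theory Num.Theory.
Import numFieldNormedType.Exports.
Local Open Scope classical_set_scope.
Local Open Scope ring_scope.

Section LinearAlgebra.
Context {R : realType}.

Definition quad m (M : 'M[R]_m) (v : 'cV[R]_m) : R := (v^T *m M *m v) 0 0.

Definition sqnorm2 m (v : 'cV[R]_m) : R := \sum_i v i 0 ^+ 2.

Definition posdef m (M : 'M[R]_m) : Prop :=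
  M^T = M /\ forall v : 'cV[R]_m, v != 0 -> 0 < quad M v.

End LinearAlgebra.

Section Calculus.
Context {R : realType} {p : nat} {V : normedModType R}.

Definition partial (k : 'I_p) (f : 'rV[R]_p -> V) : 'rV[R]_p -> V :=
  'D_(delta_mx 0 k) f.

(* On an open set, this is the usual class C^2: existence and continuity of
   the partial derivatives of orders one and two. *)
Definition C2_on (U : set 'rV[R]_p) (f : 'rV[R]_p -> V) : Prop :=
  forall x, U x -> forall k : 'I_p,
    [/\ derivable f x (delta_mx 0 k),
        {for x, continuous (partial k f)} &
        forall l : 'I_p, derivable (partial k f) x (delta_mx 0 l) /\
                         {for x, continuous (partial l (partial k f))}].

End Calculus.

Section Optimization.
Context {R : realType} {p : nat}.

(* The gradient exists and vanishes; mere equality of the total operator 'D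
   with 0 would not imply existence. *)
Definition critical_point (f : 'rV[R]_p -> R) (x : 'rV[R]_p) : Prop :=
  forall k : 'I_p, is_derive x (delta_mx 0 k : 'rV[R]_p) f 0.

Definition hessian (f : 'rV[R]_p -> R) (x : 'rV[R]_p) : 'M[R]_p :=
  \matrix_(k, l) partial k (partial l f) x.

Definition is_minimizer (D : set 'rV[R]_p) (f : 'rV[R]_p -> R)
    (x : 'rV[R]_p) : Prop :=
  D x /\ forall y, D y -> f x <= f y.

Definition is_unique_minimizer (D : set 'rV[R]_p) (f : 'rV[R]_p -> R)
    (x : 'rV[R]_p) : Prop :=
  D x /\ forall y, D y -> y != x -> f x < f y.

End Optimization.

Section Conditions.
Context {R : realType} {n p : nat}.

(* [F N theta eta] is the cost at sample size N, seen as a function of the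
   maximum likelihood estimate theta and of the hyper-parameter eta; only the
   values at theta = theta0 enter the convergence. The supremum is taken in
   \bar R because the real-valued [sup] of an unbounded set is 0. *)
Definition affine_equiv_cvg (D : set 'rV[R]_p)
    (F : nat -> 'cV[R]_n -> 'rV[R]_p -> R) (W : 'rV[R]_p -> R)
    (theta0 : 'cV[R]_n) : Prop :=
  exists a b : nat -> 'cV[R]_n -> R,
    (forall N theta, 0 < a N theta) /\
    (fun N : nat => ereal_sup
       [set `|a N theta0 * F N theta0 eta + b N theta0 - W eta|%:E
         | eta in D]) @ \oo --> (0 : \bar R).

(* The derivatives of W are only meaningful in the interior of D, hence the
   requirement that the minimizer lie there. *)
Definition regular_minimum (D : set 'rV[R]_p) (W : 'rV[R]_p -> R)
    (eta : 'rV[R]_p) : Prop :=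
  [/\ is_unique_minimizer D W eta, D° eta, critical_point W eta &
      posdef (hessian W eta)].

End Conditions.

Section Model.
Context {R : realType} {n p : nat}.
Variables (sigma : R) (u : int -> R).

Definition regressor (N : nat) : 'M[R]_(N, n) :=
  \matrix_(t < N, k < n) u (t%:Z - k%:Z).

Definition theta_ML (N : nat) (y : 'cV[R]_N) : 'cV[R]_n :=
  let Phi := regressor N in invmx (Phi^T *m Phi) *m Phi^T *m y.

Definition theta_reg (K : 'M[R]_n) (N : nat) (y : 'cV[R]_N) : 'cV[R]_n :=
  let Phi := regressor N in
  invmx (Phi^T *m Phi + sigma ^+ 2 *: invmx K) *m Phi^T *m y.

Variables (alpha : R) (P : 'rV[R]_p -> 'M[R]_n).

Definition EB_cost (N : nat) (y : 'cV[R]_N) (eta : 'rV[R]_p) : R :=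
  let Phi := regressor N in
  let Q := Phi *m P eta *m Phi^T + (sigma ^+ 2)%:M in
  quad (invmx Q) y + alpha * ln (\det Q).

(* [EB_cost] up to terms independent of eta, as a function of the maximum
   likelihood estimate. *)
Definition EB_cost_ML (N : nat) (theta : 'cV[R]_n) (eta : 'rV[R]_p) : R :=
  let Phi := regressor N in
  let S := P eta + sigma ^+ 2 *: invmx (Phi^T *m Phi) in
  quad (invmx S) theta + alpha * ln (\det S).

Variable theta0 : 'cV[R]_n.

Definition W_b (eta : 'rV[R]_p) : R :=
  quad (invmx (P eta)) theta0 + alpha * ln (\det (P eta)).

Let invP (eta : 'rV[R]_p) : 'M[R]_n := invmx (P eta).

Definition A_b (eta : 'rV[R]_p) : 'M[R]_p :=
  \matrix_(k, l)
    (quad (partial k (partial l invP) eta) theta0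
     + alpha * \tr (invP eta *m partial k (partial l P) eta)
     + alpha * \tr (partial l invP eta *m partial k P eta)).

Definition B_b (eta : 'rV[R]_p) : 'M[R]_(p, n) :=
  \matrix_(k < p, j < n) (2 *: (theta0^T *m partial k invP eta)) 0 j.

Variable Sigma : 'M[R]_n.

Definition XBias (eta : 'rV[R]_p) : 'cV[R]_n :=
  - (sigma ^+ 2 *: (invmx Sigma *m invP eta *m theta0)).

Definition XVar_half (eta : 'rV[R]_p) : 'M[R]_n :=
  - ((sigma ^+ 2) ^+ 2 *: (invmx Sigma *m invP eta *m invmx Sigma)).

Definition XVar (eta : 'rV[R]_p) : 'M[R]_n := XVar_half eta + (XVar_half eta)^T.

Definition bias_jacobian (eta : 'rV[R]_p) : 'M[R]_(n, p) :=
  \matrix_(i < n, k < p)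
    (- (sigma ^+ 2 *: (invmx Sigma *m partial k invP eta *m theta0))) i 0.

Definition XVarHPE_half (eta : 'rV[R]_p) : 'M[R]_n :=
  - (sigma ^+ 2 *:
     (bias_jacobian eta *m invmx (A_b eta) *m B_b eta *m invmx Sigma)).

Definition XVarHPE (eta : 'rV[R]_p) : 'M[R]_n :=
  XVarHPE_half eta + (XVarHPE_half eta)^T.

End Model.

Arguments regressor {R} n u N.

Section Statistics.
Context d (T : measurableType d) {R : realType} (Pr : probability T R).

(* The law N(0, sigma^2 I_N) is the product of N copies of N(0, sigma^2); it is
   characterized by its values on measurable rectangles. The library's
   [normal_prob] takes the standard deviation as its second parameter. *)
Definition white_gaussian (N : nat) (sigma : R) (E : 'I_N -> {RV Pr >-> R}) :
    Prop :=
  forall A : 'I_N -> set R, (forall i, measurable (A i)) ->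
    Pr (\bigcap_i (E i @^-1` A i)) = (\prod_(i < N) normal_prob 0 sigma (A i))%E.

Context {n : nat}.

Definition is_random_vector (X : T -> 'cV[R]_n) : Prop :=
  forall i, measurable_fun setT (fun w => X w i 0).

Definition output (u : int -> R) (theta0 : 'cV[R]_n) (N : nat)
    (E : 'I_N -> {RV Pr >-> R}) (w : T) : 'cV[R]_N :=
  regressor n u N *m theta0 + \col_i E i w.

Definition MSE (theta0 : 'cV[R]_n) (est : T -> 'cV[R]_n) : \bar R :=
  'E_Pr[fun w => sqnorm2 (est w - theta0)]%E.

Definition scaled_excess_MSE (theta0 : 'cV[R]_n)
    (est est_ML : nat -> T -> 'cV[R]_n) (N : nat) : \bar R :=
  ((N%:R ^+ 2)%:E * (MSE theta0 (est N) - MSE theta0 (est_ML N)))%E.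

Definition XMSE (theta0 : 'cV[R]_n) (est est_ML : nat -> T -> 'cV[R]_n) :
    \bar R :=
  lim (scaled_excess_MSE theta0 est est_ML @ \oo).

End Statistics.

(* Main.v *)
Require Import Defs.
From HB Require Import structures.
From mathcomp Require Import all_boot all_order all_algebra.
From mathcomp Require Import all_classical all_reals all_analysis.
From mathcomp Require Import measurable_realfun normal_distribution.
From mathcomp Require Import ring lra.
Set Implicit Arguments.
Unset Strict Implicit.
Unset Printing Implicit Defensive.
Import Order.TTheory GRing.Theory Num.Theory.
Import numFieldNormedType.Exports.
Local Open Scope classical_set_scope.
Local Open Scope ring_scope.

(** Let [theta] be the maximum likelihood estimate and [delta] its error, a
    linear image of the noise with mean zero, covariance of order [1 / N] and
    fourth moments of order [1 / N^2] ([noise_image_mean], [noise_image_cov],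
    [noise_image_fourth]). The regularized estimate is
    [theta - sigma^2 Gram^-1 g] with
    [g = (P (eta_hat) + sigma^2 Gram^-1)^-1 theta] ([theta_regE]). With
    [q = (Gram / N)^-1 g], expanding the square gives for the scaled excess
    risk ([excess_risk_near])

      [sigma^4 E |q|^2 - 2 sigma^2 N E (delta . q)],

    the mean square of [delta] having cancelled. The first term tends to the
    squared bias as soon as [q] converges. The second one has a finite limit
    because [delta] is centered: with [q = v + H delta + remainder], where [v]
    and [H] are deterministic, only [N E (delta . H delta)], which is a trace,
    survives ([q_second_moment_cvg], [cross_moment_cvg]). Splitting the limit
    of [H] into the part at fixed hyper-parameter and the part due to its
    estimation gives the variance and the hyper-parameter terms
    ([limit_risk_decomposition]).

    It remains to expand [g] to first order in [delta], uniformly in [N]. The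
    cost depends on the data through [theta] only, up to a term free of [eta]
    ([EB_minimizer]), and on the sample size through the matrix
    [Z = sigma^2 Gram^-1], which tends to zero. A compactness argument gives
    that minimizers converge to [eta_star] when [Z] and [delta] are small
    ([minimizer_cvg]). They are critical points, and so is the minimizer for
    noiseless data; subtracting the two vanishing gradients and expanding
    gives the displacement of the minimizer, to first order
    [- A_b^-1 B_b delta], because [A_b] is the Hessian of the limit cost
    ([hessian_W], [critical_displacement], [regularized_expansion]). Comparing
    with the noiseless minimizer rather than with [eta_star] is essential: no
    rate is known for [Gram / N], so the former may approach the latter slowly,
    but this only changes the deterministic [v], which [delta] does not see.

    The expansion holds when [delta] is small. Elsewhere [g] grows at most
    linearly in [delta], since [P] is continuous and positive definite on a
    compact set, so the remainder is at most [eps |delta| + K |delta|^3]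
    everywhere ([g_remainder]), which the second and fourth moments control. *)

(** * Positive definite matrices and ridge regression *)

Section PositiveDefinite.
Context {R : realType}.
Implicit Types (m : nat).

Lemma quadD m (A B : 'M[R]_m) v : quad (A + B) v = quad A v + quad B v.
Proof. by rewrite /quad mulmxDr mulmxDl mxE. Qed.

Lemma quadZ m (c : R) (A : 'M[R]_m) v : quad (c *: A) v = c * quad A v.
Proof. by rewrite /quad -scalemxAr -scalemxAl mxE. Qed.

Lemma quadB m (A B : 'M[R]_m) v : quad (A - B) v = quad A v - quad B v.
Proof. by rewrite /quad mulmxBr mulmxBl !mxE. Qed.

Lemma quad1 m (v : 'cV[R]_m) : quad 1%:M v = sqnorm2 v.
Proof.
rewrite /quad mulmx1 mxE /sqnorm2; apply: eq_bigr => i _.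
by rewrite mxE expr2.
Qed.

Lemma sqnorm2_eq0 m (v : 'cV[R]_m) : sqnorm2 v = 0 -> v = 0.
Proof.
move=> /eqP; rewrite psumr_eq0 => [/allP v0|i _]; last exact: sqr_ge0.
apply/matrixP => i j; rewrite ord1 mxE; apply/eqP.
by rewrite -sqrf_eq0; apply: v0; rewrite mem_index_enum.
Qed.

Lemma sqnorm2_ge0 m (v : 'cV[R]_m) : 0 <= sqnorm2 v.
Proof. by apply: sumr_ge0 => i _; exact: sqr_ge0. Qed.

Lemma quad_mulmx m k (A : 'M[R]_m) (B : 'M[R]_(m, k)) v :
  quad A (B *m v) = quad (B^T *m A *m B) v.
Proof. by rewrite /quad trmx_mul !mulmxA. Qed.

Lemma posdef_unitmx m (A : 'M[R]_m) : posdef A -> A \in unitmx.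
Proof.
move=> [_ Apos]; rewrite unitmxE unitfE; apply/det0P => -[v v0 vA].
have := Apos v^T; rewrite /quad trmxK vA mul0mx mxE ltxx trmx_eq0.
by move/(_ v0).
Qed.

Lemma posdef1 m : posdef (1%:M : 'M[R]_m).
Proof.
split; first exact: tr_scalar_mx.
move=> v v0; rewrite quad1 lt_neqAle sqnorm2_ge0 andbT eq_sym.
by apply: contra_neq v0; exact: sqnorm2_eq0.
Qed.

Lemma posdefD m (A B : 'M[R]_m) : posdef A -> posdef B -> posdef (A + B).
Proof.
move=> [tA Apos] [tB Bpos]; split; first by rewrite linearD /= tA tB.
by move=> v v0; rewrite quadD addr_gt0 ?Apos ?Bpos.
Qed.

Lemma posdefZ m (c : R) (A : 'M[R]_m) : 0 < c -> posdef A -> posdef (c *: A).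
Proof.
move=> c0 [tA Apos]; split; first by rewrite linearZ /= tA.
by move=> v v0; rewrite quadZ mulr_gt0 ?Apos.
Qed.

Lemma posdef_invmx m (A : 'M[R]_m) : posdef A -> posdef (invmx A).
Proof.
move=> Apd; have Au := posdef_unitmx Apd; case: Apd => tA Apos; split.
  by rewrite trmx_inv tA.
move=> v v0; have := Apos (invmx A *m v); rewrite quad_mulmx.
rewrite -mulmxA mulmxV // mulmx1 trmx_inv tA; apply.
by apply: contra_neq v0 => v0; rewrite -[v](mulKVmx Au) v0 mulmx0.
Qed.

Lemma posdef_gram m k (B : 'M[R]_(k, m)) :
  \rank B = m -> posdef (B^T *m B).
Proof.
move=> rB; split; first by rewrite trmx_mul trmxK.
move=> v v0; have -> : quad (B^T *m B) v = sqnorm2 (B *m v).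
  by rewrite -quad1 quad_mulmx mulmx1.
rewrite lt_neqAle sqnorm2_ge0 andbT eq_sym.
apply: contra_neq v0 => /sqnorm2_eq0 Bv0.
have Bfree : row_free B^T by rewrite /row_free mxrank_tr rB.
apply: trmx_inj; rewrite trmx0; apply: (row_free_inj Bfree).
by rewrite mul0mx -trmx_mul Bv0 trmx0.
Qed.

(** The segment from the identity to [A] consists of positive definite, hence
    invertible, matrices, so the determinant cannot change sign along it. *)
Lemma posdef_det_gt0 m (A : 'M[R]_m) : posdef A -> 0 < \det A.
Proof.
move=> Apd.
pose q : {poly R} :=
  \det (map_mx polyC (1%:M : 'M[R]_m) + 'X *: map_mx polyC (A - 1%:M)).
have qE t : q.[t] = \det (1%:M + t *: (A - 1%:M)).
  rewrite -horner_evalE -det_map_mx; congr (\det _).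
  by apply/matrixP => i j; rewrite !mxE /= horner_evalE !hornerE.
have q_neq0 t : 0 <= t <= 1 -> q.[t] != 0.
  move=> /andP[t0 t1]; rewrite qE -unitfE -unitmxE; apply: posdef_unitmx.
  have -> : 1%:M + t *: (A - 1%:M) = (1 - t) *: 1%:M + t *: A.
    by rewrite scalerBr scalerBl scale1r addrA addrAC.
  have [->|tN0] := eqVneq t 0.
    by rewrite subr0 scale1r scale0r addr0; exact: posdef1.
  have t_gt0 : 0 < t by rewrite lt_def tN0.
  have [->|tN1] := eqVneq t 1.
    by rewrite subrr scale0r add0r scale1r.
  apply: posdefD; apply: posdefZ => //; last exact: posdef1.
  by rewrite subr_gt0 lt_neqAle tN1.
have q0 : q.[0] = 1 by rewrite qE scale0r addr0 det1.
have q1 : q.[1] = \det A by rewrite qE scale1r addrC subrK.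
rewrite -q1 ltNge; apply/negP => q1_le0.
have [|x x01 /rootP qx0] := @poly_ivt _ (- q) 0 1 ler01.
  by rewrite !hornerN q0 oppr_le0 ler01 oppr_ge0.
have /negP := q_neq0 x x01; apply; apply/eqP/oppr_inj.
by rewrite -hornerN qx0 oppr0.
Qed.

End PositiveDefinite.

Section DeterminantIdentities.
Context {R : fieldType}.

(** Both sides are the determinant of the same block matrix, eliminated in the
    two possible orders. *)
Lemma det_1D_mulmxC m k (A : 'M[R]_(m, k)) (B : 'M[R]_(k, m)) :
  \det (1%:M + A *m B) = \det (1%:M + B *m A).
Proof.
pose M := block_mx 1%:M (- A) B 1%:M : 'M[R]_(m + k).
have M1 : M = block_mx 1%:M 0 B 1%:M *m block_mx 1%:M (- A) 0 (1%:M + B *m A).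
  rewrite mulmx_block !mul1mx !mulmx0 !mulmx1 !mul0mx ?mul1mx !addr0.
  by rewrite mulmxN addrCA addNr addr0.
have M2 : M = block_mx (1%:M + A *m B) (- A) 0 1%:M *m block_mx 1%:M 0 B 1%:M.
  rewrite mulmx_block !mulmx1 !mul1mx ?mulmx0 ?mul0mx ?add0r.
  by rewrite mulNmx addrK.
have := congr1 determinant M1; rewrite M2 !det_mulmx !det_ublock !det_lblock.
by rewrite !det1 !mul1r !mulr1.
Qed.

End DeterminantIdentities.

Lemma invmx_uniq (R : comUnitRingType) m (A B : 'M[R]_m) :
  A *m B = 1%:M -> invmx A = B.
Proof.
by move=> AB; have [Au _] := mulmx1_unit AB; rewrite -[B](mulKmx Au) AB mulmx1.
Qed.

Section RidgeAlgebra.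
Context {R : realType} {n N : nat}.
Variables (s2 : R) (Phi : 'M[R]_(N, n)) (Gram K S : 'M[R]_n).
Hypotheses (s2_gt0 : 0 < s2) (GramE : Gram = Phi^T *m Phi).
Hypotheses (Gram_pd : posdef Gram) (K_pd : posdef K).
Hypothesis SE : S = K + s2 *: invmx Gram.

Let s2_neq0 : s2 != 0. Proof. exact: lt0r_neq0. Qed.
Let Gram_unit : Gram \in unitmx. Proof. exact: posdef_unitmx. Qed.
Let K_unit : K \in unitmx. Proof. exact: posdef_unitmx. Qed.

Lemma posdef_shift : posdef S.
Proof.
by rewrite SE; apply: posdefD => //; apply: posdefZ => //; exact: posdef_invmx.
Qed.

Let S_unit : S \in unitmx. Proof. exact: posdef_unitmx posdef_shift. Qed.

(** Push-through identity, from the factorization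
    [Gram + s2 *: invmx K = invmx K *m S *m Gram]. *)
Lemma invmx_ridge :
  invmx (Gram + s2 *: invmx K)
  = invmx Gram - s2 *: (invmx Gram *m invmx S *m invmx Gram).
Proof.
have E : (Gram + s2 *: invmx K)
   *m (invmx Gram - s2 *: (invmx Gram *m invmx S *m invmx Gram)) = 1%:M.
  have -> : Gram + s2 *: invmx K = invmx K *m S *m Gram.
    rewrite SE mulmxDr mulVmx // mulmxDl mul1mx -scalemxAr -scalemxAl.
    by rewrite -mulmxA mulVmx // mulmx1.
  rewrite mulmxBr -scalemxAr !mulmxA !(mulmxK Gram_unit) (mulmxK S_unit).
  by rewrite SE mulmxDr mulVmx // -scalemxAr addrK.
exact: invmx_uniq E.
Qed.

Variable y : 'cV[R]_N.
Let th := invmx Gram *m Phi^T *m y.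
Let Q := Phi *m K *m Phi^T + s2%:M.

Lemma ridge_shrinkage :
  invmx (Gram + s2 *: invmx K) *m Phi^T *m y
  = th - s2 *: (invmx Gram *m (invmx S *m th)).
Proof.
rewrite invmx_ridge mulmxBl mulmxBl /th.
by rewrite -!scalemxAl !mulmxA.
Qed.

(** Woodbury's identity: the inverse of an [N] by [N] matrix through that of an
    [n] by [n] one. *)
Lemma invmx_Q : invmx Q = s2^-1 *: (1%:M
  - Phi *m invmx (Gram + s2 *: invmx K) *m Phi^T).
Proof.
set J := Gram + s2 *: invmx K.
have J_unit : J \in unitmx.
  apply/posdef_unitmx/posdefD => //; apply: posdefZ => //.
  exact: posdef_invmx.
have E : Q *m (s2^-1 *: (1%:M - Phi *m invmx J *m Phi^T)) = 1%:M.
  rewrite -scalemxAr mulmxBr mulmx1 /Q mulmxDl mul_scalar_mx.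
  have -> : Phi *m K *m Phi^T *m (Phi *m invmx J *m Phi^T)
    = Phi *m (K *m Gram *m invmx J) *m Phi^T by rewrite GramE !mulmxA.
  have -> : K *m Gram *m invmx J = K - s2 *: invmx J.
    have -> : K *m Gram = K *m J - s2%:M.
      by rewrite mulmxDr -scalemxAr mulmxV // scalemx1 addrK.
    by rewrite mulmxBl mulmxK // mul_scalar_mx.
  rewrite mulmxBr mulmxBl -scalemxAr -scalemxAl subrK addrAC subrr add0r.
  by rewrite scale_scalar_mx mulVf.
exact: invmx_uniq E.
Qed.

(** The residual [y - Phi *m th] is orthogonal to the columns of [Phi], so [Q]
    acts on it as the scalar [s2]; the fitted part [Phi *m th] only sees [S]. *)
Lemma quad_invmx_Q :
  quad (invmx Q) y = quad (invmx S) th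
    + s2^-1 * (sqnorm2 y - quad Gram th).
Proof.
have Gth : Phi^T *m y = Gram *m th.
  by rewrite /th !mulmxA mulmxV // mul1mx.
have tG : Gram^T = Gram by case: Gram_pd.
rewrite invmx_Q quadZ quadB quad1.
have -> : quad (Phi *m invmx (Gram + s2 *: invmx K) *m Phi^T) y
  = quad (invmx (Gram + s2 *: invmx K)) (Gram *m th).
  by rewrite -Gth quad_mulmx trmxK.
rewrite quad_mulmx tG invmx_ridge mulmxBr mulmxBl mulmxV // mul1mx.
rewrite -scalemxAr -scalemxAl !mulmxA mulmxV // mul1mx mulmxKV //.
rewrite quadB quadZ.
by field.
Qed.

(** [det_1D_mulmxC] turns the [N] by [N] determinant into an [n] by [n] one. *)
Lemma det_Q : \det Q = s2 ^+ N / s2 ^+ n * \det Gram * \det S.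
Proof.
have -> : Q = s2 *: (1%:M + (s2^-1 *: (Phi *m K)) *m Phi^T).
  by rewrite scalerDr scalemx1 -scalemxAl scalerA divff // scale1r addrC.
rewrite detZ det_1D_mulmxC -scalemxAr mulmxA -GramE.
have -> : 1%:M + s2^-1 *: (Gram *m K) = s2^-1 *: (Gram *m S).
  rewrite SE mulmxDr scalerDr addrC -scalemxAr mulmxV // scalerA mulVf //.
  by rewrite scale1r.
by rewrite detZ det_mulmx exprVn !mulrA.
Qed.

Lemma marginal_costE alpha :
  quad (invmx Q) y + alpha * ln (\det Q)
  = quad (invmx S) th + alpha * ln (\det S)
    + (s2^-1 * (sqnorm2 y - quad Gram th)
       + alpha * ln (s2 ^+ N / s2 ^+ n * \det Gram)).
Proof.
rewrite quad_invmx_Q det_Q lnM ?posrE //; last 2 first.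
- by rewrite mulr_gt0 ?divr_gt0 ?exprn_gt0 // posdef_det_gt0.
- exact: posdef_det_gt0 posdef_shift.
by ring.
Qed.

End RidgeAlgebra.

Section EstimatorAlgebra.
Context {R : realType} {n N : nat}.
Variables (sigma : R) (u : int -> R).
Hypothesis sigma_gt0 : 0 < sigma.
Local Notation Phi := (regressor n u N).
Local Notation Gram := (Phi^T *m Phi).
Hypothesis rkPhi : \rank Phi = n.

Let Gram_pd : posdef Gram. Proof. exact: posdef_gram. Qed.
Let s2_gt0 : 0 < sigma ^+ 2. Proof. exact: exprn_gt0. Qed.

(** Regularization moves the maximum likelihood estimate by [invmx Gram] times
    a bounded vector: this is where the rate of the excess risk comes from. *)
Lemma theta_regE K (y : 'cV[R]_N) : posdef K ->
  theta_reg sigma u K y = theta_ML u y - sigma ^+ 2 *: (invmx Gram *m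
    (invmx (K + sigma ^+ 2 *: invmx Gram) *m theta_ML u y)) :> 'cV[R]_n.
Proof. by move=> Kpd; exact: ridge_shrinkage. Qed.

(** The empirical Bayes cost and its expression through the maximum likelihood
    estimate differ by a term free of [eta], hence have the same minimizers. *)
Lemma EB_minimizer (p : nat) (D : set 'rV[R]_p) (P : 'rV[R]_p -> 'M[R]_n)
    (alpha : R) (y : 'cV[R]_N) (eta : 'rV[R]_p) :
  (forall x, D x -> posdef (P x)) ->
  is_minimizer D (EB_cost sigma u alpha P y) eta ->
  is_minimizer D (EB_cost_ML sigma u alpha P N (theta_ML u y)) eta.
Proof.
move=> Ppd [Deta min]; split=> // x Dx; have := min x Dx.
have costE z (Dz : D z) := marginal_costE s2_gt0 (erefl Gram) Gram_pd
  (Ppd z Dz) (erefl _) y alpha.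
by rewrite /EB_cost /EB_cost_ML !costE // lerD2r.
Qed.

Lemma theta_ML_output (theta0 : 'cV[R]_n) (e : 'cV[R]_N) :
  theta_ML u (Phi *m theta0 + e) = theta0 + invmx Gram *m Phi^T *m e.
Proof.
rewrite /theta_ML mulmxDr; congr (_ + _).
by rewrite mulmxA -(mulmxA _ _ Phi) mulVmx ?mul1mx // posdef_unitmx.
Qed.

(** The estimation error is the image of the noise by [L], so this is its
    covariance up to the factor [sigma ^+ 2]. *)
Lemma ML_gain_gram (L := invmx Gram *m Phi^T) : L *m L^T = invmx Gram.
Proof.
have [tG _] := Gram_pd.
rewrite /L trmx_mul trmxK trmx_inv tG mulmxA -(mulmxA (invmx _)).
by rewrite mulVmx ?mul1mx // posdef_unitmx.
Qed.

End EstimatorAlgebra.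

(** * Moments of the normal law *)

Section RealIntegrable.
Context d (T : measurableType d) {R : realType}.
Variable mu : {finite_measure set T -> \bar R}.
Implicit Types f g : T -> R.
Local Notation integrable f := (mu.-integrable setT (EFin \o (f : T -> R))).

Lemma integrable_measurable f : integrable f -> measurable_fun setT f.
Proof. by move=> /integrableP[/measurable_EFinP]. Qed.

Lemma integrable_addr f g : integrable f -> integrable g ->
  integrable (fun w => f w + g w).
Proof. by move=> fi gi; exact: (integrableD measurableT fi gi). Qed.

Lemma integrable_subr f g : integrable f -> integrable g ->
  integrable (fun w => f w - g w).
Proof. by move=> fi gi; exact: (integrableB measurableT fi gi). Qed.

Lemma integrable_scaler (c : R) f : integrable f ->
  integrable (fun w => c * f w).
Proof. by move=> fi; exact: (integrableZl measurableT c fi). Qed.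

Lemma integrable_constr (c : R) : integrable (fun=> c).
Proof. exact: finite_measure_integrable_cst. Qed.

Lemma integrable_dominated f g : measurable_fun setT f -> integrable g ->
  (forall w, `|f w| <= g w) -> integrable f.
Proof.
move=> mf gi fg; apply: le_integrable gi => //; first exact/measurable_EFinP.
by move=> w _; rewrite lee_fin (le_trans (fg w)) // ler_norm.
Qed.

Lemma integrable_bigsum I (r : seq I) (f : I -> T -> R) :
  (forall i, integrable (f i)) -> integrable (fun w => \sum_(i <- r) f i w).
Proof.
move=> fi; elim: r => [|i r IH].
  under eq_fun do rewrite big_nil; exact: integrable_constr.
by under eq_fun do rewrite big_cons; exact: integrable_addr.
Qed.

Lemma Rintegral_bigsum I (r : seq I) (f : I -> T -> R) :
  (forall i, integrable (f i)) ->
  \int[mu]_w (\sum_(i <- r) f i w) = \sum_(i <- r) \int[mu]_w f i w.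
Proof.
move=> fi; elim: r => [|i r IH].
  by rewrite big_nil; under eq_Rintegral do rewrite big_nil; rewrite Rintegral_cst // mul0r.
under eq_Rintegral do rewrite big_cons.
by rewrite big_cons RintegralD // ?IH //; exact: integrable_bigsum.
Qed.

End RealIntegrable.

Section ExponentialTaylor.
Context {R : realType}.

(** One step of integration of a pointwise bound on the derivative, through the
    mean value theorem. *)
Lemma iterated_expR_bound (f df : R -> R) (k : nat) :
  f 0 = 0 -> (forall x : R, is_derive x (1 : R) f (df x)) ->
  (forall x, `|df x| <= `|x| ^+ k * expR `|x|) ->
  forall x, `|f x| <= `|x| ^+ k.+1 * expR `|x|.
Proof.
move=> f0 fdf dfle x.
have cf : continuous f.
  by move=> z; apply/differentiable_continuous/derivable1_diffP; have [] := fdf z.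
have mono c : `|c| <= `|x| -> `|df c * x| <= `|x| ^+ k.+1 * expR `|x|.
  move=> cx; rewrite normrM exprSr mulrAC ler_wpM2r //.
  apply: le_trans (dfle c) _; apply: ler_pM => //.
  - by apply: lerXn2r; rewrite ?nnegrE.
  - by rewrite ler_expR.
have [x0|x0] := leP 0 x.
  have [c c0x] := MVT_segment x0 (fun z _ => fdf z) (continuous_subspaceT cf).
  rewrite f0 !subr0 => ->; apply: mono.
  by move: c0x; rewrite in_itv /= => /andP[c0 cx]; rewrite !ger0_norm.
have [c c0x] := MVT_segment (ltW x0) (fun z _ => fdf z) (continuous_subspaceT cf).
rewrite f0 !sub0r mulrN => /oppr_inj ->.
apply: mono; move: c0x; rewrite in_itv /= => /andP[xc c0].
by rewrite !ler0_norm ?lerN2 // ltW.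
Qed.

Lemma expR_sub1_bound (x : R) : `|expR x - 1| <= `|x| * expR `|x|.
Proof.
rewrite -[X in X * _]expr1; move: x; apply: iterated_expR_bound.
- by rewrite expR0 subrr.
- by move=> x; rewrite subr0 expr0 mul1r ger0_norm ?expR_ge0 // ler_expR ler_norm.
Qed.

Lemma expR_taylor1_bound (x : R) : `|expR x - 1 - x| <= x ^+ 2 * expR `|x|.
Proof.
rewrite -real_normK ?num_real //; move: x.
apply: (@iterated_expR_bound (fun x => expR x - 1 - x)).
- by rewrite expR0 !subrr.
- by move=> x; rewrite subr0 expr1; exact: expR_sub1_bound.
Qed.

Lemma expR_taylor2_bound (x : R) :
  `|expR x - 1 - x - x ^+ 2 / 2| <= `|x| ^+ 3 * expR `|x|.
Proof.
move: x; apply: (@iterated_expR_bound (fun x => expR x - 1 - x - x ^+ 2 / 2)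
  (fun x => expR x - 1 - x)).
- by rewrite expR0 expr0n mul0r !subrr.
- move=> x; apply: is_derive_eq.
  by rewrite /GRing.scale /=; field.
- by move=> x; rewrite real_normK ?num_real //; exact: expR_taylor1_bound.
Qed.

Lemma expRabs_le (x : R) : expR `|x| <= expR x + expR (- x).
Proof.
have [x0|x0] := leP 0 x; first by rewrite ger0_norm // lerDl expR_ge0.
by rewrite ltr0_norm // lerDr expR_ge0.
Qed.

Lemma pow_le_expR (x : R) n : `|x| ^+ n.+1 <= n.+1`!%:R * expR `|x|.
Proof.
have := @expR_ge1Dxn R `|x| n (normr_ge0 _).
rewrite -ler_pdivrMl ?ltr0n ?fact_gt0 // mulrC; apply: le_trans.
by rewrite lerDr.
Qed.

Lemma eq0_of_linear_bound (a K : R) :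
  (forall t, 0 < t <= 1 -> `|a| <= K * t) -> a = 0.
Proof.
move=> aK; apply/eqP; rewrite -normr_eq0; apply/eqP/le_anti.
rewrite normr_ge0 andbT; apply/ler_addgt0Pl => e e0; rewrite addr0.
have K1 : 0 < `|K| + 1 by rewrite ltr_wpDl.
pose t := Num.min 1 (e / (`|K| + 1)).
have t0 : 0 < t by rewrite lt_min ltr01 divr_gt0.
apply: le_trans (aK t _) _; first by rewrite t0 ge_min lexx.
apply: (@le_trans _ _ ((`|K| + 1) * t)).
  by rewrite ler_pM2r // (le_trans (ler_norm K)) // lerDl.
by rewrite mulrC -ler_pdivlMr // ge_min lexx orbT.
Qed.

End ExponentialTaylor.

Section NormalMoments.
Context {R : realType}.
Variable s : R.
Hypothesis s_gt0 : 0 < s.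
Local Notation mu := (@lebesgue_measure R).
Local Notation gam := (normal_prob 0 s : probability (measurableTypeR R) R).

Let s_neq0 : s != 0. Proof. exact: lt0r_neq0. Qed.

Lemma ge0_integral_normal_prob (f : R -> R) :
  (forall x, 0 <= f x) -> measurable_fun setT f ->
  (\int[gam]_x (f x)%:E = \int[mu]_x (f x * normal_pdf 0 s x)%:E)%E.
Proof.
move=> f0 mf.
have dom := normal_prob_dominates 0 s.
rewrite -(@Radon_Nikodym_SigmaFinite.change_of_variables _ _ _ gam mu dom
  (fun x => (f x)%:E)) //; last exact/measurable_EFinP.
apply: ae_eq_integral => //.
- apply: emeasurable_funM; first exact/measurable_EFinP.
  by apply: (measurable_int mu); exact: Radon_Nikodym_SigmaFinite.f_integrable.
- apply/measurable_EFinP/measurable_funM => //.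
  exact: measurable_normal_pdf.
- under [X in ae_eq _ _ _ X]eq_fun do rewrite EFinM.
  apply: ae_eqe_mul2l; apply: integral_ae_eq => //.
  + exact: Radon_Nikodym_SigmaFinite.f_integrable.
  + by apply/measurable_EFinP; exact: measurable_normal_pdf.
  + move=> A _ mA.
    by rewrite -Radon_Nikodym_SigmaFinite.f_integral.
Qed.

(** Completing the square turns [expR (t * x)] times the centered density into
    a multiple of the density centered at [s ^+ 2 * t]. *)
Lemma normal_mgf (t : R) :
  (\int[gam]_x (expR (t * x))%:E = (expR (s ^+ 2 * t ^+ 2 / 2))%:E)%E.
Proof.
rewrite ge0_integral_normal_prob; last 2 first.
- by move=> x; exact: expR_ge0.
- by apply: measurableT_comp => //; exact: measurable_funM.
have sq x : expR (t * x) * normal_pdf 0 s x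
  = expR (s ^+ 2 * t ^+ 2 / 2) * normal_pdf (s ^+ 2 * t) s x.
  rewrite !normal_pdfE // mulrCA [RHS]mulrCA; congr (_ * _).
  rewrite /normal_fun -!expRD; congr expR; field.
  by rewrite s_neq0.
under eq_integral do rewrite sq EFinM.
rewrite ge0_integralZl //; first by rewrite integral_normal_pdf mule1.
- by apply/measurable_EFinP; exact: measurable_normal_pdf.
- by move=> x _; rewrite lee_fin; exact: normal_pdf_ge0.
Qed.

Lemma normal_integrable_expR (t : R) :
  gam.-integrable setT (EFin \o (fun x => expR (t * x))).
Proof.
apply/integrableP; split.
  by apply/measurable_EFinP; apply: measurableT_comp => //; exact: measurable_funM.
under eq_integral do rewrite /= ger0_norm ?expR_ge0 //.
by rewrite normal_mgf ltry.
Qed.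

Lemma normal_integrable_bound (f : R -> R) (C t : R) :
  measurable_fun setT f -> (forall x, `|f x| <= C * expR `|t * x|) ->
  gam.-integrable setT (EFin \o f).
Proof.
move=> mf fle.
pose g (x : R) := `|C| * (expR (t * x) + expR (- t * x)).
have gi : gam.-integrable setT (EFin \o g).
  have -> : EFin \o g = (fun x => `|C|%:E * ((EFin \o (fun x => expR (t * x))) x
      + (EFin \o (fun x => expR (- t * x))) x))%E by [].
  by apply: integrableZl => //; apply: integrableD => //; exact: normal_integrable_expR.
apply: le_integrable gi => //; first exact/measurable_EFinP.
move=> x _; rewrite /= lee_fin; apply: le_trans (fle x) _.
have g0 : 0 <= g x by rewrite mulr_ge0 // addr_ge0 // expR_ge0.
rewrite [leRHS]ger0_norm //; apply: (@le_trans _ _ (`|C| * expR `|t * x|)).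
  by rewrite ler_wpM2r ?expR_ge0 // ler_norm.
by rewrite ler_wpM2l // mulNr expRabs_le.
Qed.

Lemma normal_integrable_pow n :
  gam.-integrable setT (EFin \o (fun x : R => x ^+ n)).
Proof.
apply: (@normal_integrable_bound _ n`!%:R 1); first exact: measurable_funX.
move=> x; rewrite mul1r normrX; case: n => [|n]; last exact: pow_le_expR.
by rewrite expr0 fact0 mul1r -[leLHS]expR0 ler_expR.
Qed.

(** The moments are the Taylor coefficients at [0] of the moment generating
    function: integrating the bound on the remainder of the exponential series
    shows that both expansions in [t] agree up to a multiple of [t ^+ 3]. *)
Lemma normal_moments :
  \int[gam]_x x = 0 :> R /\ \int[gam]_x (x ^+ 2) = s ^+ 2 :> R.
Proof.
set m1 := (X in X = 0 /\ _); set m2 := (X in _ /\ X = _).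
pose h (x : R) := `|x| ^+ 3 * expR `|x|.
have mh : measurable_fun setT h.
  apply: measurable_funM; last by apply: measurableT_comp => //; exact: normr_measurable.
  by apply: measurable_funX; exact: normr_measurable.
have hi : gam.-integrable setT (EFin \o h).
  apply: (@normal_integrable_bound _ 3`!%:R 2) => // x.
  rewrite normrM normrX normr_id [`|expR _|]ger0_norm ?expR_ge0 //.
  have -> : `|2 * x| = `|x| + `|x| by rewrite normrM ger0_norm // mulr_natl.
  rewrite expRD mulrA.
  by rewrite ler_wpM2r ?expR_ge0 // pow_le_expR.
pose K := \int[gam]_x h x.
have xi : gam.-integrable setT (EFin \o (fun x : R => x)).
  exact: normal_integrable_pow 1.
have x2i := normal_integrable_pow 2.
have key t : 0 < t <= 1 ->
   `|expR (s ^+ 2 * t ^+ 2 / 2) - 1 - t * m1 - t ^+ 2 / 2 * m2| <= K * t ^+ 3.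
  move=> /andP[t0 t1].
  pose r (x : R) := expR (t * x) - 1 - t * x - (t * x) ^+ 2 / 2.
  have ti : gam.-integrable setT (EFin \o (fun x : R => t * x)).
    exact: integrable_scaler.
  have t2i : gam.-integrable setT (EFin \o (fun x : R => t ^+ 2 / 2 * x ^+ 2)).
    exact: integrable_scaler.
  have e1i : gam.-integrable setT (EFin \o (fun x : R => expR (t * x) - 1)).
    apply: integrable_subr; first exact: normal_integrable_expR.
    exact: integrable_constr.
  have e2i : gam.-integrable setT (EFin \o (fun x : R => expR (t * x) - 1 - t * x)).
    exact: integrable_subr.
  have rE : \int[gam]_x r x
    = expR (s ^+ 2 * t ^+ 2 / 2) - 1 - t * m1 - t ^+ 2 / 2 * m2.
    transitivity (\int[gam]_x (expR (t * x) - 1 - t * x - t ^+ 2 / 2 * x ^+ 2)).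
      by apply: eq_Rintegral => x _; rewrite /r exprMn mulrAC.
    rewrite RintegralB // RintegralB // RintegralB //; last 2 first.
    - exact: normal_integrable_expR.
    - exact: integrable_constr.
    rewrite RintegralZl // RintegralZl // Rintegral_cst //.
    by rewrite [in X in X - _ - _ - _]/Rintegral normal_mgf /= probability_setT /= mulr1.
  rewrite -rE.
  have ri : gam.-integrable setT (EFin \o r).
    have -> : r = (fun x : R => expR (t * x) - 1 - t * x - t ^+ 2 / 2 * x ^+ 2).
      by apply/funext => x; rewrite /r exprMn mulrAC.
    exact: integrable_subr.
  apply: le_trans (le_normr_Rintegral _ _) _ => //.
  rewrite mulrC -RintegralZl //; apply: le_Rintegral => //.
  - exact: integrable_norm.
  - exact: integrable_scaler.
  move=> x _; apply: le_trans (expR_taylor2_bound _) _.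
  rewrite /h mulrA -exprMn normrM (gtr0_norm t0) ler_wpM2l //.
    by rewrite exprn_ge0 // mulr_ge0 // ltW.
  by rewrite ler_expR ler_piMl.
(* Remainder of order two of [expR (s ^+ 2 * t ^+ 2 / 2)]; it is of order
   [t ^+ 4], hence at most a multiple of [t ^+ 3] on the unit interval. *)
pose C := (s ^+ 2 / 2) ^+ 2 * expR (s ^+ 2 / 2).
have key2 t : 0 < t <= 1 ->
   `|t * m1 + t ^+ 2 / 2 * (m2 - s ^+ 2)| <= (K + C) * t ^+ 3.
  move=> t01; have /andP[t0 t1] := t01.
  pose z := s ^+ 2 * t ^+ 2 / 2.
  have -> : t * m1 + t ^+ 2 / 2 * (m2 - s ^+ 2) =
    (expR z - 1 - z) - (expR z - 1 - t * m1 - t ^+ 2 / 2 * m2).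
    by rewrite /z; field.
  apply: le_trans (ler_normB _ _) _.
  rewrite addrC mulrDl lerD // ?key //.
  apply: le_trans (expR_taylor1_bound z) _.
  have s20 : 0 <= s ^+ 2 / 2 by rewrite divr_ge0 // sqr_ge0.
  have z0 : 0 <= z by rewrite /z mulrAC mulr_ge0 // sqr_ge0.
  have zs : z <= s ^+ 2 / 2.
    by rewrite /z mulrAC ler_piMr // expr_le1 // ltW.
  rewrite /C ger0_norm // [leRHS]mulrAC.
  apply: ler_pM; rewrite ?sqr_ge0 ?expR_ge0 // ?ler_expR //.
  rewrite /z mulrAC exprMn ler_wpM2l ?sqr_ge0 // -exprM.
  by apply: ler_wiXn2l => //; exact: ltW.
(* Divide by [t], then by [t ^+ 2 / 2] once the first coefficient is gone. *)
have m10 : m1 = 0.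
  apply: (@eq0_of_linear_bound _ _ (`|K + C| + `|m2 - s ^+ 2| / 2)) => t t01.
  have /andP[t0 t1] := t01.
  have := key2 t t01; set b := m2 - s ^+ 2 => kt.
  rewrite -(ler_pM2l t0) -[X in X * `|m1|](gtr0_norm t0) -normrM.
  have -> : t * m1 = (t * m1 + t ^+ 2 / 2 * b) - t ^+ 2 / 2 * b by ring.
  apply: le_trans (ler_normB _ _) _.
  rewrite [leRHS]mulrC !mulrDl lerD //.
    apply: le_trans kt _; apply: (@le_trans _ _ (`|K + C| * t ^+ 3)).
      by rewrite ler_wpM2r ?ler_norm // exprn_ge0 // ltW.
    rewrite -mulrA ler_wpM2l // exprS ler_pM2l // expr2 ler_piMl // ltW //.
  rewrite normrM ger0_norm; last by rewrite divr_ge0 // sqr_ge0.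
  by rewrite le_eqVlt; apply/orP; left; apply/eqP; field.
split=> //; apply/eqP; rewrite -subr_eq0; apply/eqP.
apply: (@eq0_of_linear_bound _ _ (2 * (K + C))) => t t01.
have /andP[t0 t1] := t01.
have := key2 t t01; rewrite m10 mulr0 add0r normrM ger0_norm; last first.
  by rewrite divr_ge0 // sqr_ge0.
set b := `|_| => kt.
have t20 : 0 < t ^+ 2 / 2 by rewrite divr_gt0 // exprn_gt0.
rewrite -(ler_pM2l t20); apply: le_trans kt _.
by rewrite le_eqVlt; apply/orP; left; apply/eqP; field.
Qed.

End NormalMoments.

(** * Linear images of Gaussian white noise *)

Section Independence.
Context d (T : measurableType d) {R : realType} (Pr : probability T R).
Implicit Types X Y : T -> R.
Local Notation integrable f := (Pr.-integrable setT (EFin \o (f : T -> R))).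

Definition independent2 X Y : Prop :=
  forall A B : set R, measurable A -> measurable B ->
    Pr (X @^-1` A `&` Y @^-1` B) = (Pr (X @^-1` A) * Pr (Y @^-1` B))%E.

Lemma independent2_comp X Y (f g : R -> R) :
  measurable_fun setT f -> measurable_fun setT g ->
  independent2 X Y -> independent2 (f \o X) (g \o Y).
Proof.
move=> mf mg XY A B mA mB; apply: (XY (f @^-1` A) (g @^-1` B)).
- by rewrite -[X in measurable X]setTI; exact: mf.
- by rewrite -[X in measurable X]setTI; exact: mg.
Qed.

(** Independence says that the joint law of [X] and [Y] is the product of
    their laws, to which Fubini's theorem applies. *)
Lemma independent2_integral X Y :
  independent2 X Y -> integrable X -> integrable Y ->
  integrable (fun w => X w * Y w) /\
  \int[Pr]_w (X w * Y w) = (\int[Pr]_w X w) * (\int[Pr]_w Y w).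
Proof.
move=> XY iX iY.
have mX := integrable_measurable iX; have mY := integrable_measurable iY.
pose X' : {mfun T >-> R} := HB.pack X (isMeasurableFun.Build _ _ _ _ X mX).
pose Y' : {mfun T >-> R} := HB.pack Y (isMeasurableFun.Build _ _ _ _ Y mY).
have mXY : measurable_fun setT (fun w => (X w, Y w)).
  exact: measurable_fun_pair.
pose Z' : {mfun T >-> (R * R)%type} :=
  HB.pack (fun w => (X w, Y w)) (isMeasurableFun.Build _ _ _ _ _ mXY).
pose mx := distribution Pr X'; pose my := distribution Pr Y'.
have jointE : forall A, measurable A -> (mx \x my)%E A = distribution Pr Z' A.
  apply: product_measure_unique => A B mA mB.
  rewrite /mx /my /distribution /pushforward /= -XY //; congr (Pr _).
have mM : measurable_fun setT (fun z : R * R => z.1 * z.2).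
  exact: measurable_funM.
have absX : (\int[mx]_x `|x|%:E = \int[Pr]_w `|X w|%:E)%E.
  rewrite ge0_integral_distribution //.
  by apply/measurable_EFinP; exact: normr_measurable.
have absY : (\int[my]_x `|x|%:E = \int[Pr]_w `|Y w|%:E)%E.
  rewrite ge0_integral_distribution //.
  by apply/measurable_EFinP; exact: normr_measurable.
have ix : mx.-integrable setT (EFin \o (fun x : R => x)).
  apply/integrableP; split; first exact/measurable_EFinP.
  by rewrite absX; move/integrableP : iX => [].
have iy : my.-integrable setT (EFin \o (fun x : R => x)).
  apply/integrableP; split; first exact/measurable_EFinP.
  by rewrite absY; move/integrableP : iY => [].
have iM : (mx \x my)%E.-integrable setT (EFin \o (fun z : R * R => z.1 * z.2)).
  apply/integrable12ltyP; first exact/measurable_EFinP.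
  under eq_integral => x _.
    under eq_integral => y _ do rewrite /= normrM EFinM.
    rewrite ge0_integralZl //; last first.
      by apply/measurable_EFinP; exact: normr_measurable.
    over.
  rewrite /= ge0_integralZr //; last 2 first.
  - by apply/measurable_EFinP; exact: normr_measurable.
  - exact: integral_ge0.
  rewrite lte_mul_pinfty //; first exact: integral_ge0.
  - by rewrite ge0_fin_numE; [case/integrableP : ix|exact: integral_ge0].
  - by case/integrableP : iy.
have EM : (\int[mx \x my]_z (z.1 * z.2)%:E
    = (\int[mx]_x x%:E) * (\int[my]_y y%:E))%E.
  rewrite -(integral12_prod_meas1 iM) /fubini_F.
  under eq_integral => x _.
    under eq_integral => y _ do rewrite /= EFinM.
    rewrite integralZl //.
    over.
  have /fineK <- : (\int[my]_y y%:E)%E \is a fin_num by exact: integrable_fin_num iy.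
  by rewrite integralZr.
have EX : (\int[mx]_x x%:E = \int[Pr]_w (X w)%:E)%E.
  by rewrite integral_distribution //; exact/measurable_EFinP.
have EY : (\int[my]_x x%:E = \int[Pr]_w (Y w)%:E)%E.
  by rewrite integral_distribution //; exact/measurable_EFinP.
have iXY : integrable (fun w => X w * Y w).
  apply/integrableP; split; first exact/measurable_EFinP/measurable_funM.
  have -> : (\int[Pr]_w `|(X w * Y w)%:E| =
      \int[distribution Pr Z']_z `|z.1 * z.2|%:E)%E.
    rewrite ge0_integral_distribution //.
    by apply/measurable_EFinP; apply: measurableT_comp => //.
  rewrite (eq_measure_integral (mx \x my)%E); first by case/integrableP : iM.
  by move=> A mA _; exact/esym/jointE.
split=> //; rewrite /Rintegral -fineM -?EX -?EY -?EM ?EX ?EY; last 2 first.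
- exact: integrable_fin_num iX.
- exact: integrable_fin_num iY.
congr fine; transitivity (\int[distribution Pr Z']_z (z.1 * z.2)%:E)%E.
  by rewrite integral_distribution //; exact/measurable_EFinP.
by apply: eq_measure_integral => A mA _; exact/esym/jointE.
Qed.

End Independence.

Section WhiteNoise.
Context d (T : measurableType d) {R : realType} (Pr : probability T R).
Variables (N : nat) (s : R) (e : 'I_N -> {RV Pr >-> R}).
Hypotheses (s_gt0 : 0 < s) (e_white : white_gaussian s e).
Local Notation integrable f := (Pr.-integrable setT (EFin \o (f : T -> R))).
Local Notation gam := (normal_prob 0 s : probability (measurableTypeR R) R).

Lemma white_marginal i (B : set R) : measurable B ->
  Pr (e i @^-1` B) = normal_prob 0 s B.
Proof.
move=> mB; pose A j := if j == i then B else setT.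
have mA j : measurable (A j) by rewrite /A; case: eqP.
have := e_white mA; rewrite (bigD1 i) //= big1 ?mule1; last first.
  by move=> j ji; rewrite /A (negbTE ji) (@probability_setT _ _ _ gam).
rewrite {2}/A eqxx => <-; congr (Pr _); apply/seteqP; split => w.
  by move=> Bw j _; rewrite /A /=; case: eqP => [->|].
by move=> /(_ i I); rewrite /A eqxx.
Qed.

Lemma white_integral i (f : R -> R) :
  gam.-integrable setT (EFin \o f) ->
  integrable (f \o e i) /\ \int[Pr]_w f (e i w) = \int[gam]_x f x.
Proof.
move=> fi; have mf := integrable_measurable fi.
have mei : measurable_fun setT (e i : T -> measurableTypeR R).
  exact: (measurable_funP (e i)).
pose X : {mfun T >-> measurableTypeR R} :=
  HB.pack (e i : T -> measurableTypeR R) (isMeasurableFun.Build _ _ _ _ _ mei).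
have lawE A : measurable A -> distribution Pr X A = normal_prob 0 s A.
  by move=> mA; rewrite -(white_marginal i mA).
have fei : integrable (f \o e i).
  apply/integrableP; split; first exact/measurable_EFinP/measurableT_comp.
  have -> : (\int[Pr]_w `|(EFin \o (f \o e i)) w|
      = \int[distribution Pr X]_x `|f x|%:E)%E.
    rewrite ge0_integral_distribution //.
    by apply/measurable_EFinP; exact: measurableT_comp.
  rewrite (eq_measure_integral gam); first by case/integrableP : fi.
  by move=> A mA _; exact: lawE.
split=> //; rewrite /Rintegral; congr fine.
transitivity (\int[distribution Pr X]_x (f x)%:E)%E.
  by rewrite integral_distribution //; exact/measurable_EFinP.
by apply: eq_measure_integral => A mA _; exact: lawE.
Qed.

Definition linear_form (c : 'I_N -> R) (r : seq 'I_N) (w : T) : R :=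
  \sum_(i <- r) c i * e i w.

Lemma measurable_linear_form c r : measurable_fun setT (linear_form c r).
Proof. by apply: measurable_sum => i; exact: measurable_funM. Qed.

(** For fixed [B], the two finite measures [Pr (_ `&` e j @^-1` B)] and
    [Pr (e j @^-1` B) * Pr _] agree on the rectangles that do not constrain the
    [j]-th coordinate, hence on the sigma-algebra these generate, for which
    every linear form avoiding [j] is measurable. *)
Lemma independent2_linear_form c r j : j \notin r ->
  independent2 Pr (linear_form c r) (e j).
Proof.
move=> jr A B mA mB.
pose G : set (set T) := [set X | exists A : 'I_N -> set R,
  [/\ forall i, measurable (A i), A j = setT & X = \bigcap_i (e i @^-1` A i)]].
have mpre i (C : set R) : measurable C -> measurable (e i @^-1` C).
  by move=> mC; rewrite -[X in measurable X]setTI; exact: measurable_funP.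
have Gm : G `<=` measurable.
  move=> X [C [mC _ ->]]; apply: fin_bigcap_measurable => //.
  by move=> i _; exact: mpre.
have GT : G setT.
  exists (fun=> setT); split=> //.
  by apply/seteqP; split => // w _ i _.
have GI : setI_closed G.
  move=> X Y [C [mC Cj ->]] [D [mD Dj ->]]; exists (fun i => C i `&` D i).
  split; [by move=> i; exact: measurableI|by rewrite Cj Dj setTI|].
  by rewrite -bigcapI; apply: eq_bigcapr => i _; rewrite preimage_setI.
have PrB : Pr (e j @^-1` B) \is a fin_num by exact: fin_num_measure (mpre _ _ mB).
pose b : {nonneg R} := NngNum (fine_ge0 (measure_ge0 Pr (e j @^-1` B))).
have mLG : <<s G >> (linear_form c r @^-1` A).
  have meG i : i != j -> measurable_fun (setT : set (g_sigma_algebraType G)) (e i : _ -> R).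
    move=> ij _ C mC; rewrite setTI; apply: sub_sigma_algebra.
    exists (fun k => if k == i then C else setT); split.
    - by move=> k; case: eqP.
    - by rewrite eq_sym (negbTE ij).
    - apply/seteqP; split => w /=.
        by move=> Cw k _; case: eqP => [->|].
      by move=> /(_ i I); rewrite eqxx.
  have mL : measurable_fun (setT : set (g_sigma_algebraType G)) (linear_form c r : _ -> R).
    rewrite /linear_form; elim: r jr => [|i r IH].
      by move=> _; under eq_fun do rewrite big_nil; exact: measurable_cst.
    rewrite inE negb_or eq_sym => /andP[ij jr].
    under eq_fun do rewrite big_cons.
    by apply: measurable_funD; [apply: measurable_funM => //; exact: meG|exact: IH].
  by have := mL measurableT A mA; rewrite setTI.
have bE X : mscale b Pr X = (Pr X * Pr (e j @^-1` B))%E.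
  by rewrite /mscale /= fineK // muleC.
rewrite -bE; apply: (@g_sigma_algebra_measure_unique _ R T G Gm (fun=> setT)
  (fun=> GT) _ (mrestr Pr (mpre j B mB)) (mscale b Pr) GI _ _ _ mLG).
- by apply/seteqP; split => // w _; exists 0%N.
- move=> X [C [mC Cj ->]]; apply: etrans; last exact/esym/bE.
  rewrite /= /mrestr.
  pose C' i := if i == j then B else C i.
  have mC' i : measurable (C' i) by rewrite /C'; case: eqP.
  have -> : \bigcap_i (e i @^-1` C i) `&` e j @^-1` B = \bigcap_i (e i @^-1` C' i).
    apply/seteqP; split => w.
      by move=> [Cw Bw] i _; rewrite /C' /=; case: eqP => [->|_] //; exact: Cw.
    move=> Cw; split; last by have := Cw j I; rewrite /C' eqxx.
    move=> i _; have := Cw i I; rewrite /C'; case: eqP => [-> _|//].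
    by rewrite Cj.
  rewrite (e_white mC') (e_white mC) (bigD1 j) //= [in RHS](bigD1 j) //=.
  rewrite Cj (@probability_setT _ _ _ gam) mul1e {1}/C' eqxx white_marginal //.
  by rewrite [LHS]muleC; congr (_ * _)%E; apply: eq_bigr => i ij; rewrite /C' (negbTE ij).
- move=> _; rewrite /= /mrestr setTI; apply: le_lt_trans (probability_le1 _ _) _ => //.
    exact: mpre.
  exact: ltry.
Qed.

Lemma integrable_pow (f : T -> R) k : (k <= 4)%N -> measurable_fun setT f ->
  integrable (fun w => f w ^+ 4) -> integrable (fun w => f w ^+ k).
Proof.
move=> k4 mf f4; apply: (@integrable_dominated _ _ _ _ _ (fun w => 1 + f w ^+ 4)).
- exact: measurable_funX.
- exact: integrable_addr (integrable_constr _ _) f4.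
move=> w; rewrite normrX -[f w ^+ 4](@ger0_norm R) ?exprn_even_ge0 // normrX.
have [f1|f1] := leP `|f w| 1.
  by rewrite (le_trans (exprn_ile1 _ (normr_ge0 _) f1)) // lerDl exprn_ge0.
by rewrite (le_trans (ler_weXn2l (ltW f1) k4)) // lerDr.
Qed.

Let m4 : R := \int[gam]_x (x ^+ 4).

Definition fourth_moment_const : R := 3 * s ^+ 4 + m4.

Lemma fourth_moment_const_ge0 : 0 <= fourth_moment_const.
Proof.
apply: addr_ge0; first by rewrite mulr_ge0 // exprn_even_ge0.
by apply: Rintegral_ge0 => x _; exact: exprn_even_ge0.
Qed.

(** Adding one independent centered term to a linear form [S] adds
    [6 a^2 E[S^2] E[X^2] + a^4 E[X^4]] to the fourth moment, the odd terms being
    zero; this is at most [K (2 a^2 Q + a^4)] where [Q] is the sum of squared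
    coefficients so far and [K] dominates both [3 s^4] and [E[X^4]], whence the
    bound [K Q^2] by induction. *)
Lemma linear_form_moments c r : uniq r ->
  [/\ integrable (fun w => linear_form c r w ^+ 4),
      \int[Pr]_w linear_form c r w = 0,
      \int[Pr]_w (linear_form c r w ^+ 2) = s ^+ 2 * \sum_(i <- r) c i ^+ 2 &
      \int[Pr]_w (linear_form c r w ^+ 4)
        <= fourth_moment_const * (\sum_(i <- r) c i ^+ 2) ^+ 2].
Proof.
elim: r => [_|i r IH].
  have S0 : linear_form c [::] = fun=> 0.
    by apply/funext => w; rewrite /linear_form big_nil.
  rewrite S0 !big_nil mulr0 !expr0n /= mulr0 Rintegral_cst // mul0r.
  by split=> //; exact: integrable_constr.
rewrite [uniq _]/= => /andP[ir /IH [i4 E1 E2 E4]].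
set S := linear_form c r in i4 E1 E2 E4 *; set a := c i; set X := e i : T -> R.
set Q := \sum_(j <- r) c j ^+ 2 in E2 E4.
have mS : measurable_fun setT S by exact: measurable_linear_form.
have SE : linear_form c (i :: r) = fun w => S w + a * X w.
  by apply/funext => w; rewrite /linear_form big_cons addrC.
have powX k := white_integral i (normal_integrable_pow s_gt0 k).
have [nm1 nm2] := normal_moments s_gt0.
have X1 : \int[Pr]_w (X w ^+ 1) = 0.
  rewrite -nm1 (powX 1%N).2.
  by apply: eq_Rintegral => x _; rewrite expr1.
have X1' : \int[Pr]_w X w = 0.
  by rewrite -X1; apply: eq_Rintegral => x _; rewrite expr1.
have S1 : \int[Pr]_w (S w ^+ 1) = 0.
  by rewrite -E1; apply: eq_Rintegral => x _; rewrite expr1.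
have X2 : \int[Pr]_w (X w ^+ 2) = s ^+ 2 by rewrite (powX 2%N).2.
have X4 : \int[Pr]_w (X w ^+ 4) = m4 by rewrite (powX 4%N).2.
have SX k l : (k <= 4)%N -> integrable (fun w => S w ^+ k * X w ^+ l) /\
    \int[Pr]_w (S w ^+ k * X w ^+ l)
    = (\int[Pr]_w (S w ^+ k)) * \int[Pr]_w (X w ^+ l).
  move=> k4; apply: independent2_integral.
  - apply: (@independent2_comp _ _ _ Pr S X (fun x => x ^+ k) (fun x => x ^+ l)).
    + exact: measurable_funX.
    + exact: measurable_funX.
    + exact: independent2_linear_form.
  - exact: integrable_pow.
  - by have [] := powX l.
have iS1 : integrable S.
  by apply: eq_integrable (@integrable_pow S 1 _ mS i4).
have iS2 : integrable (fun w => S w ^+ 2) by exact: (@integrable_pow S 2).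
have iX1 : integrable X by apply: eq_integrable (powX 1%N).1.
have iX2 : integrable (fun w => X w ^+ 2) by have [] := powX 2%N.
have iX4 : integrable (fun w => X w ^+ 4) by have [] := powX 4%N.
have [i11 E11] := SX 1%N 1%N isT.
have [i31 E31] := SX 3%N 1%N isT.
have [i22 E22] := SX 2%N 2%N isT.
have [i13 E13] := SX 1%N 3%N isT.
rewrite SE big_cons -/Q -/a.
have sq_eq : (fun w => (S w + a * X w) ^+ 2) = fun w =>
    S w ^+ 2 + ((2 * a) * (S w ^+ 1 * X w ^+ 1) + a ^+ 2 * X w ^+ 2).
  by apply/funext => w; ring.
have q_eq : (fun w => (S w + a * X w) ^+ 4) = fun w =>
    S w ^+ 4 + ((4 * a) * (S w ^+ 3 * X w ^+ 1)
     + ((6 * a ^+ 2) * (S w ^+ 2 * X w ^+ 2)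
     + ((4 * a ^+ 3) * (S w ^+ 1 * X w ^+ 3) + a ^+ 4 * X w ^+ 4))).
  by apply/funext => w; ring.
have j1 := integrable_scaler (2 * a) i11.
have j2 := integrable_scaler (a ^+ 2) iX2.
have j31 := integrable_scaler (4 * a) i31.
have j22 := integrable_scaler (6 * a ^+ 2) i22.
have j13 := integrable_scaler (4 * a ^+ 3) i13.
have j4 := integrable_scaler (a ^+ 4) iX4.
have k1 := integrable_addr j13 j4.
have k2 := integrable_addr j22 k1.
have k3 := integrable_addr j31 k2.
split.
- by rewrite q_eq; exact: integrable_addr.
- rewrite RintegralD //; last exact: integrable_scaler.
  by rewrite RintegralZl // E1 X1' mulr0 addr0.
- rewrite sq_eq RintegralD //; last exact: integrable_addr.
  rewrite RintegralD // !RintegralZl // E11 S1 E2 X2; ring.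
rewrite q_eq RintegralD // RintegralD // RintegralD // RintegralD //.
rewrite !RintegralZl // E31 E22 E13 X4 E2 X2.
rewrite X1 S1 mulr0 mul0r !mulr0 !add0r.
have Q0 : 0 <= Q by apply: sumr_ge0 => j _; exact: sqr_ge0.
have m40 : 0 <= m4 by apply: Rintegral_ge0 => x _; exact: exprn_even_ge0.
have -> : fourth_moment_const * (a ^+ 2 + Q) ^+ 2 = fourth_moment_const * Q ^+ 2
  + (6 * a ^+ 2 * (s ^+ 2 * Q * s ^+ 2) + a ^+ 4 * m4)
  + (m4 * (2 * a ^+ 2 * Q) + 3 * s ^+ 4 * a ^+ 4).
  by rewrite /fourth_moment_const; ring.
rewrite -[leLHS]addr0; apply: lerD; first by apply: lerD.
have a40 : 0 <= a ^+ 4 by exact: exprn_even_ge0.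
have s40 : 0 <= s ^+ 4 by exact: exprn_even_ge0.
have a20 : 0 <= a ^+ 2 by exact: sqr_ge0.
by apply: addr_ge0; apply: mulr_ge0 => //; apply: mulr_ge0 => //; exact: mulr_ge0.
Qed.

Section LinearImage.
Context {n : nat}.
Variable L : 'M[R]_(n, N).

Definition noise_image (w : T) : 'cV[R]_n := L *m \col_i e i w.

Let noise_imageE a w :
  noise_image w a 0 = linear_form (L a) (index_enum 'I_N) w.
Proof.
by rewrite mxE; apply: eq_bigr => i _; rewrite mxE.
Qed.

Let moments c := @linear_form_moments c _ (index_enum_uniq 'I_N).

Let mulmx_trE a b : (L *m L^T) a b = \sum_i L a i * L b i.
Proof. by rewrite mxE; apply: eq_bigr => i _; rewrite mxE. Qed.

Lemma measurable_noise_image a : measurable_fun setT (fun w => noise_image w a 0).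
Proof.
by under eq_fun do rewrite noise_imageE; exact: measurable_linear_form.
Qed.

Lemma noise_image_mean a :
  integrable (fun w => noise_image w a 0) /\ \int[Pr]_w noise_image w a 0 = 0.
Proof.
have [i4 E1 _ _] := moments (L a); split.
  under eq_fun do rewrite noise_imageE.
  by apply: eq_integrable (@integrable_pow _ 1 _ (measurable_linear_form _ _) i4).
by under eq_Rintegral do rewrite noise_imageE.
Qed.

Lemma noise_image_fourth a :
  integrable (fun w => noise_image w a 0 ^+ 4) /\
  \int[Pr]_w (noise_image w a 0 ^+ 4)
    <= fourth_moment_const * ((L *m L^T) a a) ^+ 2.
Proof.
have [i4 _ _ E4] := moments (L a); split.
  by under eq_fun do rewrite noise_imageE.
under eq_Rintegral do rewrite noise_imageE.
by rewrite mulmx_trE.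
Qed.

(** Polarization reduces the covariance to second moments of linear forms. *)
Lemma noise_image_cov a b :
  integrable (fun w => noise_image w a 0 * noise_image w b 0) /\
  \int[Pr]_w (noise_image w a 0 * noise_image w b 0) = s ^+ 2 * (L *m L^T) a b.
Proof.
pose r := index_enum 'I_N.
pose cp i := L a i + L b i; pose cm i := L a i - L b i.
have [ip _ Ep _] := moments cp; have [im _ Em _] := moments cm.
have ip2 := @integrable_pow _ 2 isT (measurable_linear_form _ _) ip.
have im2 := @integrable_pow _ 2 isT (measurable_linear_form _ _) im.
have polar : (fun w => noise_image w a 0 * noise_image w b 0) = fun w =>
    4^-1 * (linear_form cp r w ^+ 2 - linear_form cm r w ^+ 2).
  apply/funext => w; rewrite !noise_imageE.
  have -> : linear_form cp r w = linear_form (L a) r w + linear_form (L b) r w.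
    by rewrite -big_split; apply: eq_bigr => i _; rewrite mulrDl.
  have -> : linear_form cm r w = linear_form (L a) r w - linear_form (L b) r w.
    by rewrite -sumrB; apply: eq_bigr => i _; rewrite mulrBl.
  by field.
have isub := integrable_subr ip2 im2.
rewrite polar; split; first exact: integrable_scaler.
rewrite RintegralZl // RintegralB // Ep Em mulmx_trE -mulrBr -sumrB mulrCA.
congr (_ * _); rewrite mulr_sumr; apply: eq_bigr => i _.
by rewrite /cp /cm; field.
Qed.

End LinearImage.

End WhiteNoise.

(** * Limits of matrices *)

Section MatrixLimits.
Context {R : realType}.

Lemma mx_norm_le m k (A : 'M[R]_(m, k)) (c : R) :
  0 <= c -> (forall i j, `|A i j| <= c) -> `|A| <= c.
Proof.
move=> c0 Ac; rewrite /Num.Def.normr /= mx_normrE.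
by apply: bigmax_le => // i _; exact: Ac.
Qed.

Lemma entry_le_mx_norm m k (A : 'M[R]_(m, k)) i j : `|A i j| <= `|A|.
Proof.
rewrite [leRHS]/Num.Def.normr /= mx_normrE.
exact: (le_bigmax _ (fun x => `|A x.1 x.2|) (i, j)).
Qed.

Lemma mx_norm_mulmx m k l (A : 'M[R]_(m, k)) (B : 'M[R]_(k, l)) :
  `|A *m B| <= k%:R * `|A| * `|B|.
Proof.
apply: mx_norm_le => [|i j]; first by rewrite !mulr_ge0.
rewrite mxE; apply: le_trans (ler_norm_sum _ _ _) _.
have -> : k%:R * `|A| * `|B| = \sum_(x < k) `|A| * `|B|.
  by rewrite sumr_const card_ord -mulrA mulr_natl.
by apply: ler_sum => x _; rewrite normrM ler_pM // entry_le_mx_norm.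
Qed.

Lemma mx_norm_trmx m k (A : 'M[R]_(m, k)) : `|A^T| <= `|A|.
Proof. by apply: mx_norm_le => // i j; rewrite mxE entry_le_mx_norm. Qed.

Lemma mx_norm_mxtrace m (A : 'M[R]_m) : `|\tr A| <= m%:R * `|A|.
Proof.
apply: le_trans (ler_norm_sum _ _ _) _.
rewrite mulr_natl -[X in _ *+ X]card_ord -sumr_const.
by apply: ler_sum => i _; exact: entry_le_mx_norm.
Qed.

Context {I : Type} {F : set_system I} {FF : Filter F}.

Lemma cvg_mxP m k (f : I -> 'M[R]_(m, k)) (l : 'M[R]_(m, k)) :
  f @ F --> l <-> forall i j, (fun x => f x i j) @ F --> l i j.
Proof.
split=> [fl i j|fl].
  apply: (@cvg_comp _ _ _ f (fun A : 'M[R]_(m, k) => A i j) _ _ _ fl).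
  exact: coord_continuous.
apply/cvgrPdist_le => eps eps0; near=> x.
apply: mx_norm_le => [|i j]; first exact: ltW.
rewrite !mxE; move: i j; near: x.
apply: filter_forall => i; apply: filter_forall => j.
exact: cvgr_dist_le (fl i j) _ eps0.
Unshelve. all: by end_near. Qed.

Lemma cvg_mulmx m k l (f : I -> 'M[R]_(m, k)) (g : I -> 'M[R]_(k, l))
    (a : 'M[R]_(m, k)) (b : 'M[R]_(k, l)) :
  f @ F --> a -> g @ F --> b -> (fun x => f x *m g x) @ F --> a *m b.
Proof.
move=> /cvg_mxP fa /cvg_mxP gb; apply/cvg_mxP => i j; rewrite mxE.
under eq_cvg do rewrite mxE.
apply: cvg_big => [|x _]; first exact: add_continuous.
exact: cvgM.
Qed.

Lemma cvg_det m (f : I -> 'M[R]_m) (a : 'M[R]_m) :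
  f @ F --> a -> (fun x => \det (f x)) @ F --> \det a.
Proof.
move=> /cvg_mxP fa; apply: cvg_big => [|s _]; first exact: add_continuous.
apply: cvgM; first exact: cvg_cst.
by apply: cvg_big => [|i _]; [exact: mul_continuous|exact: fa].
Qed.

Lemma cvg_cofactor m (f : I -> 'M[R]_m) (a : 'M[R]_m) i j :
  f @ F --> a -> (fun x => cofactor (f x) i j) @ F --> cofactor a i j.
Proof.
move=> /cvg_mxP fa; apply: cvgM; first exact: cvg_cst.
apply: cvg_det; apply/cvg_mxP => k l; rewrite !mxE.
by under eq_cvg do rewrite !mxE; exact: fa.
Qed.

Lemma near_unitmx m (f : I -> 'M[R]_m) (a : 'M[R]_m) : a \in unitmx ->
  f @ F --> a -> \forall x \near F, f x \in unitmx.
Proof.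
rewrite unitmxE unitfE => a0 fa.
have da : \forall x \near F, \det (f x) != 0 by exact: cvgr_neq0 (cvg_det fa) a0.
by apply: filterS da => x; rewrite unitmxE unitfE.
Qed.

Lemma cvg_invmx m (f : I -> 'M[R]_m) (a : 'M[R]_m) : a \in unitmx ->
  f @ F --> a -> (fun x => invmx (f x)) @ F --> invmx a.
Proof.
move=> au fa.
have -> : invmx a = (\det a)^-1 *: \adj a by rewrite /invmx au.
have adjE : {near F, (fun x => (\det (f x))^-1 *: \adj (f x)) =1
    (fun x => invmx (f x))}.
  by apply: filterS (near_unitmx au fa) => x fu; rewrite /invmx fu.
apply: cvg_trans (near_eq_cvg adjE) _.
apply: cvgZ; first by apply: cvgV (cvg_det fa); rewrite -unitfE -unitmxE.
apply/cvg_mxP => i j; rewrite mxE; under eq_cvg do rewrite mxE.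
exact: cvg_cofactor.
Qed.

Lemma cvg_trmx m k (f : I -> 'M[R]_(m, k)) (a : 'M[R]_(m, k)) :
  f @ F --> a -> (fun x => (f x)^T) @ F --> a^T.
Proof.
move=> /cvg_mxP fa; apply/cvg_mxP => i j; rewrite mxE.
by under eq_cvg do rewrite mxE; exact: fa.
Qed.

Lemma cvg_quad m (f : I -> 'M[R]_m) (a : 'M[R]_m)
    (g : I -> 'cV[R]_m) (b : 'cV[R]_m) :
  f @ F --> a -> g @ F --> b -> (fun x => quad (f x) (g x)) @ F --> quad a b.
Proof.
move=> fa gb; have /cvg_mxP := cvg_mulmx (cvg_mulmx (cvg_trmx gb) fa) gb.
by apply.
Qed.

End MatrixLimits.

(** * First order expansions *)

Section Expansions.
Context {R : realType} {I : Type} {F : set_system I} {FF : Filter F}.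
Variable e : I -> R.
Hypothesis e_ge0 : \forall i \near F, 0 <= e i.

Section Orders.
Context {V : normedModType R}.
Implicit Types f g : I -> V.

(** Landau's little-o and big-O of the scale [e]. *)
Definition small f : Prop :=
  forall eps, 0 < eps -> \forall i \near F, `|f i| <= eps * e i.

Definition big f : Prop := exists C, \forall i \near F, `|f i| <= C * e i.

(** [f1 - f2] equals [L] up to little-o of the scale, near the common limit [l]
    of [f1] and [f2]. Keeping both points free is what allows comparing two
    nearby critical points; fixing [f2] gives back differentiability. *)
Definition expansion f1 f2 (l : V) (L : I -> V) : Prop :=
  [/\ f1 @ F --> l, f2 @ F --> l, small (fun i => f1 i - f2 i - L i) & big L].

Lemma smallD f g : small f -> small g -> small (fun i => f i + g i).
Proof.
move=> fs gs eps eps0; have e2 : 0 < eps / 2 by rewrite divr_gt0.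
near=> i; apply: le_trans (ler_normD _ _) _.
rewrite (splitr eps) mulrDl lerD //; near: i; [exact: fs|exact: gs].
Unshelve. all: by end_near. Qed.

Lemma smallN f : small f -> small (fun i => - f i).
Proof. by move=> fs eps eps0; under eq_near do rewrite normrN; exact: fs. Qed.

Lemma near_small f g : (\forall i \near F, f i = g i) -> small f -> small g.
Proof.
by move=> fg fs eps eps0; apply: filterS2 fg (fs _ eps0) => i <-.
Qed.

Lemma bigD f g : big f -> big g -> big (fun i => f i + g i).
Proof.
move=> [C fC] [D gD]; exists (C + D); near=> i.
by rewrite (le_trans (ler_normD _ _)) // mulrDl lerD //; near: i.
Unshelve. all: by end_near. Qed.

Lemma bigN f : big f -> big (fun i => - f i).
Proof. by move=> [C fC]; exists C; under eq_near do rewrite normrN. Qed.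

Lemma small0 : small (fun=> 0).
Proof.
move=> eps eps0; apply: filterS e_ge0 => i ei.
by rewrite normr0 mulr_ge0 // ltW.
Qed.

Lemma expansionD f1 f2 l L g1 g2 m M :
  expansion f1 f2 l L -> expansion g1 g2 m M ->
  expansion (fun i => f1 i + g1 i) (fun i => f2 i + g2 i) (l + m)
    (fun i => L i + M i).
Proof.
move=> [f1l f2l fs fb] [g1m g2m gs gb]; split.
- exact: cvgD.
- exact: cvgD.
- apply: near_small (smallD fs gs); near=> i.
  by rewrite addrACA (addrACA (f1 i)) -!opprD.
- exact: bigD.
Unshelve. all: by end_near. Qed.

Lemma near_expansion f1 f2 g1 g2 l L M :
  (\forall i \near F, f1 i = g1 i) -> (\forall i \near F, f2 i = g2 i) ->
  (\forall i \near F, L i = M i) ->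
  expansion f1 f2 l L -> expansion g1 g2 l M.
Proof.
move=> fg1 fg2 LM [f1l f2l fs [C fb]]; split.
- by apply: cvg_trans f1l; apply: near_eq_cvg.
- by apply: cvg_trans f2l; apply: near_eq_cvg.
- by apply: near_small fs; near=> i; congr (_ - _ - _); near: i.
- by exists C; apply: filterS2 LM fb => i <-.
Unshelve. all: by end_near. Qed.

Lemma expansion_vanish f l : f @ F --> l ->
  expansion f f l (fun=> 0).
Proof.
move=> fl; split=> //; last first.
  by exists 0; near=> i; rewrite normr0 mul0r.
by under eq_fun do rewrite !subrr; exact: small0.
Unshelve. all: by end_near. Qed.

End Orders.

Lemma small_dominated (V W : normedModType R) (C : R)
    (f : I -> V) (g : I -> W) :
  (forall i, `|g i| <= C * `|f i|) -> small f -> small g.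
Proof.
move=> gf fs eps eps0; have C0 : 0 < `|C| + 1 by rewrite ltr_wpDl.
near=> i; apply: le_trans (gf i) _.
apply: (@le_trans _ _ ((`|C| + 1) * `|f i|)).
  by rewrite ler_wpM2r // (le_trans (ler_norm C)) // lerDl.
rewrite -ler_pdivlMl // mulrA; near: i; apply: fs.
by rewrite mulr_gt0 // invr_gt0.
Unshelve. all: by end_near. Qed.

Lemma big_dominated (V W : normedModType R) (C : R) (f : I -> V) (g : I -> W) :
  (forall i, `|g i| <= C * `|f i|) -> big f -> big g.
Proof.
move=> gf [D fD]; exists ((`|C| + 1) * D); near=> i; apply: le_trans (gf i) _.
apply: (@le_trans _ _ ((`|C| + 1) * `|f i|)).
  by rewrite ler_wpM2r // (le_trans (ler_norm C)) // lerDl.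
by rewrite -mulrA ler_wpM2l ?addr_ge0 //; near: i.
Unshelve. all: by end_near. Qed.

Lemma expansion_map (V W : normedModType R) (phi : {additive V -> W}) (C : R)
    (f1 f2 : I -> V) l L :
  (forall x, `|phi x| <= C * `|x|) -> expansion f1 f2 l L ->
  expansion (phi \o f1) (phi \o f2) (phi l) (phi \o L).
Proof.
move=> phiC [f1l f2l fs fb].
have C0 : 0 < `|C| + 1 by rewrite ltr_wpDl.
have cphi (f : I -> V) : f @ F --> l -> (phi \o f) @ F --> phi l.
  move=> fl; apply/cvgrPdist_le => eps eps0; near=> i.
  rewrite -raddfB (le_trans (phiC _)) //.
  apply: (@le_trans _ _ ((`|C| + 1) * `|l - f i|)).
    by rewrite ler_wpM2r // (le_trans (ler_norm C)) // lerDl.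
  rewrite -ler_pdivlMl //; near: i; apply: cvgr_dist_le fl _ _.
  by rewrite mulr_gt0 // invr_gt0.
split; [exact: cphi|exact: cphi| |].
  apply: (@small_dominated V W C) fs => i.
  by rewrite /= -!raddfB.
by apply: (@big_dominated V W C) fb => i; exact: phiC.
Unshelve. all: by end_near. Qed.

Section Products.
Context {a b c : nat}.
Implicit Types (f : I -> 'M[R]_(a, b)) (g : I -> 'M[R]_(b, c)).

Lemma small_mulmx_cvg f g (m : 'M[R]_(b, c)) :
  small f -> g @ F --> m -> small (fun i => f i *m g i).
Proof.
move=> fs gm eps eps0.
pose K : R := b%:R * (`|m| + 1) + 1.
have K0 : 0 < K by rewrite ltr_wpDl // mulr_ge0 // addr_ge0.
near=> i; apply: le_trans (mx_norm_mulmx _ _) _.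
apply: (@le_trans _ _ (K * `|f i|)).
  rewrite mulrAC ler_wpM2r // (@le_trans _ _ (b%:R * (`|m| + 1))) ?lerDl //.
  by rewrite ler_wpM2l //; near: i; apply: cvgr_norm_le gm _ _; rewrite ltrDl.
rewrite -ler_pdivlMl // mulrA; near: i; apply: fs.
by rewrite mulr_gt0 // invr_gt0.
Unshelve. all: by end_near. Qed.

Lemma cvg_mulmx_small f g (l : 'M[R]_(a, b)) :
  f @ F --> l -> small g -> small (fun i => f i *m g i).
Proof.
move=> fl gs eps eps0.
pose K : R := b%:R * (`|l| + 1) + 1.
have K0 : 0 < K by rewrite ltr_wpDl // mulr_ge0 // addr_ge0.
near=> i; apply: le_trans (mx_norm_mulmx _ _) _.
apply: (@le_trans _ _ (K * `|g i|)).
  rewrite ler_wpM2r // (@le_trans _ _ (b%:R * (`|l| + 1))) ?lerDl //.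
  by rewrite ler_wpM2l //; near: i; apply: cvgr_norm_le fl _ _; rewrite ltrDl.
rewrite -ler_pdivlMl // mulrA; near: i; apply: gs.
by rewrite mulr_gt0 // invr_gt0.
Unshelve. all: by end_near. Qed.

Lemma big_mulmx_cvg0 f g :
  big f -> g @ F --> (0 : 'M[R]_(b, c)) -> small (fun i => f i *m g i).
Proof.
move=> [C fC] g0 eps eps0.
pose K : R := b%:R * `|C| + 1.
have K0 : 0 < K by rewrite ltr_wpDl // mulr_ge0.
near=> i; apply: le_trans (mx_norm_mulmx _ _) _.
have ei : 0 <= e i by near: i.
have gi : `|g i| <= K^-1 * eps.
  by near: i; apply: cvgr0_norm_le g0 _ _; rewrite mulr_gt0 // invr_gt0.
have fi : b%:R * `|f i| <= K * e i.
  rewrite (@le_trans _ _ (b%:R * (`|C| * e i))) //.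
    rewrite ler_wpM2l // (@le_trans _ _ (C * e i)) //; first by near: i.
    by rewrite ler_wpM2r // ler_norm.
  by rewrite mulrA ler_wpM2r // lerDl.
apply: (@le_trans _ _ ((K * e i) * (K^-1 * eps))).
  by apply: ler_pM => //; rewrite mulr_ge0.
by rewrite mulrACA divff ?lt0r_neq0 // mul1r mulrC.
Unshelve. all: by end_near. Qed.

Lemma cvg0_mulmx_big f g :
  f @ F --> (0 : 'M[R]_(a, b)) -> big g -> small (fun i => f i *m g i).
Proof.
move=> f0 [C gC] eps eps0.
pose K : R := b%:R * `|C| + 1.
have K0 : 0 < K by rewrite ltr_wpDl // mulr_ge0.
near=> i; apply: le_trans (mx_norm_mulmx _ _) _.
have ei : 0 <= e i by near: i.
have fi : `|f i| <= K^-1 * eps.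
  by near: i; apply: cvgr0_norm_le f0 _ _; rewrite mulr_gt0 // invr_gt0.
have gi : b%:R * `|g i| <= K * e i.
  rewrite (@le_trans _ _ (b%:R * (`|C| * e i))) //.
    rewrite ler_wpM2l // (@le_trans _ _ (C * e i)) //; first by near: i.
    by rewrite ler_wpM2r // ler_norm.
  by rewrite mulrA ler_wpM2r // lerDl.
rewrite mulrAC; apply: (@le_trans _ _ ((K * e i) * (K^-1 * eps))).
  by apply: ler_pM => //; rewrite mulr_ge0.
by rewrite mulrACA divff ?lt0r_neq0 // mul1r mulrC.
Unshelve. all: by end_near. Qed.

Lemma big_mulmx_cst f (M : 'M[R]_(b, c)) : big f -> big (fun i => f i *m M).
Proof.
apply: (@big_dominated _ _ (b%:R * `|M|)) => i.
by rewrite (le_trans (mx_norm_mulmx _ _)) // mulrAC.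
Qed.

Lemma big_cst_mulmx (M : 'M[R]_(a, b)) g : big g -> big (fun i => M *m g i).
Proof. by apply: (@big_dominated _ _ (b%:R * `|M|)) => i; exact: mx_norm_mulmx. Qed.

Lemma expansion_mulmx f1 f2 l L g1 g2 m M :
  expansion f1 f2 l L -> expansion g1 g2 m M ->
  expansion (fun i => f1 i *m g1 i) (fun i => f2 i *m g2 i) (l *m m)
    (fun i => L i *m m + l *m M i).
Proof.
move=> [f1l f2l fs fb] [g1m g2m gs gb]; split.
- exact: cvg_mulmx.
- exact: cvg_mulmx.
- have g1m0 : (fun i => g1 i - m) @ F --> (0 : 'M[R]_(b, c)).
    by rewrite -(subrr m); apply: cvgB => //; exact: cvg_cst.
  have f2l0 : (fun i => f2 i - l) @ F --> (0 : 'M[R]_(a, b)).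
    by rewrite -(subrr l); apply: cvgB => //; exact: cvg_cst.
  (* Split [f1 g1 - f2 g2] as [(f1 - f2) g1 + f2 (g1 - g2)]; replacing [g1] by
     [m] after [L], and [f2] by [l] before [M], costs a little-o. *)
  have s1 := small_mulmx_cvg fs g1m.
  have s2 := big_mulmx_cvg0 fb g1m0.
  have s3 := cvg_mulmx_small f2l gs.
  have s4 := cvg0_mulmx_big f2l0 gb.
  apply: near_small (smallD (smallD s1 s2) (smallD s3 s4)); near=> i.
  rewrite !mulmxBl !mulmxBr opprD.
  set x := f1 i *m g1 i; set y := f2 i *m g1 i; set z := f2 i *m g2 i.
  set t := L i *m g1 i; set v := L i *m m; set w := f2 i *m M i.
  set q := l *m M i.
  have -> : x - y - t + (t - v) = x - y - v by rewrite addrA subrK.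
  have -> : y - z - w + (w - q) = y - z - q by rewrite addrA subrK.
  by rewrite addrACA -opprD addrA subrK.
- by apply: bigD; [exact: big_mulmx_cst|exact: big_cst_mulmx].
Unshelve. all: by end_near. Qed.

End Products.

Lemma expansion_trmx m k (f1 f2 : I -> 'M[R]_(m, k)) l L :
  expansion f1 f2 l L ->
  expansion (fun i => (f1 i)^T) (fun i => (f2 i)^T) l^T (fun i => (L i)^T).
Proof.
by apply: (@expansion_map _ _ trmx 1) => x; rewrite mul1r mx_norm_trmx.
Qed.

Lemma expansion_mxtrace m (f1 f2 : I -> 'M[R]_m) l L :
  expansion f1 f2 l L ->
  expansion (fun i => \tr (f1 i)) (fun i => \tr (f2 i)) (\tr l)
    (fun i => \tr (L i)).
Proof. exact: (@expansion_map _ _ mxtrace m%:R) (@mx_norm_mxtrace _ _). Qed.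

Lemma expansionZ (V : normedModType R) (c : R) (f1 f2 : I -> V) l L :
  expansion f1 f2 l L ->
  expansion (fun i => c *: f1 i) (fun i => c *: f2 i) (c *: l)
    (fun i => c *: L i).
Proof.
by apply: (@expansion_map _ _ ( *:%R c) `|c|) => x; rewrite normrZ.
Qed.

Lemma expansionN (V : normedModType R) (f1 f2 : I -> V) l L :
  expansion f1 f2 l L ->
  expansion (fun i => - f1 i) (fun i => - f2 i) (- l) (fun i => - L i).
Proof.
by apply: (@expansion_map _ _ -%R 1) => x; rewrite mul1r normrN.
Qed.

(** First order form of the resolvent identity
    [invmx B - invmx A = invmx A *m (A - B) *m invmx B]. *)
Lemma expansion_invmx m (f1 f2 : I -> 'M[R]_m) l L : l \in unitmx ->
  expansion f1 f2 l L ->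
  expansion (fun i => invmx (f1 i)) (fun i => invmx (f2 i)) (invmx l)
    (fun i => - (invmx l *m L i *m invmx l)).
Proof.
move=> lu [f1l f2l fs fb].
have u1l : (fun i => invmx (f1 i)) @ F --> invmx l by exact: cvg_invmx.
have u2l : (fun i => invmx (f2 i)) @ F --> invmx l by exact: cvg_invmx.
have u10 : (fun i => invmx (f1 i) - invmx l) @ F --> (0 : 'M[R]_m).
  by rewrite -(subrr (invmx l)); apply: cvgB => //; exact: cvg_cst.
have u20 : (fun i => invmx (f2 i) - invmx l) @ F --> (0 : 'M[R]_m).
  by rewrite -(subrr (invmx l)); apply: cvgB => //; exact: cvg_cst.
split => //.
- have s1 := small_mulmx_cvg (cvg_mulmx_small u1l fs) u2l.
  have s2 := small_mulmx_cvg (cvg0_mulmx_big u10 fb) u2l.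
  have s3 := big_mulmx_cvg0 (big_cst_mulmx (invmx l) fb) u20.
  apply: near_small (smallN (smallD s1 (smallD s2 s3))); near=> i.
  have f1u : f1 i \in unitmx by near: i; exact: near_unitmx f1l.
  have f2u : f2 i \in unitmx by near: i; exact: near_unitmx f2l.
  have uE : invmx (f1 i) *m (f1 i - f2 i) *m invmx (f2 i)
      = invmx (f2 i) - invmx (f1 i).
    by rewrite mulmxBr mulVmx // mulmxBl mul1mx -mulmxA mulmxV // mulmx1.
  rewrite mulmxBr mulmxBl uE !mulmxBl mulmxBr opprK.
  set x := invmx (f1 i) *m L i *m _; set y := invmx l *m L i *m invmx (f2 i).
  set z := invmx l *m L i *m invmx l.
  have -> : x - y + (y - z) = x - z by rewrite addrA subrK.
  by rewrite addrA subrK opprB opprB addrC.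
- by apply/bigN/big_mulmx_cst/big_cst_mulmx.
Unshelve. all: by end_near. Qed.

Definition mix_rows m (k : nat) (A B : 'M[R]_m) : 'M[R]_m :=
  \matrix_(i, j) if (i < k)%N then A i j else B i j.

Definition mix_adj m (A B : 'M[R]_m) : 'M[R]_m :=
  \matrix_(j, i) cofactor (mix_rows i A B) i j.

(** Passing from [B] to [A] one row at a time, the determinant changes by an
    expression linear in the replaced row, given by its Laplace expansion. *)
Lemma det_subE m (A B : 'M[R]_m) :
  \det A - \det B = \tr ((A - B) *m mix_adj A B).
Proof.
have -> : \det A - \det B = \sum_(0 <= k < m)
    (\det (mix_rows k.+1 A B) - \det (mix_rows k A B)).
  rewrite (telescope_sumr (fun k => \det (mix_rows k A B))) //.
  have -> : mix_rows m A B = A by apply/matrixP => i j; rewrite mxE ltn_ord.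
  by have -> : mix_rows 0 A B = B by apply/matrixP => i j; rewrite mxE.
rewrite big_mkord; apply: eq_bigr => k _.
rewrite (expand_det_row _ k) [\det (mix_rows k A B)](expand_det_row _ k).
rewrite mxE -sumrB; apply: eq_bigr => j _.
have -> : cofactor (mix_rows k.+1 A B) k j = cofactor (mix_rows k A B) k j.
  congr (_ * \det _); apply/matrixP => x y; rewrite !mxE ltnS.
  have := neq_lift k x; rewrite -val_eqE /= => kx.
  by rewrite leq_eqVlt eq_sym (negbTE kx).
by rewrite -mulrBl !mxE ltnn ltnSn.
Qed.

(** Jacobi's formula. *)
Lemma expansion_det m (f1 f2 : I -> 'M[R]_m) l L :
  expansion f1 f2 l L ->
  expansion (fun i => \det (f1 i)) (fun i => \det (f2 i)) (\det l)
    (fun i => \tr (L i *m \adj l)).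
Proof.
move=> [f1l f2l fs fb].
have Cl : (fun i => mix_adj (f1 i) (f2 i)) @ F --> \adj l.
  apply/cvg_mxP => j i; rewrite mxE; under eq_cvg do rewrite mxE.
  apply: cvg_cofactor; apply/cvg_mxP => x y; under eq_cvg do rewrite mxE.
  by case: ltnP => _; [move/cvg_mxP: f1l; apply|move/cvg_mxP: f2l; apply].
have C0 : (fun i => mix_adj (f1 i) (f2 i) - \adj l) @ F --> (0 : 'M[R]_m).
  by rewrite -(subrr (\adj l)); apply: cvgB => //; exact: cvg_cst.
split.
- exact: cvg_det.
- exact: cvg_det.
- have s1 := smallD (small_mulmx_cvg fs Cl) (big_mulmx_cvg0 fb C0).
  have := @small_dominated _ _ m%:R _ (fun i => \tr _)
    (fun i => mx_norm_mxtrace _) s1.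
  apply: near_small; near=> i.
  by rewrite mulmxBl mulmxBr addrA subrK raddfB /= det_subE.
apply: (@big_dominated _ _ m%:R _ _ (fun i => mx_norm_mxtrace _)).
exact: big_mulmx_cst.
Unshelve. all: by end_near. Qed.

Lemma is_derive_near (V W : normedModType R) (f : V -> W) (x v : V) (D : W) :
  is_derive x v f D -> forall eps, 0 < eps ->
  \forall h \near (0 : R), `|f (h *: v + x) - f x - h *: D| <= eps * `|h|.
Proof.
move=> [dv <-] eps eps0.
have := dv; rewrite /derivable => /cvgrPdist_le /(_ _ eps0) /=.
rewrite near_withinE => H; near=> h.
have [->|h0] := eqVneq h 0.
  by rewrite !scale0r add0r subrr subr0 !normr0 mulr0.
have Hh : h != 0 -> `|'D_v f x - h^-1 *: (f (h *: v + x) - f x)| <= eps.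
  by near: h; exact: H.
have -> : f (h *: v + x) - f x - h *: 'D_v f x
    = - (h *: ('D_v f x - h^-1 *: (f (h *: v + x) - f x))).
  by rewrite scalerBr scalerA divff // scale1r opprB.
by rewrite normrN normrZ [leRHS]mulrC ler_pM2l ?normr_gt0 //; exact: Hh.
Unshelve. all: by end_near. Qed.

Lemma expansion_comp (phi : R -> R) (f1 : I -> R) (l dphi : R) (L : I -> R) :
  is_derive l (1 : R) phi dphi -> expansion f1 (fun=> l) l L ->
  expansion (phi \o f1) (fun=> phi l) (phi l) (fun i => dphi * L i).
Proof.
move=> dp [f1l _ fs [C fb]].
have f10 : (fun i => f1 i - l) @ F --> (0 : R).
  by rewrite -(subrr l); apply: cvgB => //; exact: cvg_cst.
have f1b : big (fun i => f1 i - l).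
  exists (C + 1); near=> i.
  have -> : f1 i - l = L i + (f1 i - l - L i) by ring.
  apply: le_trans (ler_normD _ _) _; rewrite mulrDl lerD //; near: i => //.
  exact: (fs _ ltr01).
split.
- apply: continuous_cvg => //.
  by apply/differentiable_continuous/derivable1_diffP; have [] := dp.
- exact: cvg_cst.
- have [K fK] := f1b.
  apply: (@near_small _ (fun i => (phi (f1 i) - phi l - (f1 i - l) * dphi)
    + dphi * (f1 i - l - L i))).
    by near=> i => /=; ring.
  apply: smallD; last first.
    by apply: (@small_dominated _ _ `|dphi|) fs => i; rewrite normrM.
  move=> eps eps0.
  have K1 : 0 < `|K| + 1 by rewrite ltr_wpDl.
  have H : \forall i \near F, `|phi (f1 i) - phi l - (f1 i - l) * dphi|
      <= eps / (`|K| + 1) * `|f1 i - l|.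
    have H : F ((fun i => f1 i - l) @^-1` _) :=
      f10 _ (is_derive_near dp (divr_gt0 eps0 K1)).
    by apply: filterS H => i; rewrite /= /GRing.scale /= mulr1 subrK.
  near=> i; have ei : 0 <= e i by near: i.
  apply: (@le_trans _ _ (eps / (`|K| + 1) * `|f1 i - l|)); first by near: i.
  rewrite mulrAC ler_pdivrMr // -mulrA ler_pM2l //.
  apply: (@le_trans _ _ (K * e i)); first by near: i.
  by rewrite mulrC ler_wpM2l // (le_trans (ler_norm K)) // lerDl.
by exists (`|dphi| * C); near=> i; rewrite normrM -mulrA ler_wpM2l //; near: i.
Unshelve. all: by end_near. Qed.

End Expansions.

Section DerivativeExpansions.
Context {R : realType} {V W : normedModType R}.
Implicit Types (f : V -> W) (x v : V).

Let scale : R -> R := fun h => `|h|.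

Let scale_ge0 : \forall h \near (0 : R)^', 0 <= scale h.
Proof. by apply: nearW => h; exact: normr_ge0. Qed.

(** A directional derivative is an expansion in the increment [h], one of the
    two points being fixed: the rules for expansions are also the rules of
    differentiation, and each formula is derived once for both uses. *)
Lemma expansion_of_derive f x v D : is_derive x v f D ->
  expansion (F := (0 : R)^') scale (fun h : R => f (h *: v + x)) (fun=> f x)
    (f x) (fun h => h *: D).
Proof.
move=> fD.
have fs := is_derive_near fD.
have h0 : (fun h : R => h) @ (0 : R)^' --> (0 : R).
  by move=> A A0; apply: (nbhs_dnbhs A0).
split.
- apply/cvgrPdist_le => eps eps0; near=> h.
  rewrite distrC -[X in `|X|](subrK (h *: D)).
  apply: le_trans (ler_normD _ _) _; rewrite (splitr eps) lerD //.
    apply: (@le_trans _ _ (1 * `|h|)).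
      by near: h; apply: nbhs_dnbhs; exact: fs.
    by rewrite mul1r; near: h; apply: cvgr0_norm_le h0 _ _; rewrite divr_gt0.
  rewrite normrZ.
  apply: (@le_trans _ _ (`|h| * (`|D| + 1))); first by rewrite ler_wpM2l // lerDl.
  rewrite -ler_pdivlMr ?ltr_wpDl //; near: h; apply: cvgr0_norm_le h0 _ _.
  by rewrite !divr_gt0 // ltr_wpDl.
- exact: cvg_cst.
- by move=> eps eps0; apply: nbhs_dnbhs; exact: fs.
- by exists `|D|; near=> h; rewrite normrZ mulrC.
Unshelve. all: by end_near. Qed.

Lemma derive_of_expansion f x v D :
  expansion (F := (0 : R)^') scale (fun h : R => f (h *: v + x)) (fun=> f x)
    (f x) (fun h => h *: D) -> is_derive x v f D.
Proof.
move=> [_ _ fs _].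
have dl : (fun h : R => h^-1 *: ((f \o shift x) (h *: v) - f x)) @ (0 : R)^' --> D.
  apply/cvgrPdist_le => eps eps0; near=> h.
  have h0 : h != 0 by near: h; exact: nbhs_dnbhs_neq.
  have -> : D - h^-1 *: ((f \o shift x) (h *: v) - f x)
      = - (h^-1 *: (f (h *: v + x) - f x - h *: D)).
    by rewrite [in RHS]scalerBr scalerA mulVf // scale1r opprB.
  rewrite normrN normrZ normfV mulrC ler_pdivrMr ?normr_gt0 //.
  by near: h; exact: fs.
apply: DeriveDef; first by apply/cvg_ex; exists D.
exact/cvg_lim.
Unshelve. all: by end_near. Qed.

End DerivativeExpansions.

(** * Strict differentiability *)

Section StrictDifferentiability.
Context {R : realType} {p : nat}.
Local Notation basis k := (delta_mx 0 k : 'rV[R]_p).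

Lemma is_derive_line (f : 'rV[R]_p -> R) (v w : 'rV[R]_p) (t : R) :
  derivable f (t *: v + w) v ->
  is_derive t (1 : R) (fun s => f (s *: v + w)) ('D_v f (t *: v + w)).
Proof.
move=> df.
have quotE : (fun h : R => h^-1 *: (f ((h *: (1 : R) + t) *: v + w) - f (t *: v + w)))
    = (fun h => h^-1 *: (f (h *: v + (t *: v + w)) - f (t *: v + w))).
  apply/funext => h; have -> : h *: (1 : R) = h by rewrite /GRing.scale /= mulr1.
  by rewrite scalerDl addrA.
by apply: DeriveDef; [rewrite /derivable /= quotE|rewrite /derive /= quotE].
Qed.

(** The mean value theorem, whatever the sign of the increment. *)
Lemma mean_value0 (g dg : R -> R) (a : R) :
  (forall c, `|c| <= `|a| -> 0 <= c * a -> is_derive c (1 : R) g (dg c)) ->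
  exists c, [/\ `|c| <= `|a|, 0 <= c * a & g a - g 0 = dg c * a].
Proof.
move=> gd; have [a0|a0] := leP 0 a.
  have gd' c : c \in `[0, a] -> is_derive c (1 : R) g (dg c).
    rewrite in_itv /= => /andP[c0 ca].
    by apply: gd; rewrite ?ger0_norm ?mulr_ge0.
  have gdo c : c \in `]0, a[%R -> is_derive c (1 : R) g (dg c).
    by move=> c0a; apply: gd'; move: c0a; rewrite !in_itv /= => /andP[/ltW -> /ltW ->].
  have gc : {within `[0, a], continuous g}.
    by apply: derivable_within_continuous => c /gd' [].
  have [c c0a gE] := MVT_segment a0 gdo gc.
  move: c0a; rewrite in_itv /= => /andP[c0 ca]; exists c.
  by rewrite gE subr0 !ger0_norm ?mulr_ge0.
have gd' c : c \in `[a, 0] -> is_derive c (1 : R) g (dg c).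
  rewrite in_itv /= => /andP[ac c0].
  by apply: gd; rewrite ?ler0_norm ?lerN2 ?mulr_le0 // ltW.
have gdo c : c \in `]a, 0[%R -> is_derive c (1 : R) g (dg c).
  by move=> ca0; apply: gd'; move: ca0; rewrite !in_itv /= => /andP[/ltW -> /ltW ->].
have gc : {within `[a, 0], continuous g}.
  by apply: derivable_within_continuous => c /gd' [].
have [c ca0 gE] := MVT_segment (ltW a0) gdo gc.
move: ca0; rewrite in_itv /= => /andP[ac c0]; exists c.
rewrite -opprB gE sub0r mulrN opprK; split => //.
  by rewrite !ler0_norm ?lerN2 // ltW.
by rewrite mulr_le0 // ltW.
Qed.

(** Strict differentiability of a function with continuous partial derivatives:
    go from [z] to [y] one coordinate at a time and apply the mean value
    theorem on each leg. *)
Lemma strict_differentiability (f : 'rV[R]_p -> R) (x : 'rV[R]_p) :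
  (\forall z \near x, forall k, derivable f z (basis k)) ->
  (forall k, {for x, continuous (partial k f)}) ->
  forall eps, 0 < eps -> exists2 U, nbhs x U & forall y z, U y -> U z ->
    `|f y - f z - \sum_k (y - z) 0 k * partial k f x| <= eps * `|y - z|.
Proof.
move=> df cf eps eps0; pose eps' := eps / (p%:R + 1).
have p1 : 0 < p%:R + 1 :> R by rewrite ltr_wpDl.
have eps'0 : 0 < eps' by rewrite divr_gt0.
have near_x : \forall z \near x, forall k,
    derivable f z (basis k) /\ `|partial k f z - partial k f x| <= eps'.
  near=> z => k; split; first by move: k; near: z.
  rewrite distrC; move: k; near: z; apply: filter_forall => k.
  exact: cvgr_dist_le (cf k) _ eps'0.
have [r /= r0 rP] := (nbhs_normP _ _).1 near_x.
exists [set y | forall k, `|x 0 k - y 0 k| < r].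
  apply/(@nbhs_normP _ _ x _); exists r => //= y xy k.
  have := entry_le_mx_norm (x - y) 0 k; rewrite !mxE => /le_lt_trans; exact.
move=> y z Uy Uz.
(* The neighbourhood is a box, hence contains these hybrids of [y] and [z]. *)
pose w j : 'rV[R]_p := \row_i if (i < j)%N then y 0 i else z 0 i.
have -> : f y - f z = \sum_(k < p) (f (w k.+1) - f (w k)).
  rewrite -(big_mkord xpredT (fun k => f (w k.+1) - f (w k))).
  rewrite (telescope_sumr (fun k => f (w k))) //.
  congr (f _ - f _); apply/rowP => i; rewrite mxE ?ltn_ord //.
rewrite -sumrB; apply: le_trans (ler_norm_sum _ _ _) _.
apply: (@le_trans _ _ (\sum_(k < p) eps' * `|y - z|)); last first.
  rewrite sumr_const card_ord -mulrnAl ler_wpM2r // -mulr_natl /eps'.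
  by rewrite mulrA ler_pdivrMr // mulrC ler_wpM2l ?ltW // ltrDl.
apply: ler_sum => k _; pose a : R := (y - z) 0 k; rewrite -/a.
have wk c : c *: basis k + w k
    = \row_i if i == k then z 0 k + c else w k 0 i.
  apply/rowP => i; rewrite !mxE eqxx /=; case: eqVneq => [->|_].
    by rewrite ltnn mulr1 addrC.
  by rewrite mulr0 add0r.
have wS : w k.+1 = a *: basis k + w k.
  rewrite wk; apply/rowP => i; rewrite !mxE ltnS.
  case: (eqVneq i k) => [->|ik].
    by rewrite leqnn /a !mxE; ring.
  by rewrite leq_eqVlt -val_eqE in ik *; rewrite (negbTE ik).
have w0 : w k = 0 *: basis k + w k by rewrite scale0r add0r.
have inU c : `|c| <= `|a| -> 0 <= c * a -> forall i,
    derivable f (c *: basis k + w k) (basis i) /\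
    `|partial i f (c *: basis k + w k) - partial i f x| <= eps'.
  move=> ca c0; apply: rP => /=.
  apply: (@le_lt_trans _ _ (\big[Num.max/0]_i `|x 0 i - (c *: basis k + w k) 0 i|)).
    apply: mx_norm_le => [|i j]; first by rewrite bigmax_ge_id.
    rewrite ord1 !mxE.
    by have := le_bigmax 0 (fun i => `|x 0 i - (c *: basis k + w k) 0 i|) j; rewrite !mxE.
  apply: bigmax_lt => // i _; rewrite wk mxE; case: (eqVneq i k) => [->|_]; last first.
    by rewrite mxE; case: ifP => _; [exact: Uy|exact: Uz].
  move: (Uy k) (Uz k) ca c0; rewrite /a !mxE; clear.
  move: (x 0 k) (y 0 k) (z 0 k) => xk yk zk.
  rewrite !ltr_norml => /andP[y1 y2] /andP[z1 z2].
  have [h|h] := leP 0 (yk - zk).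
    rewrite (ger0_norm h) ler_norml => /andP[c1 c2] c3.
    have [h0|h0] := eqVneq (yk - zk) 0; first by apply/andP; split; lra.
    have c4 : 0 <= c by rewrite -(pmulr_lge0 (x := yk - zk)) // lt_def h0.
    by apply/andP; split; lra.
  rewrite (ltr0_norm h) ler_norml => /andP[c1 c2] c3.
  have c4 : c <= 0 by rewrite -(nmulr_lge0 _ h).
  by apply/andP; split; lra.
have [c [ca c0 gE]] := @mean_value0 (fun s => f (s *: basis k + w k))
  (fun s => partial k f (s *: basis k + w k)) a
  (fun c ca c0 => is_derive_line (inU c ca c0 k).1).
rewrite wS {2}w0 gE [_ * a]mulrC -mulrBr normrM mulrC.
by rewrite ler_pM // ?(inU c ca c0 k).2 // entry_le_mx_norm.
Unshelve. all: by end_near. Qed.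

Lemma derivable_entry m n (f : 'rV[R]_p -> 'M[R]_(m, n)) x k i j :
  derivable f x (basis k) -> partial k f x i j = partial k (fun z => f z i j) x.
Proof. by move=> df; rewrite /partial derive_mx // mxE. Qed.

Context {I : Type} {F : set_system I} {FF : Filter F}.
Variable e : I -> R.

(** Strict, rather than ordinary, differentiability at [x] is what compares the
    values at two points that both move towards [x]. *)
Lemma expansion_of_C1 m n (f : 'rV[R]_p -> 'M[R]_(m, n)) x
    (eta1 eta2 : I -> 'rV[R]_p) :
  (\forall z \near x, forall k, derivable f z (basis k)) ->
  (forall k, {for x, continuous (partial k f)}) ->
  eta1 @ F --> x -> eta2 @ F --> x ->
  (\forall i \near F, `|eta1 i - eta2 i| <= e i) ->
  expansion (F := F) e (f \o eta1) (f \o eta2) (f x)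
    (fun i => \sum_k (eta1 i - eta2 i) 0 k *: partial k f x).
Proof.
move=> df cf e1x e2x e12.
have strict : forall eps, 0 < eps -> exists2 U, nbhs x U & forall y z, U y -> U z ->
    `|f y - f z - \sum_k (y - z) 0 k *: partial k f x| <= eps * `|y - z|.
  move=> eps eps0.
  have sd i j : exists2 U, nbhs x U & forall y z, U y -> U z ->
      `|f y i j - f z i j - \sum_k (y - z) 0 k * partial k f x i j|
        <= eps * `|y - z|.
    have [||U xU UP] := @strict_differentiability (fun z => f z i j) x _ _ _ eps0.
    - by apply: filterS df => z dz k; have /derivable_mxP := dz k; apply.
    - move=> k; have /cvg_mxP/(_ i j) := cf k.
      rewrite derivable_entry; last by move: k; exact: (nbhs_singleton df).
      have pE : \forall z \near x,
          partial k f z i j = partial k (fun z => f z i j) z.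
        by apply: filterS df => z dz; rewrite derivable_entry.
      by move=> H; apply: cvg_trans H; exact: (near_eq_cvg pE).
    exists U => // y z Uy Uz; have := UP y z Uy Uz; congr (`|_ - _| <= _).
    apply: eq_bigr => k _; rewrite derivable_entry //.
    by move: k; exact: (nbhs_singleton df).
  pose U (ij : 'I_m * 'I_n) := sval (cid2 (sd ij.1 ij.2)).
  exists [set y | forall ij, U ij y].
    have nU ij : \forall y \near x, U ij y by rewrite /U; case: cid2.
    by near=> y => /= ij; move: ij; near: y; exact: filter_forall nU.
  move=> y z Uy Uz; apply: mx_norm_le => [|i j].
    by rewrite mulr_ge0 // ltW.
  move: (Uy (i, j)) (Uz (i, j)); rewrite /U; case: cid2 => V /= _ VP Vy Vz.
  have := VP y z Vy Vz; rewrite !mxE summxE; congr (`|_ - _| <= _).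
  by apply: eq_bigr => k _; rewrite [RHS]mxE.
have dsum (y z : 'rV[R]_p) : `|\sum_k (y - z) 0 k *: partial k f x|
    <= (\sum_k `|partial k f x|) * `|y - z|.
  apply: le_trans (ler_norm_sum _ _ _) _; rewrite mulr_suml.
  apply: ler_sum => k _; rewrite normrZ mulrC ler_wpM2l //.
  exact: entry_le_mx_norm.
have K0 : 0 <= \sum_k `|partial k f x| by apply: sumr_ge0.
set K := \sum_k _ in dsum K0.
have cfx (eta : I -> 'rV[R]_p) : eta @ F --> x -> (f \o eta) @ F --> f x.
  move=> ex; have [U xU UP] := strict _ ltr01.
  apply/cvgrPdist_le => eps eps0; near=> i.
  have Ui : U (eta i) by near: i; exact: ex.
  rewrite distrC -(subrK (\sum_k (eta i - x) 0 k *: partial k f x) (f (eta i) - f x)).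
  apply: le_trans (ler_normD _ _) _.
  apply: (@le_trans _ _ ((1 + K) * `|eta i - x|)).
    by rewrite mulrDl lerD // UP //; exact: nbhs_singleton.
  rewrite -ler_pdivlMl ?ltr_pwDl //; near: i; apply: cvgr_distC_le ex _ _.
  by rewrite mulr_gt0 // invr_gt0 ltr_pwDl.
split; [exact: cfx|exact: cfx| |].
  move=> eps eps0; have [U xU UP] := strict _ eps0; near=> i.
  apply: le_trans (UP _ _ _ _) _; [by near: i; exact: e1x|by near: i; exact: e2x|].
  by apply: ler_wpM2l; [exact: ltW|near: i].
exists K; near=> i; apply: le_trans (dsum _ _) _.
by rewrite ler_wpM2l //; near: i.
Unshelve. all: by end_near. Qed.

End StrictDifferentiability.

(** * The cost function and its gradient *)

Lemma quad_mxtrace (R : realType) m (A : 'M[R]_m) (v : 'cV[R]_m) :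
  quad A v = \tr (A *m (v *m v^T)).
Proof. by rewrite mulmxA mxtrace_mulC mulmxA trace_mx11. Qed.

Section ShiftedCost.
Context {R : realType} {n p : nat}.
Variables (alpha : R) (P : 'rV[R]_p -> 'M[R]_n).
Local Notation basis k := (delta_mx 0 k : 'rV[R]_p).

(** For [Z = sigma ^+ 2 *: invmx Gram] this is the empirical Bayes cost as a
    function of the maximum likelihood estimate, for [Z = 0] its limit; letting
    [Z] tend to [0] treats all sample sizes at once. *)
Definition shifted_cost (Z : 'M[R]_n) (theta : 'cV[R]_n) (eta : 'rV[R]_p) : R :=
  quad (invmx (P eta + Z)) theta + alpha * ln (\det (P eta + Z)).

Definition inv_partial (Z : 'M[R]_n) (k : 'I_p) (eta : 'rV[R]_p) : 'M[R]_n :=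
  - (invmx (P eta + Z) *m partial k P eta *m invmx (P eta + Z)).

Definition cost_gradient (Z : 'M[R]_n) (theta : 'cV[R]_n) (k : 'I_p)
    (eta : 'rV[R]_p) : R :=
  quad (inv_partial Z k eta) theta
  + alpha * \tr (invmx (P eta + Z) *m partial k P eta).

Lemma cost_gradientE Z theta k eta : cost_gradient Z theta k eta
  = \tr (- (invmx (P eta + Z) *m partial k P eta *m invmx (P eta + Z))
         *m (theta *m theta^T))
    + alpha *: \tr (invmx (P eta + Z) *m partial k P eta).
Proof. by rewrite -quad_mxtrace. Qed.

Let scale_ge0 : \forall h \near (0 : R)^', 0 <= `|h|.
Proof. by apply: nearW => h; exact: normr_ge0. Qed.

Lemma expansion_shifted (Z : 'M[R]_n) k eta : derivable P eta (basis k) ->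
  expansion (F := (0 : R)^') (fun h : R => `|h|)
    (fun h => P (h *: basis k + eta) + Z) (fun=> P eta + Z) (P eta + Z)
    (fun h => h *: partial k P eta + 0).
Proof.
move=> dP; apply: expansionD; last exact: expansion_vanish (cvg_cst _).
by apply: expansion_of_derive; apply: DeriveDef.
Qed.

Lemma is_derive_inv_partial (Z : 'M[R]_n) k eta :
  derivable P eta (basis k) -> P eta + Z \in unitmx ->
  is_derive eta (basis k) (fun x => invmx (P x + Z)) (inv_partial Z k eta).
Proof.
move=> dP Su; apply: derive_of_expansion.
apply: near_expansion (expansion_invmx scale_ge0 Su (expansion_shifted Z dP)).
- by near=> h.
- by near=> h.
near=> h; rewrite addr0 /inv_partial -scalemxAr -scalemxAl scalerN //.
Unshelve. all: by end_near. Qed.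

Lemma is_derive_shifted_cost (Z : 'M[R]_n) theta k eta :
  derivable P eta (basis k) -> 0 < \det (P eta + Z) ->
  is_derive eta (basis k) (shifted_cost Z theta) (cost_gradient Z theta k eta).
Proof.
move=> dP det_gt0; apply: derive_of_expansion.
have det_neq0 := lt0r_neq0 det_gt0.
have Su : P eta + Z \in unitmx by rewrite unitmxE unitfE.
have S := expansion_shifted Z dP.
have lnD := is_derive1_ln det_gt0.
have eq_cost x : \tr (invmx (P x + Z) *m (theta *m theta^T))
    + alpha *: ln (\det (P x + Z)) = shifted_cost Z theta x.
  by rewrite -quad_mxtrace.
rewrite -eq_cost.
pose proof (expansion_vanish scale_ge0 (cvg_cst (theta *m theta^T))) as E0.
pose proof (expansion_invmx scale_ge0 Su S) as E1.
pose proof (expansion_mxtrace (expansion_mulmx scale_ge0 E1 E0)) as E2.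
pose proof (expansion_det scale_ge0 S) as E3.
have E4 : expansion (F := (0 : R)^') (fun h : R => `|h|)
    (fun h => \det (P (h *: basis k + eta) + Z)) (fun=> \det (P eta + Z))
    (\det (P eta + Z))
    (fun h => \tr ((h *: partial k P eta + 0) *m \adj (P eta + Z))) by exact: E3.
pose proof (expansionZ alpha (expansion_comp scale_ge0 lnD E4)) as E5.
apply: near_expansion (expansionD E2 E5).
- by near=> h; rewrite /= eq_cost.
- by near=> h; rewrite /= eq_cost.
near=> h; rewrite addr0 mulmx0 addr0 /cost_gradient quad_mxtrace /inv_partial.
have -> : \tr (invmx (P eta + Z) *m partial k P eta)
    = (\det (P eta + Z))^-1 * \tr (partial k P eta *m \adj (P eta + Z)).
  by rewrite [invmx _]/invmx Su -scalemxAl mxtraceZ mxtrace_mulC.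
rewrite -scalemxAr -!scalemxAl !mulNmx -scalemxAl !raddfN /= !mxtraceZ.
by rewrite /GRing.scale /=; ring.
Unshelve. all: by end_near. Qed.

End ShiftedCost.

(** * Second order behaviour of the limit cost *)

Section LittleO.
Context {R : realType} {I : Type} {F : set_system I} {FF : Filter F}.
Variable e : I -> R.

Lemma small_mx m k (f : I -> 'M[R]_(m, k)) : (\forall i \near F, 0 <= e i) ->
  (forall a b, small (F := F) e (fun i => f i a b)) -> small (F := F) e f.
Proof.
move=> e0 fs eps eps0; near=> i; apply: mx_norm_le => [|a b].
  by rewrite mulr_ge0 ?(ltW eps0) //; near: i.
move: a b; near: i; apply: filter_forall => a; apply: filter_forall => b.
exact: fs.
Unshelve. all: by end_near. Qed.

Lemma small_rescale (V : normedModType R) (e' : I -> R) (C : R) (f : I -> V) :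
  (\forall i \near F, 0 <= e' i) -> (\forall i \near F, e i <= C * e' i) ->
  small (F := F) e f -> small (F := F) e' f.
Proof.
move=> e0 ee' fs eps eps0; have C0 : 0 < `|C| + 1 by rewrite ltr_wpDl.
near=> i; have e'i : 0 <= e' i by near: i.
apply: (@le_trans _ _ (eps / (`|C| + 1) * e i)).
  by near: i; apply: fs; rewrite divr_gt0.
rewrite mulrAC ler_pdivrMr // -mulrA ler_pM2l //.
apply: (@le_trans _ _ (C * e' i)); first by near: i.
by rewrite mulrC ler_wpM2l // (le_trans (ler_norm C)) // lerDl.
Unshelve. all: by end_near. Qed.

End LittleO.

Section SensitivityAlgebra.
Context {R : realType} {n : nat}.
Variables U K : 'M[R]_n.

(** First order variation of [- (invmx S *m K *m invmx S)], with
    [U = invmx S], when [S] varies by [X] and [K] by [Y]. *)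
Definition inv_variation (X Y : 'M[R]_n) : 'M[R]_n :=
  - ((- (U *m X *m U) *m K + U *m Y) *m U + U *m K *m (- (U *m X *m U))).

Lemma inv_variationD X Y X' Y' : inv_variation (X + X') (Y + Y')
  = inv_variation X Y + inv_variation X' Y'.
Proof.
rewrite /inv_variation -opprD; congr (- _).
rewrite !(mulmxDr, mulmxDl, opprD, mulNmx, mulmxN).
by rewrite [X in X + _ = _]addrACA [LHS]addrACA.
Qed.

Lemma inv_variationZ c X Y :
  inv_variation (c *: X) (c *: Y) = c *: inv_variation X Y.
Proof.
rewrite /inv_variation scalerN scalerDr; congr (- (_ + _)).
  by rewrite scalemxAl scalerDr -!scalemxAr -!scalemxAl -scalerN -scalemxAl.
by rewrite -!scalemxAr -scalemxAl -scalerN -scalemxAr.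
Qed.

Lemma inv_variation_sum p (c : 'I_p -> R) (X Y : 'I_p -> 'M[R]_n) :
  inv_variation (\sum_l c l *: X l) (\sum_l c l *: Y l)
  = \sum_l c l *: inv_variation (X l) (Y l).
Proof.
elim/big_ind3 : _ => [|X1 Y1 ? X2 Y2 ? <- <-|l _].
- by have := inv_variationZ 0 0 0; rewrite !scale0r.
- exact: inv_variationD.
- exact: inv_variationZ.
Qed.

End SensitivityAlgebra.

Lemma mxtrace_sandwichC (R : comRingType) n (U A B : 'M[R]_n) :
  \tr (- (U *m A *m U) *m B) = \tr (- (U *m B *m U) *m A).
Proof.
rewrite !mulNmx ![\tr (- _)]raddfN /=; congr (- _).
by rewrite -(mulmxA (U *m A)) mxtrace_mulC mulmxA.
Qed.

Section LocalModel.
Context {R : realType} {n p : nat}.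
Variables (alpha : R) (D : set 'rV[R]_p) (P : 'rV[R]_p -> 'M[R]_n).
Hypothesis P_posdef : forall eta, D eta -> posdef (P eta).
Hypothesis P_C2 : C2_on D° P.
Local Notation basis k := (delta_mx 0 k : 'rV[R]_p).
Local Notation invP := (fun eta => invmx (P eta)).

Section Expansion.
Context {I : Type} {F : set_system I} {FF : Filter F}.
Variable e : I -> R.
Hypothesis e_ge0 : \forall i \near F, 0 <= e i.

Lemma expansion_inv_partial (S1 S2 K1 K2 : I -> 'M[R]_n) S K LS LK :
  S \in unitmx ->
  expansion (F := F) e S1 S2 S LS -> expansion (F := F) e K1 K2 K LK ->
  expansion (F := F) e
    (fun i => - (invmx (S1 i) *m K1 i *m invmx (S1 i)))
    (fun i => - (invmx (S2 i) *m K2 i *m invmx (S2 i)))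
    (- (invmx S *m K *m invmx S))
    (fun i => inv_variation (invmx S) K (LS i) (LK i)).
Proof.
move=> Su ES EK.
pose proof (expansion_invmx e_ge0 Su ES) as EU.
exact (expansionN (expansion_mulmx e_ge0 (expansion_mulmx e_ge0 EU EK) EU)).
Qed.

End Expansion.

Lemma interior_posdef eta : D° eta -> posdef (P eta).
Proof. by move=> /interior_subset; exact: P_posdef. Qed.

Lemma interior_near eta : D° eta -> \forall z \near eta, D° z.
Proof. by move=> De; apply: open_nbhs_nbhs; split => //; exact: open_interior. Qed.

Lemma partial_invP eta k : D° eta ->
  is_derive eta (basis k) invP (inv_partial P 0 k eta).
Proof.
move=> De; have [dP _ _] := P_C2 De k.
have := @is_derive_inv_partial _ _ _ P 0 k eta dP; rewrite addr0.
under [X in is_derive _ _ X]eq_fun do rewrite addr0.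
by apply; exact/posdef_unitmx/interior_posdef.
Qed.

Lemma partial_invPE eta k : D° eta -> partial k invP eta = inv_partial P 0 k eta.
Proof. by move=> /(partial_invP k) []. Qed.

Lemma inv_partial0E eta k :
  inv_partial P 0 k eta = - (invmx (P eta) *m partial k P eta *m invmx (P eta)).
Proof. by rewrite /inv_partial addr0. Qed.

Lemma partial2_invP eta k l : D° eta ->
  is_derive eta (basis l) (partial k invP)
    (inv_variation (invmx (P eta)) (partial k P eta)
       (partial l P eta) (partial l (partial k P) eta)).
Proof.
move=> De; have [dP _ _] := P_C2 De l; have [_ _ /(_ l)[ddP _]] := P_C2 De k.
apply: (@near_eq_is_derive _ _ _ (inv_partial P 0 k)).
  by apply: filterS (interior_near De) => z Dz; rewrite partial_invPE.
apply: derive_of_expansion.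
have scale_ge0 : \forall h \near (0 : R)^', 0 <= `|h|.
  by apply: nearW => h; exact: normr_ge0.
have Pu := posdef_unitmx (interior_posdef De).
pose proof (expansion_of_derive (DeriveDef dP erefl)) as E1.
pose proof (expansion_of_derive (DeriveDef ddP erefl)) as E2.
rewrite inv_partial0E; apply: near_expansion (expansion_inv_partial scale_ge0 Pu E1 E2).
- by near=> h; rewrite inv_partial0E.
- by near=> h.
by near=> h; rewrite inv_variationZ.
Unshelve. all: by end_near. Qed.

Lemma partial2_invPE eta k l : D° eta -> partial l (partial k invP) eta
  = inv_variation (invmx (P eta)) (partial k P eta)
      (partial l P eta) (partial l (partial k P) eta).
Proof. by move=> /(partial2_invP k l) []. Qed.

Lemma partial_P_sym eta k : D° eta -> (partial k P eta)^T = partial k P eta.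
Proof.
move=> De; have [dP _ _] := P_C2 De k.
have dPT : is_derive eta (basis k) (fun x => (P x)^T) (partial k P eta)^T.
  apply: derive_of_expansion.
  pose proof (expansion_trmx (expansion_of_derive (DeriveDef dP erefl))) as E.
  apply: near_expansion E; near=> h => //.
  by rewrite linearZ.
have [_ <-] := dPT; rewrite /partial; apply: near_eq_derive.
by apply: filterS (interior_near De) => z /interior_posdef [].
Unshelve. all: by end_near. Qed.

Lemma partial_invP_sym eta k : D° eta -> (inv_partial P 0 k eta)^T = inv_partial P 0 k eta.
Proof.
move=> De; have [tP _] := interior_posdef De.
by rewrite inv_partial0E linearN /= !trmx_mul trmx_inv tP partial_P_sym // mulmxA.
Qed.

Variable theta0 : 'cV[R]_n.

Lemma W_bE : W_b alpha P theta0 = shifted_cost alpha P 0 theta0.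
Proof. by apply/funext => eta; rewrite /W_b /shifted_cost addr0. Qed.

Lemma partial_W eta k : D° eta ->
  partial k (W_b alpha P theta0) eta = cost_gradient alpha P 0 theta0 k eta.
Proof.
move=> De; rewrite W_bE; have [dP _ _] := P_C2 De k.
suff [] : is_derive eta (basis k) (shifted_cost alpha P 0 theta0)
  (cost_gradient alpha P 0 theta0 k eta) by [].
by apply: is_derive_shifted_cost => //; rewrite addr0; apply/posdef_det_gt0/interior_posdef.
Qed.

Lemma tr_inv_partialC eta k l :
  \tr (inv_partial P 0 l eta *m partial k P eta) = \tr (inv_partial P 0 k eta *m partial l P eta).
Proof.
by rewrite !inv_partial0E; exact: mxtrace_sandwichC.
Qed.

Lemma A_bE eta l k : D° eta -> A_b alpha P theta0 eta l k
  = quad (inv_variation (invmx (P eta)) (partial k P eta)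
       (partial l P eta) (partial l (partial k P) eta)) theta0
    + alpha * \tr (inv_partial P 0 l eta *m partial k P eta
                   + invmx (P eta) *m partial l (partial k P) eta).
Proof.
move=> De; rewrite mxE partial2_invPE // partial_invPE // tr_inv_partialC mxtraceD.
have abc (a b c : R) : a + alpha * b + alpha * c = a + alpha * (c + b) by ring.
exact: abc.
Qed.

(** Hence the second order condition at the minimizer makes [A_b] symmetric and
    invertible. The formula defining [A_b] lists the mixed trace term with its
    two indices in the other order, which [tr_inv_partialC] exchanges. *)
Lemma hessian_W eta : D° eta ->
  hessian (W_b alpha P theta0) eta = A_b alpha P theta0 eta.
Proof.
move=> De; apply/matrixP => l k; rewrite A_bE // mxE.
have [dP _ _] := P_C2 De l; have [_ _ /(_ l)[ddP _]] := P_C2 De k.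
have -> : partial l (partial k (W_b alpha P theta0)) eta
    = 'D_(basis l) (fun z => \tr (partial k invP z *m (theta0 *m theta0^T))
        + alpha *: \tr (invmx (P z) *m partial k P z)) eta.
  apply: near_eq_derive; apply: filterS (interior_near De) => z Dz.
  by rewrite partial_W // /cost_gradient quad_mxtrace partial_invPE // addr0.
have scale_ge0 : \forall h \near (0 : R)^', 0 <= `|h|.
  by apply: nearW => h; exact: normr_ge0.
apply: derive_val; apply: derive_of_expansion.
pose proof (expansion_of_derive (partial2_invP k l De)) as E1.
pose proof (expansion_of_derive (partial_invP l De)) as E2.
pose proof (expansion_of_derive (DeriveDef ddP erefl)) as E3.
pose proof (expansion_vanish scale_ge0 (cvg_cst (theta0 *m theta0^T))) as E0.
pose proof (expansion_mxtrace (expansion_mulmx scale_ge0 E1 E0)) as E4.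
pose proof (expansionZ alpha (expansion_mxtrace (expansion_mulmx scale_ge0 E2 E3))) as E5.
apply: near_expansion (expansionD E4 E5).
- by near=> h.
- by near=> h.
near=> h; rewrite mulmx0 addr0 quad_mxtrace -!scalemxAl -scalemxAr -scalerDr.
have lin (a b : R) : h * a + alpha *: (h * b) = h *: (a + alpha * b).
  by rewrite /GRing.scale /=; ring.
by rewrite !mxtraceZ; exact: lin.
Unshelve. all: by end_near. Qed.

End LocalModel.

(** * The regularized estimate at nearby critical points *)

Section CriticalPoints.
Context {R : realType} {n p : nat}.
Variables (alpha : R) (D : set 'rV[R]_p) (P : 'rV[R]_p -> 'M[R]_n).
Hypothesis P_posdef : forall eta, D eta -> posdef (P eta).
Hypothesis P_C2 : C2_on D° P.
Variables (theta0 : 'cV[R]_n) (eta0 : 'rV[R]_p).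
Hypothesis eta0_int : D° eta0.
Local Notation basis k := (delta_mx 0 k : 'rV[R]_p).
Local Notation invP := (fun eta => invmx (P eta)).

Definition sensitivity_mx : 'M[R]_(n, p) :=
  \matrix_(i, k) (partial k invP eta0 *m theta0) i 0.

(** Derivative with respect to [theta] of [invmx (P (eta theta)) *m theta],
    where [eta theta] is the critical point of the cost for [theta]; the matrix
    [- invmx A_b *m B_b] is the derivative of [eta theta] that the implicit
    function theorem would give. *)
Definition gain_mx : 'M[R]_n :=
  invmx (P eta0)
  - sensitivity_mx *m invmx (A_b alpha P theta0 eta0) *m B_b P theta0 eta0.

Context {I : Type} {F : set_system I} {FF : Filter F}.
Variables (Z : I -> 'M[R]_n) (eta1 eta2 : I -> 'rV[R]_p) (theta1 : I -> 'cV[R]_n).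
Hypothesis Z0 : Z @ F --> (0 : 'M[R]_n).
Hypotheses (eta1_cvg : eta1 @ F --> eta0) (eta2_cvg : eta2 @ F --> eta0).
Hypothesis theta1_cvg : theta1 @ F --> theta0.

Let e i : R := `|eta1 i - eta2 i| + `|theta1 i - theta0|.

Let e_ge0 : \forall i \near F, 0 <= e i.
Proof. by apply: nearW => i; rewrite addr_ge0. Qed.

Let P_unit : P eta0 \in unitmx.
Proof. exact: posdef_unitmx (interior_posdef P_posdef eta0_int). Qed.

Let expansion_C1 m k (f : 'rV[R]_p -> 'M[R]_(m, k)) :
  (forall z, D° z -> forall l, derivable f z (basis l)) ->
  (forall l, {for eta0, continuous (partial l f)}) ->
  expansion (F := F) e (f \o eta1) (f \o eta2) (f eta0)
    (fun i => \sum_l (eta1 i - eta2 i) 0 l *: partial l f eta0).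
Proof.
move=> df cf; apply: expansion_of_C1 => //.
  by apply: filterS (interior_near eta0_int) => z Dz l; exact: df.
by apply: nearW => i; rewrite lerDl.
Qed.

Let U0 := invmx (P eta0).

(** The perturbation [Z] is common to both points, so it only has to vanish in
    the limit, at whatever rate. *)
Lemma expansion_shift :
  expansion (F := F) e (fun i => P (eta1 i) + Z i) (fun i => P (eta2 i) + Z i)
    (P eta0) (fun i => \sum_l (eta1 i - eta2 i) 0 l *: partial l P eta0).
Proof.
have EP := @expansion_C1 _ _ P (fun z Dz l => let: And3 h _ _ := P_C2 Dz l in h)
  (fun l => let: And3 _ h _ := P_C2 eta0_int l in h).
pose proof (expansion_vanish e_ge0 Z0) as EZ.
rewrite -[P eta0]addr0; apply: near_expansion (expansionD EP EZ).
- by near=> i.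
- by near=> i.
by near=> i; rewrite addr0.
Unshelve. all: by end_near. Qed.

Lemma expansion_partial k :
  expansion (F := F) e (fun i => partial k P (eta1 i)) (fun i => partial k P (eta2 i))
    (partial k P eta0)
    (fun i => \sum_l (eta1 i - eta2 i) 0 l *: partial l (partial k P) eta0).
Proof.
apply: (@expansion_C1 _ _ (partial k P)).
  by move=> z Dz l; have [_ _ /(_ l)[]] := P_C2 Dz k.
by move=> l; have [_ _ /(_ l)[]] := P_C2 eta0_int k.
Qed.

Lemma expansion_theta :
  expansion (F := F) e theta1 (fun=> theta0) theta0 (fun i => theta1 i - theta0).
Proof.
split=> //; first exact: cvg_cst.
  by under eq_fun do rewrite subrr; exact: small0.
by exists 1; apply: nearW => i; rewrite mul1r lerDr.
Qed.

Let partial_invP0 l : partial l invP eta0 = - (U0 *m partial l P eta0 *m U0).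
Proof. by rewrite (partial_invPE P_posdef P_C2 l eta0_int) inv_partial0E. Qed.

Lemma expansion_inverse :
  expansion (F := F) e (fun i => invmx (P (eta1 i) + Z i))
    (fun i => invmx (P (eta2 i) + Z i)) U0
    (fun i => \sum_l (eta1 i - eta2 i) 0 l *: partial l invP eta0).
Proof.
apply: near_expansion (expansion_invmx e_ge0 P_unit expansion_shift).
- by near=> i.
- by near=> i.
near=> i; rewrite mulmx_sumr mulmx_suml -sumrN; apply: eq_bigr => l _.
by rewrite -scalemxAr -scalemxAl -scalerN partial_invP0.
Unshelve. all: by end_near. Qed.

Lemma expansion_regularized :
  expansion (F := F) e (fun i => invmx (P (eta1 i) + Z i) *m theta1 i)
    (fun i => invmx (P (eta2 i) + Z i) *m theta0) (U0 *m theta0)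
    (fun i => sensitivity_mx *m (eta1 i - eta2 i)^T + U0 *m (theta1 i - theta0)).
Proof.
apply: near_expansion (expansion_mulmx e_ge0 expansion_inverse expansion_theta).
- by near=> i.
- by near=> i.
near=> i; congr (_ + _); apply/matrixP => a b; rewrite ord1.
rewrite mulmx_suml summxE mxE; apply: eq_bigr => l _.
by rewrite -scalemxAl mxE !mxE mulrC.
Unshelve. all: by end_near. Qed.

Lemma B_bE k (v : 'cV[R]_n) : (B_b P theta0 eta0 *m v) k 0
  = \tr (partial k invP eta0 *m (v *m theta0^T + theta0 *m v^T)).
Proof.
have sym : (partial k invP eta0)^T = partial k invP eta0.
  rewrite (partial_invPE P_posdef P_C2 k eta0_int).
  exact: (partial_invP_sym P_posdef P_C2).
set V := partial k invP eta0 in sym *.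
have -> : \tr (V *m (v *m theta0^T + theta0 *m v^T)) = 2 * \tr (theta0^T *m V *m v).
  rewrite mulmxDr mxtraceD mulr_natl mulr2n; congr (_ + _).
    by rewrite mulmxA mxtrace_mulC mulmxA.
  by rewrite -mxtrace_tr !trmx_mul trmxK sym -mulmxA mxtrace_mulC -mulmxA mxtrace_mulC.
rewrite trace_mx11 mxE [in RHS]mxE mulr_sumr; apply: eq_bigr => j _.
by rewrite !mxE mulrA.
Qed.

(** [A_b] and [B_b] enter here, as the partial derivatives of the gradient with
    respect to [eta] and [theta]. *)
Lemma expansion_gradient k :
  expansion (F := F) e (fun i => cost_gradient alpha P (Z i) (theta1 i) k (eta1 i))
    (fun i => cost_gradient alpha P (Z i) theta0 k (eta2 i))
    (cost_gradient alpha P 0 theta0 k eta0)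
    (fun i => ((A_b alpha P theta0 eta0)^T *m (eta1 i - eta2 i)^T
               + B_b P theta0 eta0 *m (theta1 i - theta0)) k 0).
Proof.
pose proof (expansion_inv_partial e_ge0 P_unit expansion_shift
  (expansion_partial k)) as EV.
pose proof (expansion_mulmx e_ge0 expansion_theta (expansion_trmx expansion_theta))
  as ET.
pose proof (expansion_mxtrace (expansion_mulmx e_ge0 EV ET)) as E1.
pose proof (expansion_mulmx e_ge0 expansion_inverse (expansion_partial k)) as E2.
pose proof (expansionZ alpha (expansion_mxtrace E2)) as E3.
have lim_eq : cost_gradient alpha P 0 theta0 k eta0
    = \tr (- (U0 *m partial k P eta0 *m U0) *m (theta0 *m theta0^T))
      + alpha *: \tr (U0 *m partial k P eta0).
  by rewrite cost_gradientE addr0.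
rewrite lim_eq; apply: near_expansion (expansionD E1 E3).
- by apply: nearW => i; rewrite /= cost_gradientE; reflexivity.
- by apply: nearW => i; rewrite /= cost_gradientE; reflexivity.
near=> i; rewrite mxE B_bE mulmx_suml mulmx_sumr inv_variation_sum.
rewrite mulmx_suml mxtraceD -partial_invP0 -addrA addrCA addrC; congr (_ + _).
rewrite mxE [in RHS](eq_bigr (fun l => (eta1 i - eta2 i) 0 l
    * A_b alpha P theta0 eta0 l k)); last by move=> l _; rewrite mxE [X in _ * X]mxE mulrC.
rewrite -big_split /= !(raddf_sum mxtrace) /= scaler_sumr -big_split /=.
have lin (c : R) (X W V K U Y : 'M[R]_n) :
    \tr ((c *: X) *m W) + alpha *: \tr ((c *: V) *m K + U *m (c *: Y))
    = c * (\tr (X *m W) + alpha * \tr (V *m K + U *m Y)).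
  rewrite -!scalemxAl -scalemxAr -scalerDr !mxtraceZ /GRing.scale /=.
  by rewrite mulrDr; congr (_ + _); rewrite mulrCA.
apply: eq_bigr => l _; rewrite lin (A_bE _ P_posdef P_C2 _ l k eta0_int).
by rewrite quad_mxtrace (partial_invPE P_posdef P_C2 l eta0_int).
Unshelve. all: by end_near. Qed.

Hypothesis A_sym : (A_b alpha P theta0 eta0)^T = A_b alpha P theta0 eta0.
Hypothesis A_unit : A_b alpha P theta0 eta0 \in unitmx.
Hypothesis crit1 : \forall i \near F, forall k,
  cost_gradient alpha P (Z i) (theta1 i) k (eta1 i) = 0.
Hypothesis crit2 : \forall i \near F, forall k,
  cost_gradient alpha P (Z i) theta0 k (eta2 i) = 0.

Let A := A_b alpha P theta0 eta0.
Let B := B_b P theta0 eta0.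

(** Both gradients vanish, so the first order part of their difference is
    negligible; [A_b] being invertible, it can be solved for the displacement of
    the critical point. The implicit function theorem would give the same
    derivative, but would have to be applied uniformly in [Z]. *)
Lemma critical_displacement : small (F := F) e
  (fun i => (eta1 i - eta2 i)^T + invmx A *m (B *m (theta1 i - theta0))).
Proof.
have sm : small (F := F) e
    (fun i => A *m (eta1 i - eta2 i)^T + B *m (theta1 i - theta0)).
  apply: small_mx => // k j; rewrite ord1.
  have [_ _ gs _] := expansion_gradient k.
  apply: near_small (smallN gs); apply: filterS2 crit1 crit2 => i c1 c2.
  by rewrite c1 c2 subrr sub0r opprK A_sym.
pose proof (cvg_mulmx_small (cvg_cst (invmx A)) sm) as sm'.
apply: near_small sm'; near=> i; rewrite mulmxDr mulmxA mulVmx // mul1mx.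
by [].
Unshelve. all: by end_near. Qed.

(** With the little-o of [critical_displacement] taken at half of the scale, the
    displacement of [eta] is absorbed on the left. *)
Lemma scale_le_theta : exists C, \forall i \near F, e i <= C * `|theta1 i - theta0|.
Proof.
pose K : R := n%:R * `|invmx A *m B|.
exists (2 * K + 2); near=> i.
have half : `|(eta1 i - eta2 i)^T + invmx A *m (B *m (theta1 i - theta0))|
    <= 2^-1 * e i by near: i; apply: critical_displacement; rewrite invr_gt0.
have lin : `|invmx A *m (B *m (theta1 i - theta0))| <= K * `|theta1 i - theta0|.
  by rewrite mulmxA mx_norm_mulmx.
have dT : `|eta1 i - eta2 i| <= `|(eta1 i - eta2 i)^T|.
  by rewrite -[X in `|X| <= _]trmxK mx_norm_trmx.
have tri : `|(eta1 i - eta2 i)^T| <= 2^-1 * e i + K * `|theta1 i - theta0|.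
  rewrite -[X in `|X| <= _](addrK (invmx A *m (B *m (theta1 i - theta0)))).
  by apply: le_trans (ler_normB _ _) _; exact: lerD.
have := le_trans dT tri; rewrite /e.
move: `|eta1 i - eta2 i| `|theta1 i - theta0| => a b ab; lra.
Unshelve. all: by end_near. Qed.

(** The displacement of the critical point is eliminated between
    [expansion_regularized] and [critical_displacement]. *)
Lemma regularized_expansion : small (F := F) (fun i => `|theta1 i - theta0|)
  (fun i => invmx (P (eta1 i) + Z i) *m theta1 i
    - invmx (P (eta2 i) + Z i) *m theta0 - gain_mx *m (theta1 i - theta0)).
Proof.
have [C eC] := scale_le_theta.
apply: (small_rescale _ eC); first by apply: nearW.
have [_ _ gs _] := expansion_regularized.
pose proof (cvg_mulmx_small (cvg_cst sensitivity_mx) critical_displacement) as ms.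
apply: near_small (smallD gs ms); near=> i.
set dth := theta1 i - theta0; set x := sensitivity_mx *m _.
set d := _ *m _ - _ *m _.
rewrite /gain_mx mulmxBl -!mulmxA -/A -/B (mulmxDr sensitivity_mx) -/x.
rewrite -/U0; move: (U0 *m dth) (sensitivity_mx *m (invmx A *m _)) => y z.
clearbody d x; rewrite -(addrA d) opprD opprB addrACA addNr add0r.
by rewrite (addrC (- y)).
Unshelve. all: by end_near. Qed.

End CriticalPoints.

(** * Limits of scaled moments *)

Section VectorBounds.
Context {R : realType} {n : nat}.
Implicit Types x : 'cV[R]_n.

Definition dotv (x y : 'cV[R]_n) : R := \sum_a x a 0 * y a 0.

Lemma mx_norm_pow_le_sum x k : `|x| ^+ k.+1 <= \sum_a `|x a 0| ^+ k.+1.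
Proof.
have sum_ge0 : 0 <= \sum_a `|x a 0| ^+ k.+1.
  by apply: sumr_ge0 => a _; exact: exprn_ge0.
have [x0|x0] := eqVneq `|x| 0; first by rewrite x0 expr0n.
have [[a b] /= xab] : exists i, `|x| = `|x i.1 i.2| by exact: mx_norm_neq0.
rewrite (bigD1 a) //= xab (ord1 b) lerDl.
by apply: sumr_ge0 => c _; exact: exprn_ge0.
Qed.

Lemma dotv_le x y : `|dotv x y| <= n%:R * (`|x| * `|y|).
Proof.
apply: le_trans (ler_norm_sum _ _ _) _.
rewrite mulr_natl -[X in _ *+ X]card_ord -sumr_const.
by apply: ler_sum => a _; rewrite normrM ler_pM // entry_le_mx_norm.
Qed.

Definition power_sum (k : nat) x : R := \sum_a x a 0 ^+ k.

Lemma mx_norm_even_pow_le x k : odd k.+1 = false ->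
  `|x| ^+ k.+1 <= power_sum k.+1 x.
Proof.
move=> ev; apply: le_trans (mx_norm_pow_le_sum x k) _.
apply: ler_sum => a _; rewrite -normrX ger0_norm //.
by apply: exprn_even_ge0; rewrite ev.
Qed.

End VectorBounds.

Lemma Rintegral_probability_cst d (T : measurableType d) (R : realType)
  (Pr : probability T R) (c : R) : \int[Pr]_w c = c.
Proof. by rewrite Rintegral_cst //= probability_setT mulr1. Qed.

Lemma cvg_invn (R : realType) : (fun N : nat => N%:R^-1) @ \oo --> (0 : R).
Proof. by rewrite -cvg_shiftS; exact: cvg_harmonic. Qed.

(** The moment bounds below leave an arbitrarily small part and a part of order
    [1 / N] whose constant depends on it. *)
Lemma cvg0_harmonic_bound (R : realType) (x : nat -> R) :
  (forall eps, 0 < eps -> exists K, \forall N \near \oo, `|x N| <= eps + K / N%:R) ->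
  x @ \oo --> (0 : R).
Proof.
move=> xK; apply/cvgr0Pnorm_le => eps eps0.
have [K xKe] := xK _ (divr_gt0 eps0 (ltr0n R 2)).
have KN : (fun N => K / N%:R) @ \oo --> (0 : R).
  by rewrite -(mulr0 K); apply: cvgM; [exact: cvg_cst|exact: cvg_invn].
near=> N; rewrite (splitr eps).
apply: (@le_trans _ _ (eps / 2 + K / N%:R)); first by near: N.
rewrite lerD2l (le_trans (ler_norm _)) //; near: N.
by apply: cvgr0_norm_le KN _ _; rewrite divr_gt0.
Unshelve. all: by end_near. Qed.

Section MomentLimits.
Context d (T : measurableType d) {R : realType} (Pr : probability T R) {n : nat}.
Local Notation integrable f := (Pr.-integrable setT (EFin \o (f : T -> R))).
Variables (delta q : nat -> T -> 'cV[R]_n) (S : nat -> 'M[R]_n) (S0 : 'M[R]_n).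
Variables (v : nat -> 'cV[R]_n) (v0 : 'cV[R]_n) (H : nat -> 'M[R]_n) (H0 : 'M[R]_n).

Hypothesis delta_meas : \forall N \near \oo, is_random_vector (delta N).
Hypothesis delta_mean : \forall N \near \oo, forall a,
  integrable (fun w => delta N w a 0) /\ \int[Pr]_w delta N w a 0 = 0.
Hypothesis delta_cov : \forall N \near \oo, forall a b,
  integrable (fun w => delta N w a 0 * delta N w b 0) /\
  \int[Pr]_w (delta N w a 0 * delta N w b 0) = N%:R^-1 * S N a b.
Variable K4 : R.
Hypothesis delta_fourth : \forall N \near \oo, forall a,
  integrable (fun w => delta N w a 0 ^+ 4) /\
  \int[Pr]_w (delta N w a 0 ^+ 4) <= K4 * N%:R^-1 ^+ 2.
Hypothesis q_meas : \forall N \near \oo, is_random_vector (q N).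
Hypotheses (S_cvg : S @ \oo --> S0) (v_cvg : v @ \oo --> v0) (H_cvg : H @ \oo --> H0).
Variable C : R.
Hypothesis q_lipschitz : \forall N \near \oo, forall w,
  `|q N w - v N| <= C * `|delta N w|.
Hypothesis q_expansion : forall eps, 0 < eps -> exists K, \forall N \near \oo,
  forall w, `|q N w - v N - H N *m delta N w|
    <= eps * `|delta N w| + K * `|delta N w| ^+ 3.

Let d2 N w := power_sum 2 (delta N w).
Let d4 N w := power_sum 4 (delta N w).

Lemma near_gt0 : \forall N \near \oo, (0 < N)%N.
Proof. by exists 1%N. Qed.

Let d2_moment : exists M, \forall N \near \oo,
  integrable (d2 N) /\ N%:R * \int[Pr]_w d2 N w <= M.
Proof.
exists (\tr S0 + 1).
have trS : \forall N \near \oo, \tr (S N) <= \tr S0 + 1.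
  have trcvg : (fun N => \tr (S N)) @ \oo --> \tr S0.
    apply: cvg_big => [|a _]; first exact: add_continuous.
    by move/cvg_mxP : S_cvg; apply.
  by apply: (cvgr_le _ trcvg); rewrite ltrDl.
near=> N.
have N0 : (0 < N)%N by near: N; exact: near_gt0.
have d2E : d2 N = fun w => \sum_a delta N w a 0 * delta N w a 0.
  by apply/funext => w; apply: eq_bigr => a _; rewrite expr2.
have cov : forall a b, integrable (fun w => delta N w a 0 * delta N w b 0) /\
  \int[Pr]_w (delta N w a 0 * delta N w b 0) = N%:R^-1 * S N a b by near: N.
have covN a := cov a a.
rewrite d2E; split; first by apply: integrable_bigsum => a; case: (covN a).
rewrite Rintegral_bigsum; last by move=> a; case: (covN a).
under eq_bigr => a _ do rewrite (covN a).2.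
rewrite -mulr_sumr mulrA divff ?mul1r; last by rewrite pnatr_eq0 -lt0n.
by near: N.
Unshelve. all: by end_near. Qed.

Let d4_moment : \forall N \near \oo,
  integrable (d4 N) /\ N%:R * \int[Pr]_w d4 N w <= n%:R * K4 * N%:R^-1.
Proof.
near=> N.
have N0 : (0 < N)%N by near: N; exact: near_gt0.
have i4 : forall a, integrable (fun w => delta N w a 0 ^+ 4) /\
  \int[Pr]_w (delta N w a 0 ^+ 4) <= K4 * N%:R^-1 ^+ 2 by near: N.
split; first by apply: integrable_bigsum => a; case: (i4 a).
rewrite Rintegral_bigsum; last by move=> a; case: (i4 a).
apply: (@le_trans _ _ (N%:R * \sum_(a < n) K4 * N%:R^-1 ^+ 2)).
  by rewrite ler_wpM2l //; apply: ler_sum => a _; case: (i4 a).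
rewrite sumr_const card_ord -mulr_natl le_eqVlt; apply/orP; left; apply/eqP.
by field; rewrite pnatr_eq0 -lt0n.
Unshelve. all: by end_near. Qed.

Let norm2_le N w : `|delta N w| ^+ 2 <= d2 N w.
Proof. exact: mx_norm_even_pow_le. Qed.

Let norm4_le N w : `|delta N w| ^+ 4 <= d4 N w.
Proof. exact: mx_norm_even_pow_le. Qed.

Let norm1_le N w : `|delta N w| <= 1 + d2 N w.
Proof.
have [h|h] := leP `|delta N w| 1.
  by rewrite (le_trans h) // lerDl (le_trans _ (norm2_le N w)) // sqr_ge0.
apply: (@le_trans _ _ (`|delta N w| ^+ 2)); first by rewrite expr2 ler_peMl // ltW.
by rewrite (le_trans (norm2_le N w)) // lerDr.
Qed.

Let entry_diff N : (forall w, `|q N w - v N| <= C * `|delta N w|) ->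
  forall w a, `|q N w a 0 - v N a 0| <= `|C| * `|delta N w|.
Proof.
move=> qv w a; apply: (@le_trans _ _ `|q N w - v N|).
  by have := entry_le_mx_norm (q N w - v N) a 0; rewrite !mxE.
by rewrite (le_trans (qv w)) // ler_wpM2r // ler_norm.
Qed.

Lemma q_square_integrable : \forall N \near \oo, forall a,
  integrable (fun w => q N w a 0 ^+ 2).
Proof.
have [M d2M] := d2_moment; near=> N => a.
have [id2 _] : integrable (d2 N) /\ N%:R * \int[Pr]_w d2 N w <= M by near: N.
have qv : forall w, `|q N w - v N| <= C * `|delta N w| by near: N.
have mq : is_random_vector (q N) by near: N.
apply: (@integrable_dominated _ _ _ _ _
  (fun w => 2 * v N a 0 ^+ 2 + 2 * C ^+ 2 * d2 N w)).
- by apply: measurable_funX; exact: mq.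
- by apply: integrable_addr; [exact: integrable_constr|exact: integrable_scaler].
move=> w; have := entry_diff qv w a.
set x := q N w a 0; set y := v N a 0 => xy.
have xy2 : (x - y) ^+ 2 <= C ^+ 2 * d2 N w.
  rewrite -[leLHS]real_normK ?num_real //.
  apply: (@le_trans _ _ ((`|C| * `|delta N w|) ^+ 2)).
    by apply: lerXn2r; rewrite ?nnegrE // mulr_ge0.
  by rewrite exprMn real_normK ?num_real // ler_wpM2l ?sqr_ge0.
rewrite ger0_norm ?sqr_ge0 //; have := sqr_ge0 (x - 2 * y); nra.
Unshelve. all: by end_near. Qed.

(** By Young's inequality [|x^2 - y^2| <= t y^2 + (1 + 1/t) (x - y)^2], and the
    integral of the last square is of order [1 / N] by the Lipschitz bound. *)
Lemma q_second_moment_cvg :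
  (fun N => \int[Pr]_w sqnorm2 (q N w)) @ \oo --> sqnorm2 v0.
Proof.
have [M d2M] := d2_moment.
have entry a : (fun N => \int[Pr]_w (q N w a 0 ^+ 2)) @ \oo --> v0 a 0 ^+ 2.
  have vcvg : (fun N => v N a 0 * v N a 0) @ \oo --> v0 a 0 * v0 a 0.
    by move/cvg_mxP : v_cvg => /(_ a 0) h; exact: cvgM.
  suff diff0 : (fun N => \int[Pr]_w (q N w a 0 ^+ 2) - v N a 0 ^+ 2) @ \oo --> (0 : R).
    have -> : (fun N => \int[Pr]_w (q N w a 0 ^+ 2)) = (fun N =>
        (\int[Pr]_w (q N w a 0 ^+ 2) - v N a 0 ^+ 2) + v N a 0 * v N a 0).
      by apply/funext => N; rewrite -expr2 subrK.
    by rewrite -[v0 a 0 ^+ 2]add0r expr2; exact: cvgD.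
  apply: cvg0_harmonic_bound => eps eps0.
  pose Mv := v0 a 0 * v0 a 0 + 1.
  have Mv0 : 0 < Mv by rewrite ltr_wpDl // -expr2 sqr_ge0.
  pose t := eps / Mv; have t0 : 0 < t by rewrite divr_gt0.
  exists ((1 + t^-1) * C ^+ 2 * M); near=> N.
  have N0 : (0 < N)%N by near: N; exact: near_gt0.
  have [id2 Md2] : integrable (d2 N) /\ N%:R * \int[Pr]_w d2 N w <= M by near: N.
  have qv : forall w, `|q N w - v N| <= C * `|delta N w| by near: N.
  have iqa : forall a, integrable (fun w => q N w a 0 ^+ 2).
    by near: N; exact: q_square_integrable.
  have iq := iqa a.
  have vMv : v N a 0 ^+ 2 <= Mv.
    by rewrite expr2; near: N; apply: (cvgr_le _ vcvg); rewrite ltrDl.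
  have -> : \int[Pr]_w (q N w a 0 ^+ 2) - v N a 0 ^+ 2
      = \int[Pr]_w (q N w a 0 ^+ 2 - v N a 0 ^+ 2).
    rewrite RintegralB //; last exact: integrable_constr.
    by rewrite (Rintegral_probability_cst Pr (v N a 0 ^+ 2)).
  have idiff : integrable (fun w => q N w a 0 ^+ 2 - v N a 0 ^+ 2).
    by apply: integrable_subr => //; exact: integrable_constr.
  apply: le_trans (le_normr_Rintegral _ idiff) _ => //.
  apply: (@le_trans _ _ (\int[Pr]_w (eps + (1 + t^-1) * C ^+ 2 * d2 N w))).
    apply: le_Rintegral => //; first exact: integrable_norm.
      by apply: integrable_addr; [exact: integrable_constr|exact: integrable_scaler].
    move=> w _; apply: (@le_trans _ _ (t * v N a 0 ^+ 2
        + (1 + t^-1) * (q N w a 0 - v N a 0) ^+ 2)).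
      set x := q N w a 0; set y := v N a 0.
      have h1 := sqr_ge0 (t * y + (x - y)); have h2 := sqr_ge0 (t * y - (x - y)).
      have tv : 0 < t^-1 by rewrite invr_gt0.
      have g1 : 0 <= t^-1 * (t * y + (x - y)) ^+ 2 by rewrite mulr_ge0 // ltW.
      have g2 : 0 <= t^-1 * (t * y - (x - y)) ^+ 2 by rewrite mulr_ge0 // ltW.
      have e1 : t^-1 * (t * y + (x - y)) ^+ 2
          = t * y ^+ 2 + 2 * y * (x - y) + t^-1 * (x - y) ^+ 2.
        by field; exact: lt0r_neq0.
      have e2 : t^-1 * (t * y - (x - y)) ^+ 2
          = t * y ^+ 2 - 2 * y * (x - y) + t^-1 * (x - y) ^+ 2.
        by field; exact: lt0r_neq0.
      rewrite e1 in g1; rewrite e2 in g2.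
      have s0 := sqr_ge0 (x - y).
      rewrite ler_norml; apply/andP; split; lra.
    rewrite lerD //.
      apply: (@le_trans _ _ (t * Mv)); first by rewrite ler_pM2l.
      by rewrite /t divfK // lt0r_neq0.
    rewrite -mulrA ler_pM2l ?ltr_pDr ?invr_gt0 ?addr_gt0 ?invr_gt0 //.
    rewrite -[leLHS]real_normK ?num_real //.
    apply: (@le_trans _ _ ((`|C| * `|delta N w|) ^+ 2)).
      by apply: lerXn2r; rewrite ?nnegrE ?mulr_ge0 //; exact: entry_diff.
    by rewrite exprMn real_normK ?num_real // ler_wpM2l ?sqr_ge0.
  rewrite RintegralD //; [|exact: integrable_constr|exact: integrable_scaler].
  rewrite Rintegral_probability_cst lerD2l RintegralZl //.
  rewrite -[leRHS]mulrA ler_wpM2l //.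
    by rewrite mulr_ge0 ?sqr_ge0 // addr_ge0 // invr_ge0 ltW.
  by rewrite ler_pdivlMr ?ltr0n // mulrC.
have sumE : \forall N \near \oo, \sum_a \int[Pr]_w (q N w a 0 ^+ 2)
    = \int[Pr]_w sqnorm2 (q N w).
  apply: filterS q_square_integrable => N iq.
  by rewrite /sqnorm2 Rintegral_bigsum.
apply: cvg_trans (near_eq_cvg sumE) _.
by apply: cvg_big => [|a _]; [exact: add_continuous|exact: entry].
Unshelve. all: by end_near. Qed.

Let measurable_dotv N : is_random_vector (delta N) -> is_random_vector (q N) ->
  measurable_fun setT (fun w => dotv (delta N w) (q N w)).
Proof. by move=> md mq; apply: measurable_sum => a; exact: measurable_funM. Qed.

Lemma dotv_integrable : \forall N \near \oo,
  integrable (fun w => dotv (delta N w) (q N w)).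
Proof.
have [M d2M] := d2_moment; near=> N.
have [id2 _] : integrable (d2 N) /\ N%:R * \int[Pr]_w d2 N w <= M by near: N.
have qv : forall w, `|q N w - v N| <= C * `|delta N w| by near: N.
have mq : is_random_vector (q N) by near: N.
have md : is_random_vector (delta N) by near: N.
apply: (@integrable_dominated _ _ _ _ _
  (fun w => n%:R * (`|v N| + (`|v N| + `|C|) * d2 N w))).
- exact: measurable_dotv.
- apply: integrable_scaler.
  by apply: integrable_addr; [exact: integrable_constr|exact: integrable_scaler].
move=> w; apply: le_trans (dotv_le _ _) _; rewrite ler_wpM2l //.
have qn : `|q N w| <= `|v N| + `|C| * `|delta N w|.
  rewrite -[q N w](subrK (v N)) addrC (le_trans (ler_normD _ _)) // lerD2l.
  by rewrite (le_trans (qv w)) // ler_wpM2r // ler_norm.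
apply: (@le_trans _ _ (`|delta N w| * (`|v N| + `|C| * `|delta N w|))).
  by rewrite ler_wpM2l.
rewrite mulrDr mulrCA -expr2 mulrDl addrA lerD //.
  by rewrite -[X in X + _]mulr1 -mulrDr mulrC ler_wpM2l.
by rewrite ler_wpM2l.
Unshelve. all: by end_near. Qed.

(** The constant part of [q] is uncorrelated with [delta], the linear part
    contributes the trace, and the remainder is controlled by the second and
    fourth moments of [delta]. *)
Lemma cross_moment_cvg :
  (fun N => N%:R * \int[Pr]_w dotv (delta N w) (q N w)) @ \oo
  --> \tr (H0 *m S0^T).
Proof.
have [M d2M] := d2_moment.
pose main N := \tr (H N *m (S N)^T).
have main_cvg : main @ \oo --> \tr (H0 *m S0^T).
  apply: cvg_big => [|a _]; first exact: add_continuous.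
  pose proof (cvg_mulmx H_cvg (cvg_trmx S_cvg)) as HS.
  by move/cvg_mxP : HS; apply.
suff diff0 : (fun N => N%:R * \int[Pr]_w dotv (delta N w) (q N w) - main N)
    @ \oo --> (0 : R).
  have -> : (fun N => N%:R * \int[Pr]_w dotv (delta N w) (q N w)) = (fun N =>
      (N%:R * \int[Pr]_w dotv (delta N w) (q N w) - main N) + main N).
    by apply/funext => N; rewrite subrK.
  by rewrite -[\tr _]add0r; exact: cvgD.
apply: cvg0_harmonic_bound => eps eps0.
pose c : R := n%:R * (`|M| + 1).
have c1 : 0 < c + 1 by rewrite ltr_wpDl // mulr_ge0 // addr_ge0.
pose t := eps / (c + 1); have t0 : 0 < t by rewrite divr_gt0.
have [K qK] := q_expansion t0.
exists (n%:R * `|K| * (n%:R * K4)); near=> N.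
have N0 : (0 < N)%N by near: N; exact: near_gt0.
have [id2 Md2] : integrable (d2 N) /\ N%:R * \int[Pr]_w d2 N w <= M by near: N.
have [id4 Md4] : integrable (d4 N) /\
  N%:R * \int[Pr]_w d4 N w <= n%:R * K4 * N%:R^-1 by near: N; exact: d4_moment.
have idq : integrable (fun w => dotv (delta N w) (q N w)).
  by near: N; exact: dotv_integrable.
have mean : forall a, integrable (fun w => delta N w a 0) /\
  \int[Pr]_w delta N w a 0 = 0 by near: N.
have cov : forall a b, integrable (fun w => delta N w a 0 * delta N w b 0) /\
  \int[Pr]_w (delta N w a 0 * delta N w b 0) = N%:R^-1 * S N a b by near: N.
have qKN : forall w, `|q N w - v N - H N *m delta N w|
    <= t * `|delta N w| + K * `|delta N w| ^+ 3 by near: N.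
pose lin w := \sum_a v N a 0 * delta N w a 0.
pose bil w := \sum_a \sum_b H N a b * (delta N w a 0 * delta N w b 0).
pose rem w := dotv (delta N w) (q N w - v N - H N *m delta N w).
have splitE w : dotv (delta N w) (q N w) = lin w + bil w + rem w.
  rewrite /lin /bil /rem /dotv -!big_split /=; apply: eq_bigr => a _.
  rewrite !mxE -[X in _ + X + _](_ : delta N w a 0 * \sum_j H N a j * delta N w j 0 = _).
    by ring.
  by rewrite mulr_sumr; apply: eq_bigr => b _; rewrite mulrCA.
have ilin : integrable lin.
  by apply: integrable_bigsum => a; apply: integrable_scaler; case: (mean a).
have ibil : integrable bil.
  apply: integrable_bigsum => a; apply: integrable_bigsum => b.
  by apply: integrable_scaler; case: (cov a b).
have irem : integrable rem.
  have -> : rem = fun w => dotv (delta N w) (q N w) - (lin w + bil w).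
    by apply/funext => w; rewrite splitE addrAC subrr add0r.
  by apply: integrable_subr => //; exact: integrable_addr.
have Elin : \int[Pr]_w lin w = 0.
  rewrite Rintegral_bigsum; last by move=> a; apply: integrable_scaler; case: (mean a).
  rewrite big1 // => a _; rewrite RintegralZl //; last by case: (mean a).
  by rewrite (mean a).2 mulr0.
have Ebil : N%:R * \int[Pr]_w bil w = main N.
  have inner a : integrable (fun w => \sum_b H N a b * (delta N w a 0 * delta N w b 0)).
    by apply: integrable_bigsum => b; apply: integrable_scaler; case: (cov a b).
  rewrite Rintegral_bigsum // mulr_sumr; apply: eq_bigr => a _.
  rewrite Rintegral_bigsum; last by move=> b; apply: integrable_scaler; case: (cov a b).
  rewrite mxE mulr_sumr; apply: eq_bigr => b _.
  rewrite RintegralZl //; last by case: (cov a b).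
  by rewrite (cov a b).2 mxE mulrCA mulVKf // pnatr_eq0 -lt0n.
have -> : N%:R * \int[Pr]_w dotv (delta N w) (q N w) - main N
    = N%:R * \int[Pr]_w rem w.
  under eq_Rintegral do rewrite splitE.
  rewrite RintegralD //; last exact: integrable_addr.
  by rewrite RintegralD // Elin add0r mulrDr Ebil addrAC subrr add0r.
rewrite normrM ger0_norm //.
have remle : `|\int[Pr]_w rem w|
    <= n%:R * (t * \int[Pr]_w d2 N w + `|K| * \int[Pr]_w d4 N w).
  have isum : integrable (fun w => t * d2 N w + `|K| * d4 N w).
    by apply: integrable_addr; exact: integrable_scaler.
  apply: le_trans (le_normr_Rintegral _ irem) _ => //.
  have -> : n%:R * (t * \int[Pr]_w d2 N w + `|K| * \int[Pr]_w d4 N w)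
      = \int[Pr]_w (n%:R * (t * d2 N w + `|K| * d4 N w)).
    rewrite RintegralZl // RintegralD //; [|exact: integrable_scaler..].
    by rewrite !RintegralZl.
  apply: le_Rintegral => //; first exact: integrable_norm.
    exact: integrable_scaler.
  move=> w _; apply: le_trans (dotv_le _ _) _; rewrite ler_wpM2l //.
  apply: (@le_trans _ _ (`|delta N w| * (t * `|delta N w| + `|K| * `|delta N w| ^+ 3))).
    rewrite ler_wpM2l // (le_trans (qKN w)) // lerD2l ler_wpM2r ?exprn_ge0 //.
    exact: ler_norm.
  rewrite mulrDr !(mulrCA `|delta N w|) -expr2 -[_ * `|delta N w| ^+ 3]exprS.
  apply: lerD; first by rewrite ler_pM2l //; exact: norm2_le.
  by rewrite ler_wpM2l //; exact: norm4_le.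
apply: (@le_trans _ _ (N%:R * (n%:R * (t * \int[Pr]_w d2 N w + `|K| * \int[Pr]_w d4 N w)))).
  by rewrite ler_wpM2l.
have -> : N%:R * (n%:R * (t * \int[Pr]_w d2 N w + `|K| * \int[Pr]_w d4 N w))
  = t * (n%:R * (N%:R * \int[Pr]_w d2 N w))
    + n%:R * `|K| * (N%:R * \int[Pr]_w d4 N w) by ring.
apply: lerD; last first.
  by rewrite -[leRHS]mulrA ler_wpM2l ?mulr_ge0.
apply: (@le_trans _ _ (t * (c + 1))); last by rewrite /t divfK // lt0r_neq0.
rewrite ler_pM2l // (@le_trans _ _ c) ?lerDl // ler_wpM2l //.
by rewrite (le_trans Md2) // (le_trans (ler_norm M)) // lerDl.
Unshelve. all: by end_near. Qed.

End MomentLimits.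

(** * Consistency of minimizers *)

Section Consistency.
Context {R : realType} {n p : nat}.
Variables (alpha : R) (D : set 'rV[R]_p) (P : 'rV[R]_p -> 'M[R]_n).
Hypothesis P_posdef : forall eta, D eta -> posdef (P eta).
Hypothesis P_cont : {within D, continuous P}.
Hypothesis D_compact : compact D.

Let P_unit eta : D eta -> P eta \in unitmx.
Proof. by move=> /P_posdef /posdef_unitmx. Qed.

Section JointLimits.
Context {I : Type} {F : set_system I} {FF : Filter F}.
Variables (Z : I -> 'M[R]_n) (theta : I -> 'cV[R]_n) (theta0 : 'cV[R]_n).
Hypotheses (Z0 : Z @ F --> (0 : 'M[R]_n)) (theta_cvg : theta @ F --> theta0).

Lemma cvg_shifted (eta : I -> 'rV[R]_p) x : D x -> eta @ F --> within D (nbhs x) ->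
  (fun i => P (eta i) + Z i) @ F --> P x.
Proof.
move=> Dx etax; rewrite -[P x]addr0; apply: cvgD => //.
have /subspace_continuousP/(_ _ Dx) Px := P_cont.
exact: cvg_comp etax Px.
Qed.

Lemma cvg_shifted_cost (eta : I -> 'rV[R]_p) x :
  D x -> eta @ F --> within D (nbhs x) ->
  (fun i => shifted_cost alpha P (Z i) (theta i) (eta i)) @ F
  --> shifted_cost alpha P 0 theta0 x.
Proof.
move=> Dx etax; have PZ := cvg_shifted Dx etax.
rewrite /shifted_cost addr0; apply: cvgD.
  by apply: cvg_quad => //; apply: cvg_invmx => //; exact: P_unit.
apply: cvgM; first exact: cvg_cst.
apply: continuous_cvg; last exact: cvg_det.
exact/continuous_ln/posdef_det_gt0/P_posdef.
Qed.

End JointLimits.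

(** Turns a limit along the points of [D] near [x] into the local statement
    that covering compactness asks for. *)
Lemma within_near (J : Type) (G : set_system J) (FG : Filter G)
    (Q : J -> 'rV[R]_p -> Prop) (x : 'rV[R]_p) :
  (\forall y \near within D (nbhs x) & j \near G, Q j y) ->
  \forall y \near x & j \near G, D y -> Q j y.
Proof.
case=> -[A B] /= [wA GB] AB; exists ([set y | D y -> A y], B) => //=.
by move=> [y j] [/= Ay Bj] Dy; apply: (AB (y, j)); split => //; exact: Ay.
Qed.

(** Covering compactness yields a property for all [i] far enough, not a bound;
    the bound is therefore made a second index [M], sent to infinity. *)
Lemma uniform_invmx_bound {I : Type} {F : set_system I} {FF : ProperFilter F}
    (Z : I -> 'M[R]_n) : Z @ F --> (0 : 'M[R]_n) ->
  exists C, \forall i \near F, forall x, D x -> `|invmx (P x + Z i)| <= C.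
Proof.
move=> Z0; pose G := filter_prod (+oo : set_system R) F.
have cover : \forall Mi \near G, D `<=` [set x | `|invmx (P x + Z Mi.2)| <= Mi.1].
  have /compact_near_coveringP/near_covering_withinP := D_compact.
  apply => x Dx; apply: within_near.
  have ucvg : (fun z : 'rV[R]_p * (R * I) => invmx (P z.1 + Z z.2.2))
      @ filter_prod (within D (nbhs x)) G --> invmx (P x).
    apply: cvg_invmx; first exact: P_unit.
    apply: (@cvg_shifted _ _ _ (fun z => Z z.2.2)) Dx _; last exact: cvg_fst.
    apply: cvg_comp Z0; apply: (cvg_comp _ _ cvg_snd); exact: cvg_snd.
  have Mcvg : (fun z : 'rV[R]_p * (R * I) => z.2.1)
      @ filter_prod (within D (nbhs x)) G --> (+oo : set_system R).
    by apply: (cvg_comp _ _ cvg_snd); exact: cvg_fst.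
  have h1 : \forall z \near filter_prod (within D (nbhs x)) G,
      `|invmx (P z.1 + Z z.2.2)| <= `|invmx (P x)| + 1.
    by apply: cvgr_norm_le ucvg _ _; rewrite ltrDl.
  have h2 : \forall z \near filter_prod (within D (nbhs x)) G,
      `|invmx (P x)| + 1 <= z.2.1.
    by move/cvgryPge : Mcvg; apply.
  by apply: filterS2 h1 h2 => -[y [M i]] /=; exact: le_trans.
have [[A B] /= [oA FB] AB] := cover.
have [M AM] := filter_ex oA.
by exists M; apply: filterS FB => i Bi x; apply: (AB (M, i)).
Qed.

Section Minimizers.
Context {I : Type} {F : set_system I} {FF : Filter F}.
Variables (Z : I -> 'M[R]_n).
Hypothesis Z0 : Z @ F --> (0 : 'M[R]_n).
Variables (theta : I -> 'cV[R]_n) (theta0 : 'cV[R]_n) (eta : I -> 'rV[R]_p).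
Variable eta0 : 'rV[R]_p.
Hypothesis theta_cvg : theta @ F --> theta0.
Hypothesis eta_min : \forall i \near F,
  is_minimizer D (shifted_cost alpha P (Z i) (theta i)) (eta i).
Hypothesis eta0_min : is_unique_minimizer D (shifted_cost alpha P 0 theta0) eta0.

(** The costs converge jointly in all their arguments; off any neighbourhood
    of [eta0] in the compact [D], the limit cost exceeds its minimum, hence so
    do eventually, and uniformly, the costs themselves. *)
Lemma minimizer_cvg : eta @ F --> eta0.
Proof.
have [Deta0 min0] := eta0_min.
move=> U; rewrite nbhsE => -[V [oV Veta0] VU].
have Kc : compact (D `&` ~` V) by apply: compact_closedI => //; exact: open_closedC.
have cost0 : (fun i => shifted_cost alpha P (Z i) (theta i) eta0) @ F
    --> shifted_cost alpha P 0 theta0 eta0.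
  apply: cvg_shifted_cost => //.
  move=> A; rewrite nbhs_filterE => wA; apply: nearW => i.
  exact: (nbhs_singleton (wA : nbhs eta0 _)).
have above : \forall i \near F, (D `&` ~` V) `<=` [set x |
    shifted_cost alpha P (Z i) (theta i) eta0
    < shifted_cost alpha P (Z i) (theta i) x].
  move/compact_near_coveringP/near_covering_withinP : Kc; apply => x [Dx Vx].
  have xeta0 : x != eta0 by apply/eqP => E; apply: Vx; rewrite E.
  have lt0 := min0 _ Dx xeta0.
  have near_D : \forall y \near x & i \near F, D y ->
      shifted_cost alpha P (Z i) (theta i) eta0
      < shifted_cost alpha P (Z i) (theta i) y.
    apply: within_near.
    have ccvg : (fun z : 'rV[R]_p * I => shifted_cost alpha P (Z z.2) (theta z.2) z.1
          - shifted_cost alpha P (Z z.2) (theta z.2) eta0)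
        @ filter_prod (within D (nbhs x)) F
        --> shifted_cost alpha P 0 theta0 x - shifted_cost alpha P 0 theta0 eta0.
      apply: cvgB; last exact: cvg_comp cvg_snd cost0.
      apply: (@cvg_shifted_cost _ _ _ (fun z => Z z.2) (fun z => theta z.2)) => //.
      - exact: cvg_comp cvg_snd Z0.
      - exact: cvg_comp cvg_snd theta_cvg.
      - exact: cvg_fst.
    have lt0' : 0 < shifted_cost alpha P 0 theta0 x
        - shifted_cost alpha P 0 theta0 eta0 by rewrite subr_gt0.
    pose proof (cvgr_gt _ ccvg _ lt0') as ccvg0.
    by apply: filterS ccvg0 => -[y i] /=; rewrite subr_gt0.
  by apply: filterS near_D => -[y i] /= h [Dy _]; exact: h.
apply: filterS2 eta_min above => i [Di mini] abovei; apply: VU.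
apply: contrapT => Vi; have := abovei (eta i) (conj Di Vi).
by rewrite /= ltNge => /negP; apply; exact: mini.
Qed.

End Minimizers.

End Consistency.

(** * The excess risk *)

Section RiskAlgebra.
Context {R : realType} {n p : nat}.

Lemma sqnorm2B (x z : 'cV[R]_n) t :
  sqnorm2 (x - t *: z) = sqnorm2 x - 2 * t * dotv x z + t ^+ 2 * sqnorm2 z.
Proof.
rewrite /sqnorm2 /dotv !mulr_sumr -sumrN -!big_split; apply: eq_bigr => a _ /=.
rewrite !mxE; ring.
Qed.

Lemma sqnorm2Z (x : 'cV[R]_n) t : sqnorm2 (t *: x) = t ^+ 2 * sqnorm2 x.
Proof.
by rewrite /sqnorm2 mulr_sumr; apply: eq_bigr => a _; rewrite mxE exprMn.
Qed.

Variables (sigma alpha : R) (P : 'rV[R]_p -> 'M[R]_n) (theta0 : 'cV[R]_n).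
Variables (Sigma : 'M[R]_n) (eta : 'rV[R]_p).

Lemma bias_jacobianE : bias_jacobian sigma P theta0 Sigma eta
  = - (sigma ^+ 2 *: (invmx Sigma *m sensitivity_mx P theta0 eta)).
Proof.
have entry (x : 'cV[R]_n) (M : 'M[R]_(n, p)) i k :
    (forall j, x j 0 = M j k) -> (invmx Sigma *m x) i 0 = (invmx Sigma *m M) i k.
  by move=> xM; rewrite !mxE; apply: eq_bigr => j _; rewrite xM.
have opp a b (M : 'M[R]_(a, b)) i k c : (- (c *: M)) i k = - (c * M i k).
  by rewrite !mxE.
apply/matrixP => i k; rewrite mxE !opp -mulmxA (entry _ (sensitivity_mx P theta0 eta) _ k) //.
by move=> j; rewrite [RHS]mxE.
Qed.

(** The variance and the hyper-parameter terms are the two parts of the gain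
    matrix, a trace being the same for a matrix and its transpose. *)
Lemma limit_risk_decomposition :
  sigma ^+ 4 * sqnorm2 (invmx Sigma *m (invmx (P eta) *m theta0))
  - 2 * sigma ^+ 2 * \tr (invmx Sigma *m gain_mx alpha P theta0 eta
                          *m (sigma ^+ 2 *: invmx Sigma))
  = sqnorm2 (XBias sigma P theta0 Sigma eta) + \tr (XVar sigma P Sigma eta)
    + \tr (XVarHPE sigma alpha P theta0 Sigma eta).
Proof.
have -> : XBias sigma P theta0 Sigma eta
    = (- sigma ^+ 2) *: (invmx Sigma *m (invmx (P eta) *m theta0)).
  by rewrite /XBias scaleNr mulmxA.
rewrite sqnorm2Z sqrrN -exprM -addrA; congr (_ + _).
rewrite /XVar /XVarHPE !mxtraceD !mxtrace_tr.
have -> : \tr (XVar_half sigma P Sigma eta)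
    = - (sigma ^+ 4 * \tr (invmx Sigma *m invmx (P eta) *m invmx Sigma)).
  by rewrite /XVar_half raddfN /= mxtraceZ -exprM.
have -> : \tr (XVarHPE_half sigma alpha P theta0 Sigma eta)
    = sigma ^+ 4 * \tr (invmx Sigma *m sensitivity_mx P theta0 eta
        *m invmx (A_b alpha P theta0 eta) *m B_b P theta0 eta *m invmx Sigma).
  rewrite /XVarHPE_half bias_jacobianE !mulNmx -!scalemxAl scalerN scalerA opprK.
  by rewrite mxtraceZ -exprD.
rewrite /gain_mx mulmxBr mulmxBl -!scalemxAr raddfB /= !mxtraceZ !mulmxA.
ring.
Qed.

End RiskAlgebra.

Section RealExpectation.
Context d (T : measurableType d) {R : realType} (Pr : probability T R).

Lemma expectation_Rintegral (f : T -> R) : Pr.-integrable setT (EFin \o f) ->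
  'E_Pr[f]%E = (\int[Pr]_w f w)%:E.
Proof. by move=> fi; rewrite unlock fineK //; exact: integrable_fin_num. Qed.

End RealExpectation.

Section ExcessRisk.
Context {R : realType} d (T : measurableType d) (Pr : probability T R) {n p : nat}.
Variables (sigma alpha : R) (theta0 : 'cV[R]_n) (u : int -> R) (Sigma : 'M[R]_n).
Hypotheses (sigma_gt0 : 0 < sigma) (Sigma_posdef : posdef Sigma).
Hypothesis rank_regressor : forall N, (n <= N)%N -> \rank (regressor n u N) = n.
Hypothesis cvg_Sigma : (fun N : nat => N%:R^-1 *:
  ((regressor n u N)^T *m regressor n u N)) @ \oo --> Sigma.
Variable E : forall N : nat, 'I_N -> {RV Pr >-> R}.
Arguments E : clear implicits.
Hypothesis E_gaussian : forall N, (n <= N)%N -> white_gaussian sigma (E N).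
Variables (D : set 'rV[R]_p) (P : 'rV[R]_p -> 'M[R]_n).
Hypothesis P_posdef : forall eta, D eta -> posdef (P eta).
Hypothesis P_cont : {within D, continuous P}.
Hypothesis P_C2 : C2_on D° P.
Variable eta_hat : forall N : nat, 'cV[R]_N -> 'rV[R]_p.
Hypothesis eta_hat_argmin : forall N (y : 'cV[R]_N), (n <= N)%N ->
  is_minimizer D (EB_cost sigma u alpha P y) (eta_hat y).
Hypothesis D_compact : compact D.
Hypothesis eta_hat_critical : forall N (y : 'cV[R]_N), (n <= N)%N ->
  critical_point (EB_cost_ML sigma u alpha P N (theta_ML u y)) (eta_hat y).
Variable eta_star : 'rV[R]_p.
Hypothesis eta_star_min : regular_minimum D (W_b alpha P theta0) eta_star.

Let Phi N := regressor n u N.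
Let Gram N : 'M[R]_n := (Phi N)^T *m Phi N.
Let V N : 'M[R]_n := invmx (N%:R^-1 *: Gram N).
Let Z N : 'M[R]_n := sigma ^+ 2 *: invmx (Gram N).
Let delta N (w : T) : 'cV[R]_n := noise_image (E N) (invmx (Gram N) *m (Phi N)^T) w.
Let y N (w : T) : 'cV[R]_N := output u theta0 (E N) w.
(** The regularized estimate is [theta_ML - sigma ^+ 2 *: (invmx Gram *m g)].
    For noiseless data, [eta_hat] and [g] become the deterministic [eta_c] and
    [c], around which [g] is expanded. *)
Let g N (w : T) : 'cV[R]_n :=
  invmx (P (eta_hat (y N w)) + Z N) *m (theta0 + delta N w).
Let eta_c N : 'rV[R]_p := eta_hat (Phi N *m theta0).
Let c N : 'cV[R]_n := invmx (P (eta_c N) + Z N) *m theta0.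
Let gain : 'M[R]_n := gain_mx alpha P theta0 eta_star.

Let eta_star_int : D° eta_star. Proof. by case: eta_star_min. Qed.
Let Sigma_unit : Sigma \in unitmx. Proof. exact: posdef_unitmx. Qed.

Lemma near_sample_size : \forall N \near \oo, (n <= N)%N /\ (0 < N)%N.
Proof. by exists (maxn n 1) => // N /=; rewrite geq_max => /andP. Qed.

Lemma invmx_GramE N : (0 < N)%N -> (n <= N)%N ->
  invmx (Gram N) = N%:R^-1 *: V N.
Proof.
move=> N0 nN; have GU : Gram N \in unitmx.
  by apply/posdef_unitmx/posdef_gram/rank_regressor.
have Nu : (N%:R^-1 : R) != 0 by rewrite invr_eq0 pnatr_eq0 -lt0n.
by rewrite /V invmxZ ?unitmxZ ?unitfE // invrK scalerA mulVf ?scale1r // -invr_eq0.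
Qed.

Lemma V_cvg : V @ \oo --> invmx Sigma.
Proof. by apply: cvg_invmx. Qed.

Lemma Z_cvg : Z @ \oo --> (0 : 'M[R]_n).
Proof.
have ZV : \forall N \near \oo, (sigma ^+ 2 * N%:R^-1) *: V N = Z N.
  apply: filterS near_sample_size => N [nN N0].
  by rewrite /Z invmx_GramE // scalerA.
apply: cvg_trans (near_eq_cvg ZV) _.
have s0 : (fun N : nat => sigma ^+ 2 / N%:R) @ \oo --> (0 : R).
  by rewrite -(mulr0 (sigma ^+ 2)); apply: cvgM; [exact: cvg_cst|exact: cvg_invn].
pose proof (cvgZ s0 V_cvg) as ZVcvg; rewrite scale0r in ZVcvg.
exact: ZVcvg.
Qed.

Lemma theta_MLE N w : (n <= N)%N -> theta_ML u (y N w) = theta0 + delta N w.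
Proof. by move=> nN; rewrite /y /output theta_ML_output //; exact: rank_regressor. Qed.

Lemma theta_ML_noiseless N : (n <= N)%N -> theta_ML u (Phi N *m theta0) = theta0.
Proof.
move=> nN; rewrite -[Phi N *m theta0]addr0 theta_ML_output ?mulmx0 ?addr0 //.
exact: rank_regressor.
Qed.

(** Large sample sizes together with outcomes of small estimation error. Limits
    along this filter are deterministic statements uniform in the outcome, so the
    expansions apply to random quantities as they stand. *)
Definition small_error : set_system (nat * T) := fun A => exists2 r, 0 < r &
  \forall N \near \oo, forall w, `|delta N w| < r -> A (N, w).

Global Instance small_error_filter : Filter small_error.
Proof.
split.
- by exists 1 => //; apply: nearW.
- move=> A B [r r0 rA] [r' r'0 rB]; exists (Num.min r r').
    by rewrite lt_min r0.
  apply: filterS2 rA rB => N NA NB w; rewrite lt_min => /andP[wr wr'].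
  by split; [exact: NA|exact: NB].
- move=> A B AB [r r0 rA]; exists r => //.
  by apply: filterS rA => N NA w /NA; exact: AB.
Qed.

Lemma small_error_fst (Q : nat -> Prop) : (\forall N \near \oo, Q N) ->
  \forall i \near small_error, Q i.1.
Proof. by move=> QN; exists 1 => //; apply: filterS QN => N h w _. Qed.

Lemma small_error_cvg_fst (U : topologicalType) (f : nat -> U) (l : U) :
  f @ \oo --> l -> (fun i => f i.1) @ small_error --> l.
Proof. by move=> fl A /fl; exact: small_error_fst. Qed.

Lemma small_error_delta :
  (fun i => theta0 + delta i.1 i.2) @ small_error --> theta0.
Proof.
apply/cvgrPdist_lt => eps eps0; exists eps => //; apply: nearW => N w /=.
by rewrite opprD addrA subrr sub0r normrN.
Qed.

Lemma W_unique_min : is_unique_minimizer D (shifted_cost alpha P 0 theta0) eta_star.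
Proof. by rewrite -W_bE; case: eta_star_min. Qed.

Lemma eta_hat_cvg : (fun i => eta_hat (y i.1 i.2)) @ small_error --> eta_star.
Proof.
apply: (minimizer_cvg P_posdef P_cont D_compact (small_error_cvg_fst Z_cvg)
  small_error_delta _ W_unique_min).
apply: filterS (small_error_fst near_sample_size) => -[N w] /= [nN _].
rewrite -theta_MLE //.
by apply: (EB_minimizer sigma_gt0 (rank_regressor nN) P_posdef); exact: eta_hat_argmin.
Qed.

Lemma eta_c_cvg : eta_c @ \oo --> eta_star.
Proof.
apply: (minimizer_cvg P_posdef P_cont D_compact Z_cvg (cvg_cst theta0) _ W_unique_min).
apply: filterS near_sample_size => N [nN _].
rewrite -[X in shifted_cost _ _ _ X](theta_ML_noiseless nN).
by apply: (EB_minimizer sigma_gt0 (rank_regressor nN) P_posdef); exact: eta_hat_argmin.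
Qed.

Lemma critical_gradient N (yN : 'cV[R]_N) : (n <= N)%N -> D° (eta_hat yN) ->
  forall k, cost_gradient alpha P (Z N) (theta_ML u yN) k (eta_hat yN) = 0.
Proof.
move=> nN Deta k; have [_ crit0] := eta_hat_critical yN nN k.
have [dP _ _] := P_C2 Deta k.
have posS : posdef (P (eta_hat yN) + Z N).
  apply: posdefD; first by apply: P_posdef; exact: interior_subset.
  apply: posdefZ; first exact: exprn_gt0.
  exact/posdef_invmx/posdef_gram/rank_regressor.
have [_ gradE] := is_derive_shifted_cost alpha (theta_ML u yN) dP (posdef_det_gt0 posS).
by rewrite -gradE -crit0.
Qed.

Lemma A_b_regular : (A_b alpha P theta0 eta_star)^T = A_b alpha P theta0 eta_star
  /\ A_b alpha P theta0 eta_star \in unitmx.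
Proof.
have [_ _ _ Hpd] := eta_star_min.
rewrite -(hessian_W _ P_posdef P_C2 theta0 eta_star_int).
by split; [case: Hpd|exact: posdef_unitmx].
Qed.

Lemma g_expansion : small (F := small_error) (fun i => `|delta i.1 i.2|)
  (fun i => g i.1 i.2 - c i.1 - gain *m delta i.1 i.2).
Proof.
have [A_sym A_unit] := A_b_regular.
have crit1 : \forall i \near small_error, forall k,
    cost_gradient alpha P (Z i.1) (theta0 + delta i.1 i.2) k (eta_hat (y i.1 i.2)) = 0.
  have int1 : \forall i \near small_error, D° (eta_hat (y i.1 i.2)).
    exact: (eta_hat_cvg (interior_near eta_star_int)).
  apply: filterS2 int1 (small_error_fst near_sample_size) => -[N w] /= Dw [nN _] k.
  by rewrite -theta_MLE //; exact: critical_gradient.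
have crit2 : \forall i \near small_error, forall k,
    cost_gradient alpha P (Z i.1) theta0 k (eta_c i.1) = 0.
  have int2 : \forall N \near \oo, D° (eta_c N).
    exact: (eta_c_cvg (interior_near eta_star_int)).
  apply: (@small_error_fst (fun N => forall k,
    cost_gradient alpha P (Z N) theta0 k (eta_c N) = 0)).
  apply: filterS2 int2 near_sample_size => N DN [nN _] k.
  rewrite -[X in cost_gradient _ _ _ X](theta_ML_noiseless nN).
  exact: critical_gradient.
pose proof (regularized_expansion P_posdef P_C2 eta_star_int
  (small_error_cvg_fst Z_cvg) eta_hat_cvg (small_error_cvg_fst eta_c_cvg)
  small_error_delta A_sym A_unit crit1 crit2) as ex.
have dE i : theta0 + delta i.1 i.2 - theta0 = delta i.1 i.2 by rewrite addrC addKr.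
move=> eps eps0; apply: filterS (ex eps eps0) => i.
by rewrite dE.
Qed.

Lemma c_cvg : c @ \oo --> invmx (P eta_star) *m theta0.
Proof.
apply: cvg_mulmx; last exact: cvg_cst.
have Deta : D eta_star by exact: interior_subset.
apply: cvg_invmx; first exact/posdef_unitmx/P_posdef.
apply: (cvg_shifted P_cont Z_cvg Deta) => A wA.
have := eta_c_cvg (wA : nbhs eta_star _); apply: filterS2 near_sample_size.
move=> N [nN _]; apply.
by case: (eta_hat_argmin (Phi N *m theta0) nN).
Qed.

(** Off the small-error event the error is at least [r], so a bound affine in
    the error becomes linear in it. *)
Lemma g_lipschitz : exists C, \forall N \near \oo, forall w,
  `|g N w - c N| <= C * `|delta N w|.
Proof.
have [C0 C0P] := uniform_invmx_bound P_posdef P_cont D_compact Z_cvg.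
have [r r0 rP] := g_expansion ltr01.
pose B : R := n%:R * `|C0|.
exists (1 + n%:R * `|gain| + (B * (2 * `|theta0|) / r + B)); near=> N => w.
have [nN N0] : (n <= N)%N /\ (0 < N)%N by near: N; exact: near_sample_size.
have B0 : 0 <= B by rewrite mulr_ge0.
have bound : forall x, D x -> `|invmx (P x + Z N)| <= C0 by near: N.
have mulB x (th : 'cV[R]_n) : D x -> `|invmx (P x + Z N) *m th| <= B * `|th|.
  move=> Dx; rewrite (le_trans (mx_norm_mulmx _ _)) // ler_wpM2r //.
  by rewrite ler_wpM2l // (le_trans (bound _ Dx)) // ler_norm.
have [wr|rw] := ltP `|delta N w| r.
  have near_w : `|g N w - c N - gain *m delta N w| <= 1 * `|delta N w|.
    by move: w wr; near: N.
  rewrite -[X in `|X|](subrK (gain *m delta N w)).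
  rewrite (le_trans (ler_normD _ _)) // mulrDl -[leLHS]addr0 lerD //.
    by rewrite mulrDl lerD // mx_norm_mulmx.
  by rewrite !(mulr_ge0, addr_ge0) // invr_ge0 ltW.
have gB : `|g N w| <= B * (`|theta0| + `|delta N w|).
  rewrite (le_trans (mulB _ _ _)) //; last by rewrite ler_wpM2l // ler_normD.
  by case: (eta_hat_argmin (y N w) nN).
have cB : `|c N| <= B * `|theta0|.
  by apply: mulB; case: (eta_hat_argmin (Phi N *m theta0) nN).
apply: le_trans (ler_normB _ _) _; apply: le_trans (lerD gB cB) _.
rewrite mulrDl -[leLHS]add0r lerD ?mulr_ge0 ?addr_ge0 ?mulr_ge0 //.
rewrite mulrDl mulrDr addrAC lerD //.
rewrite [leRHS]mulrAC ler_pdivlMr //.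
have -> : B * `|theta0| + B * `|theta0| = B * (2 * `|theta0|) by ring.
by rewrite ler_wpM2l // !mulr_ge0.
Unshelve. all: by end_near. Qed.

(** Where the error is at least [r], the Lipschitz bound is at most its cube
    divided by [r ^+ 2], and cubes of the error are negligible on average. *)
Lemma g_remainder eps : 0 < eps -> exists K, \forall N \near \oo, forall w,
  `|g N w - c N - gain *m delta N w| <= eps * `|delta N w| + K * `|delta N w| ^+ 3.
Proof.
move=> eps0; have [C CP] := g_lipschitz; have [r r0 rP] := g_expansion eps0.
pose B : R := `|C| + n%:R * `|gain|.
have B0 : 0 <= B by rewrite addr_ge0 // mulr_ge0.
exists (B / r ^+ 2); near=> N => w.
have Bw : 0 <= B / r ^+ 2 * `|delta N w| ^+ 3.
  by rewrite mulr_ge0 ?exprn_ge0 // divr_ge0 // sqr_ge0.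
have [wr|rw] := ltP `|delta N w| r.
  have near_w : `|g N w - c N - gain *m delta N w| <= eps * `|delta N w|.
    by move: w wr {Bw}; near: N.
  by rewrite (le_trans near_w) // lerDl.
have Cw : `|g N w - c N| <= C * `|delta N w| by move: (w); near: N.
rewrite (le_trans (ler_normB _ _)) //.
apply: (@le_trans _ _ (B * `|delta N w|)).
  rewrite mulrDl lerD ?mx_norm_mulmx // (le_trans Cw) //.
  by rewrite ler_wpM2r // ler_norm.
have cube : B * `|delta N w| <= B / r ^+ 2 * `|delta N w| ^+ 3.
  have d1 : 1 <= (`|delta N w| / r) ^+ 2 by rewrite exprn_ege1 // ler_pdivlMr ?mul1r.
  have -> : B / r ^+ 2 * `|delta N w| ^+ 3
      = B * `|delta N w| * (`|delta N w| / r) ^+ 2 by field; exact: lt0r_neq0.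
  by rewrite ler_peMr // mulr_ge0.
by apply: le_trans cube _; rewrite lerDr mulr_ge0 // ltW.
Unshelve. all: by end_near. Qed.

Let est_ML N (w : T) : 'cV[R]_n := theta_ML u (y N w).
Let est_reg N (w : T) : 'cV[R]_n :=
  theta_reg sigma u (P (eta_hat (y N w))) (y N w).
Hypothesis est_reg_measurable : forall N, (n <= N)%N -> is_random_vector (est_reg N).
(** Both terms of the excess risk are moments of this vector: its mean square,
    and its correlation with [delta]. *)
Let q N w := V N *m g N w.
Let S N : 'M[R]_n := sigma ^+ 2 *: V N.

Lemma est_reg_error N w : (0 < N)%N -> (n <= N)%N ->
  est_reg N w - theta0 = delta N w - (sigma ^+ 2 / N%:R) *: q N w.
Proof.
move=> N0 nN; rewrite /est_reg theta_regE //; last 2 first.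
- exact: rank_regressor.
- by apply: P_posdef; case: (eta_hat_argmin (y N w) nN).
rewrite theta_MLE // -/(Phi N) -/(Gram N) -/(Z N) -/(g N w) invmx_GramE //.
rewrite -scalemxAl scalerA addrAC; congr (_ - _).
by rewrite addrC addKr.
Qed.

Lemma measurable_delta N : is_random_vector (delta N).
Proof. by move=> a; exact: measurable_noise_image. Qed.

(** [q] is read off the estimator, whose measurability is assumed, because its
    definition goes through the arbitrary selection [eta_hat]. *)
Lemma measurable_q N : (0 < N)%N -> (n <= N)%N -> is_random_vector (q N).
Proof.
move=> N0 nN a.
have qE w : q N w a 0 = (N%:R / sigma ^+ 2)
    * (delta N w a 0 - (est_reg N w a 0 - theta0 a 0)).
  have := est_reg_error w N0 nN => /matrixP/(_ a 0); rewrite !mxE => ->.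
  by field; rewrite pnatr_eq0 -lt0n N0 lt0r_neq0.
under eq_fun do rewrite qE.
apply: measurable_funM; first exact: measurable_cst.
apply: measurable_funB; first exact: measurable_delta.
by apply: measurable_funB; [exact: est_reg_measurable|exact: measurable_cst].
Qed.

Let KV : R := `|invmx Sigma| + 1.

Lemma V_bounded : \forall N \near \oo, `|V N| <= KV.
Proof. by apply: cvgr_norm_le V_cvg _ _; rewrite ltrDl. Qed.

Lemma mulV_le N (x : 'cV[R]_n) b : `|V N| <= KV -> `|x| <= b ->
  `|V N *m x| <= n%:R * KV * b.
Proof.
move=> VK xb; rewrite (le_trans (mx_norm_mulmx _ _)) // ler_pM //.
by rewrite ler_wpM2l.
Qed.

Lemma q_lipschitz : exists C, \forall N \near \oo, forall w,
  `|q N w - V N *m c N| <= C * `|delta N w|.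
Proof.
have [C CP] := g_lipschitz; exists (n%:R * KV * C).
apply: filterS2 CP V_bounded => N CN VN w.
by rewrite /q -mulmxBr -[leRHS]mulrA; exact: mulV_le.
Qed.

Lemma q_remainder eps : 0 < eps -> exists K, \forall N \near \oo, forall w,
  `|q N w - V N *m c N - V N *m gain *m delta N w|
    <= eps * `|delta N w| + K * `|delta N w| ^+ 3.
Proof.
move=> eps0; pose M : R := n%:R * KV + 1.
have KV0 : 0 <= n%:R * KV by rewrite mulr_ge0 // addr_ge0.
have M0 : 0 < M by rewrite ltr_wpDl.
have [K KP] := g_remainder (divr_gt0 eps0 M0); exists (n%:R * KV * K).
apply: filterS2 KP V_bounded => N KN VN w.
rewrite /q -mulmxA -!mulmxBr (le_trans (mulV_le VN (KN w))) //.
rewrite mulrDr !mulrA lerD // ler_wpM2r // ler_pdivrMr //.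
by rewrite mulrC ler_wpM2l ?(ltW eps0) // lerDl.
Qed.

Lemma delta_mean : \forall N \near \oo, forall a,
  Pr.-integrable setT (EFin \o (fun w => delta N w a 0)) /\
  \int[Pr]_w delta N w a 0 = 0.
Proof.
apply: filterS near_sample_size => N [nN _] a.
exact: (noise_image_mean sigma_gt0 (E_gaussian nN)).
Qed.

Lemma delta_cov : \forall N \near \oo, forall a b,
  Pr.-integrable setT (EFin \o (fun w => delta N w a 0 * delta N w b 0)) /\
  \int[Pr]_w (delta N w a 0 * delta N w b 0) = N%:R^-1 * S N a b.
Proof.
apply: filterS near_sample_size => N [nN N0] a b.
have [i2 ->] := noise_image_cov sigma_gt0 (E_gaussian nN) (invmx (Gram N) *m (Phi N)^T) a b.
split=> //; rewrite ML_gain_gram ?rank_regressor // -/(Phi N) -/(Gram N) invmx_GramE //.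
by rewrite !mxE mulrCA.
Qed.

Lemma delta_fourth : \forall N \near \oo, forall a,
  Pr.-integrable setT (EFin \o (fun w => delta N w a 0 ^+ 4)) /\
  \int[Pr]_w (delta N w a 0 ^+ 4)
    <= fourth_moment_const sigma * KV ^+ 2 * N%:R^-1 ^+ 2.
Proof.
apply: filterS2 near_sample_size V_bounded => N [nN N0] VN a.
have [i4 le4] := noise_image_fourth sigma_gt0 (E_gaussian nN) (invmx (Gram N) *m (Phi N)^T) a.
split=> //; apply: le_trans le4 _.
rewrite ML_gain_gram ?rank_regressor // -/(Phi N) -/(Gram N) invmx_GramE //.
rewrite -mulrA ler_wpM2l ?fourth_moment_const_ge0 // mxE exprMn mulrC.
rewrite ler_wpM2r ?sqr_ge0 // -[leLHS]real_normK ?num_real //.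
apply: lerXn2r; rewrite ?nnegrE ?addr_ge0 //.
exact: le_trans (entry_le_mx_norm _ _ _) VN.
Qed.

Let near_measurable_delta : \forall N \near \oo, is_random_vector (delta N).
Proof. by apply: nearW; exact: measurable_delta. Qed.

Let near_measurable_q : \forall N \near \oo, is_random_vector (q N).
Proof. by apply: filterS near_sample_size => N [nN N0]; exact: measurable_q. Qed.

Let S_cvg : S @ \oo --> sigma ^+ 2 *: invmx Sigma.
Proof. by apply: cvgZr; exact: V_cvg. Qed.

Let cross_limit : (fun N => N%:R * \int[Pr]_w dotv (delta N w) (q N w)) @ \oo
  --> \tr (invmx Sigma *m gain *m (sigma ^+ 2 *: invmx Sigma)).
Proof.
have [C CP] := q_lipschitz.
have tS : (sigma ^+ 2 *: invmx Sigma)^T = sigma ^+ 2 *: invmx Sigma.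
  by rewrite linearZ /= trmx_inv Sigma_posdef.1.
rewrite -[X in \tr (_ *m X)]tS.
apply: (cross_moment_cvg near_measurable_delta delta_mean delta_cov delta_fourth
  near_measurable_q S_cvg _ CP q_remainder).
by apply: cvg_mulmx V_cvg _; exact: cvg_cst.
Qed.

Let square_limit : (fun N => \int[Pr]_w sqnorm2 (q N w)) @ \oo
  --> sqnorm2 (invmx Sigma *m (invmx (P eta_star) *m theta0)).
Proof.
have [C CP] := q_lipschitz.
apply: (q_second_moment_cvg delta_cov near_measurable_q S_cvg _ CP).
exact: cvg_mulmx V_cvg c_cvg.
Qed.

(** The squared error of the maximum likelihood estimate cancels; the powers
    of [N] of the cross term and of the squared shrinkage match the scaling. *)
Lemma excess_risk_near : \forall N \near \oo,
  scaled_excess_MSE Pr theta0 est_reg est_ML N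
  = (sigma ^+ 4 * \int[Pr]_w sqnorm2 (q N w)
     - 2 * sigma ^+ 2 * (N%:R * \int[Pr]_w dotv (delta N w) (q N w)))%:E.
Proof.
have [C CP] := q_lipschitz.
pose proof (q_square_integrable delta_cov near_measurable_q S_cvg CP) as q2.
pose proof (dotv_integrable near_measurable_delta delta_cov near_measurable_q
  S_cvg CP) as dq.
near=> N.
have [nN N0] : (n <= N)%N /\ (0 < N)%N by near: N; exact: near_sample_size.
have iq2 : forall a, Pr.-integrable setT (EFin \o (fun w => q N w a 0 ^+ 2)).
  by near: N.
have idq : Pr.-integrable setT (EFin \o (fun w => dotv (delta N w) (q N w))).
  by near: N.
have icov : forall a b,
  Pr.-integrable setT (EFin \o (fun w => delta N w a 0 * delta N w b 0)) /\
  \int[Pr]_w (delta N w a 0 * delta N w b 0) = N%:R^-1 * S N a b.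
  by near: N; exact: delta_cov.
have id2 : Pr.-integrable setT (EFin \o (fun w => sqnorm2 (delta N w))).
  by apply: integrable_bigsum => a; case: (icov a a).
have isq : Pr.-integrable setT (EFin \o (fun w => sqnorm2 (q N w))).
  exact: integrable_bigsum.
pose t : R := sigma ^+ 2 / N%:R.
have regE : (fun w => sqnorm2 (est_reg N w - theta0)) = (fun w =>
    sqnorm2 (delta N w) - 2 * t * dotv (delta N w) (q N w) + t ^+ 2 * sqnorm2 (q N w)).
  by apply/funext => w; rewrite est_reg_error // sqnorm2B.
have MLE : (fun w => sqnorm2 (est_ML N w - theta0)) = (fun w => sqnorm2 (delta N w)).
  by apply/funext => w; rewrite /est_ML theta_MLE // addrC addKr.
have i1 : Pr.-integrable setT (EFin \o (fun w =>
    sqnorm2 (delta N w) - 2 * t * dotv (delta N w) (q N w))).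
  by apply: integrable_subr => //; exact: integrable_scaler.
have i2 : Pr.-integrable setT (EFin \o (fun w => t ^+ 2 * sqnorm2 (q N w))).
  exact: integrable_scaler.
rewrite /scaled_excess_MSE /MSE regE MLE !expectation_Rintegral //; last first.
  exact: integrable_addr.
rewrite RintegralD // RintegralB //; last exact: integrable_scaler.
rewrite !RintegralZl // -EFinB -EFinM /t; congr (_%:E).
field; by rewrite pnatr_eq0 -lt0n.
Unshelve. all: by end_near. Qed.

Lemma excess_risk_cvg : scaled_excess_MSE Pr theta0 est_reg est_ML @ \oo
  --> (sqnorm2 (XBias sigma P theta0 Sigma eta_star)
       + \tr (XVar sigma P Sigma eta_star)
       + \tr (XVarHPE sigma alpha P theta0 Sigma eta_star))%:E.
Proof.
rewrite -limit_risk_decomposition.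
have eqN := excess_risk_near.
apply: cvg_trans (near_eq_cvg (filterS (fun N => @esym _ _ _) eqN)) _.
apply: cvg_EFin; first exact: nearW.
by apply: cvgB; (apply: cvgM; first exact: cvg_cst);
  [exact: square_limit|exact: cross_limit].
Qed.

End ExcessRisk.

Theorem corollary2p4
  (R : realType) (d : measure_display) (T : measurableType d)
  (Pr : probability T R) (n p : nat) (n_gt0 : (0 < n)%N)
  (sigma : R) (sigma_gt0 : 0 < sigma) (alpha : R) (alpha_gt0 : 0 < alpha)
  (theta0 : 'cV[R]_n)
  (u : int -> R) (u_causal : forall t : int, t < 0 -> u t = 0)
  (rank_regressor : forall N : nat, (n <= N)%N -> \rank (regressor n u N) = n)
  (Sigma : 'M[R]_n) (Sigma_posdef : posdef Sigma)
  (cvg_Sigma : (fun N : nat => N%:R^-1 *: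
      ((regressor n u N)^T *m regressor n u N)) @ \oo --> Sigma)
  (E : forall N : nat, 'I_N -> {RV Pr >-> R})
  (E_gaussian : forall N : nat, (n <= N)%N -> white_gaussian sigma (E N))
  (D : set 'rV[R]_p) (P : 'rV[R]_p -> 'M[R]_n)
  (P_posdef : forall eta, D eta -> posdef (P eta))
  (P_cont : {within D, continuous P})
  (P_C2 : C2_on D° P)
  (eta_hat : forall N : nat, 'cV[R]_N -> 'rV[R]_p)
  (eta_hat_argmin : forall (N : nat) (y : 'cV[R]_N), (n <= N)%N ->
      is_minimizer D (EB_cost sigma u alpha P y) (eta_hat N y))
  (cond_i : compact D)
  (cond_ii : forall (N : nat) (y : 'cV[R]_N), (n <= N)%N ->
      critical_point (EB_cost_ML sigma u alpha P N (theta_ML u y))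
                     (eta_hat N y))
  (eta_star : 'rV[R]_p)
  (cond_iii_cvg : affine_equiv_cvg D (EB_cost_ML sigma u alpha P)
      (W_b alpha P theta0) theta0)
  (cond_iii_nonzero : exists2 eta, D eta & W_b alpha P theta0 eta != 0)
  (cond_iii_min : regular_minimum D (W_b alpha P theta0) eta_star)
  (est_ML := fun (N : nat) (w : T) =>
      theta_ML u (output u theta0 (E N) w) : 'cV[R]_n)
  (est_reg := fun (N : nat) (w : T) =>
      let y := output u theta0 (E N) w in
      theta_reg sigma u (P (eta_hat N y)) y)
  (est_reg_measurable : forall N : nat, (n <= N)%N ->
      is_random_vector (est_reg N)) :
  cvg (scaled_excess_MSE Pr theta0 est_reg est_ML @ \oo) /\
  XMSE Pr theta0 est_reg est_ML =
    (sqnorm2 (XBias sigma P theta0 Sigma eta_star)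
     + \tr (XVar sigma P Sigma eta_star)
     + \tr (XVarHPE sigma alpha P theta0 Sigma eta_star))%:E.
Proof.
have lim := excess_risk_cvg sigma_gt0 Sigma_posdef rank_regressor cvg_Sigma
  E_gaussian P_posdef P_cont P_C2 eta_hat_argmin cond_i cond_ii cond_iii_min
  est_reg_measurable.
split; first by apply/cvg_ex; eexists; exact: lim.
exact: cvg_lim lim.
Qed.
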